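(* Let $n\ge 1$, $\alpha\ge 0$, and let $X=N+R$ be a formal Gevrey-$\alpha$ vector field on $(\mathbb{C}^n,0)$ with $N$ its nilpotent linear part and $R$ of order $\ge 2$. Then there exists a formal transformation $\Phi$ that is Gevrey-$(1+\alpha)$ and such that $\Phi_*X$ is a normal form (in the sense defined in the context) that is Gevrey-$(1+\alpha)$. If moreover $X$ is formally linearizable, then the transformation $\Phi$ and the corresponding normal form $\Phi_*X$ can be taken to be Gevrey-$\alpha$.
   Context: Gevrey: a formal power series $\sum_{l\ge 0}\sum_{|k|=l}a_kx^k$ in $x=(x_1,\dots,x_n)$ (with $k\in\mathbb{N}^n$, $|k|=k_1+\dots+k_n$) is Gevrey-$\alpha$ if there are $C,r>0$ such that $\sum_{|k|=l}|a_k|\le C r^l (l!)^\alpha$ for all $l\geq 0$. A formal vector field $X=\sum_{i=1}^n X_i\frac{\partial}{\partial x_i}$, or a formal map, is Gevrey-$\alpha$ if each of its components is. Nilpotent: a linear vector field $N$ is nilpotent if it acts (as a derivation) as a nilpotent linear operator on the space of homogeneous polynomials of degree $\delta$ for each $\delta\ge 1$; equivalently, after a linear change of coordinates, $N=\sum_{i=1}^{n-1}a_ix_{i+1}\frac{\partial}{\partial x_i}$ for some $a_i\in\mathbb{C}$. Transformations: a formal transformation is $\Phi=\Psi\circ Q$ with $Q$ an invertible linear map of $\mathbb{C}^n$ and $\Psi$ a formal map with $\Psi^{-1}=I+U$, where the formal series $U$ has order $\ge 2$. It acts on formal vector fields by $\Phi_*X=(D\Phi\cdot X)\circ\Phi^{-1}$.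 The vector field $X$ is formally linearizable if there is a formal transformation tangent to the identity carrying $X$ to its linear part $N$. Inner product: on the space $\mathcal{P}_d$ of homogeneous polynomials of degree $d$ in $n$ variables put $$\Big\langle\sum_{|\beta|=d}a_\beta x^\beta,\sum_{|\beta|=d}b_\beta x^\beta\Big\rangle=\sum_{|\beta|=d}a_\beta\overline{b_\beta}\,\frac{\beta!}{|\beta|!}.$$ Let $\mathcal{V}_\delta=\{\sum_i P_i\frac{\partial}{\partial x_i}: P_i\in\mathcal{P}_{\delta+1}\}$, with inner product $\langle V,W\rangle=\sum_i\langle V_i,W_i\rangle$. Standard linear part: a linear vector field $N_0$ is in standard block form if the coordinates are grouped into blocks $x^1,\dots,x^s$ with $x^j=(x^j_1,\dots,x^j_{k_j+1})$, $k_j\in\mathbb{N}=\{0,1,2,\dots\}$, $\sum_j(k_j+1)=n$, and $$N_0=\sum_{j=1}^s\sum_{i=1}^{k_j}\sqrt{i(k_j+1-i)}\;x^j_{i+1}\frac{\partial}{\partial x^j_i}$$ (blocks with $k_j=0$ contribute $0$). Every nilpotent linear vector field is linearly conjugate to one in standard block form. Normal form: a formal vector field $X'=N_0+R'$ with $N_0$ in standard block form and $R'=\sum_{\delta\ge 1}R'_{(\delta)}$, $R'_{(\delta)}\in\mathcal{V}_\delta$, is a normal form if $d_0^*(R'_{(\delta)})=0$ for every $\delta\ge 1$, where $d_0:\mathcal{V}_\delta\to\mathcal{V}_\delta$, $d_0(U)=[U,N_0]$, and $d_0^*$ is its adjoint for the inner product $\langle V,W\rangle=\sum_{i=1}^n\langle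 V_i,W_i\rangle$ on $\mathcal{V}_\delta$ (for $V=\sum_i V_i\frac{\partial}{\partial x_i}$, $W=\sum_i W_i\frac{\partial}{\partial x_i}$), in which $\langle V_i,W_i\rangle$ is the inner product $\langle\sum_{|\beta|=\delta+1}a_\beta x^\beta,\sum_{|\beta|=\delta+1}b_\beta x^\beta\rangle=\sum_{|\beta|=\delta+1}a_\beta\overline{b_\beta}\,\frac{\beta!}{|\beta|!}$ on $\mathcal{P}_{\delta+1}$. *)

(* Defs.v *)
From mathcomp Require Import all_boot all_order all_algebra.
From mathcomp Require Import reals complex mpoly.
(* Required without Import: some notations of mathcomp-analysis clash with
   those of mpoly, and only powR is needed. *)
From mathcomp Require exp.

Set Implicit Arguments.
Unset Strict Implicit.
Unset Printing Implicit Defensive.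

Import Order.TTheory GRing.Theory Num.Theory.
Local Open Scope ring_scope.
Local Open Scope complex_scope.

(* f : fps stands for \sum_k (f k) x^k; F : ftuple is either the formal vector
   field \sum_i F_i d/dx_i or the formal map (F_i)_i. *)
Definition fps (R : realType) (n : nat) := 'X_{1..n} -> R[i].
Definition ftuple (R : realType) (n : nat) := 'I_n -> fps R n.
Definition pvf (R : realType) (n : nat) := 'I_n -> {mpoly R[i][n]}.

Section FormalSeries.
Variables (R : realType) (n : nat).
Implicit Types (f g : fps R n) (F G X Y : ftuple R n) (V W : pvf R n).

Definition fps_of_mpoly (p : {mpoly R[i][n]}) : fps R n := fun m => p@_m.

Definition ftuple_of_pvf V : ftuple R n := fun i => fps_of_mpoly (V i).

Definition trunc (d : nat) f : {mpoly R[i][n]} :=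
  \sum_(m : 'X_{1..n < d.+1}) f m *: 'X_[m].

Definition fps_mul f g : fps R n :=
  fun m => (trunc (mdeg m) f * trunc (mdeg m) g)@_m.

Definition fps_deriv (j : 'I_n) f : fps R n :=
  fun m => f (m + U_(j))%MM *+ (m j).+1.

(* Meaningful when the G i have no constant term: then the coefficient of x^m
   in f o G only depends on the coefficients of f and G of degree <= |m|. *)
Definition fps_comp f G : fps R n :=
  fun m => (trunc (mdeg m) f
              \mPo [tuple trunc (mdeg m) (G i) | i < n])@_m.

Definition fadd F G : ftuple R n := fun i m => F i m + G i m.

Definition fcomp F G : ftuple R n := fun i => fps_comp (F i) G.

Definition flinear (Q : 'M[R[i]]_n) : ftuple R n :=
  ftuple_of_pvf (fun i => \sum_j Q i j *: 'X_j).

Definition fid : ftuple R n := flinear 1%:M.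

Definition order_ge (d : nat) F :=
  forall i m, (mdeg m < d)%N -> F i m = 0.

Definition hpart (d : nat) F : pvf R n :=
  fun i => \sum_(m : 'X_{1..n < d.+1} | mdeg m == d) F i m *: 'X_[m].

Definition gevrey (alpha : R) F :=
  forall i, exists B r : R, [/\ 0 < B, 0 < r &
    forall l : nat, \sum_(m : 'X_{1..n < l.+1} | mdeg m == l) `|F i m|
      <= (B * r ^+ l * exp.powR (l`!%N)%:R alpha)%:C].

Definition inverse_map F G :=
  [/\ order_ge 1 F, order_ge 1 G, fcomp F G = fid & fcomp G F = fid].

Definition formal_transformation F :=
  exists (Psi Psiinv U : ftuple R n) (Q : 'M[R[i]]_n),
    [/\ Q \in unitmx, order_ge 2 U, Psiinv = fadd fid U,
        inverse_map Psi Psiinv & F = fcomp Psi (flinear Q)].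

Definition tangent_to_id F := exists2 U, order_ge 2 U & F = fadd fid U.

Definition jacobian_apply F X : ftuple R n :=
  fun i m => \sum_j fps_mul (fps_deriv j (F i)) (X j) m.

(* Y = F_* X, with G = F^-1: inverses are unique, so F and X determine Y. *)
Definition is_pushforward F X Y :=
  exists2 G, inverse_map F G & Y = fcomp (jacobian_apply F X) G.

End FormalSeries.

Section VectorFields.
Variables (R : realType) (n : nat).
Implicit Types (p q : {mpoly R[i][n]}) (V W N : pvf R n).

Definition vf_apply V p : {mpoly R[i][n]} := \sum_j V j * p^`M(j).

Definition bracket V W : pvf R n :=
  fun i => vf_apply V (W i) - vf_apply W (V i).

(* The space V_d; membership in V_0 says that V is a linear vector field. *)
Definition in_V (d : nat) V := forall i, V i \is (d.+1).-homog.

Definition nilpotent_vf N :=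
  forall d : nat, (0 < d)%N ->
    exists k : nat, forall p, p \is d.-homog -> iter k (vf_apply N) p = 0.

Definition hinner (d : nat) p q : R[i] :=
  \sum_(b : 'X_{1..n < d.+1} | mdeg b == d)
    p@_b * (q@_b)^* * ((\prod_(i < n) (b i)`!)%N%:R / (d`!%N)%:R).

Definition vinner (d : nat) V W : R[i] := \sum_i hinner d.+1 (V i) (W i).

(* The adjoint of D : V_d -> V_d.  It exists and is unique on V_d, since V_d
   is finite dimensional and vinner is positive definite on it. *)
Definition is_adjoint (d : nat) (D Dadj : pvf R n -> pvf R n) :=
  (forall W, in_V d W -> in_V d (Dadj W)) /\
  (forall V W, in_V d V -> in_V d W ->
     vinner d (D V) W = vinner d V (Dadj W)).

(* x j i is the index of the coordinate x^j_{i+1}: positions inside a block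
   are counted from 0, so that x (j, i) |-> x (j, i+1) has weight
   sqrt((i+1)(k_j - i)).  Bijectivity of x says that the blocks partition the
   coordinates, hence that \sum_j (k_j + 1) = n. *)
Definition standard_form N :=
  exists (s : nat) (k : 'I_s -> nat) (x : forall j : 'I_s, 'I_(k j).+1 -> 'I_n),
    bijective (fun u : {j : 'I_s & 'I_(k j).+1} => x (tag u) (tagged u)) /\
    N = (fun v => \sum_(j < s)
           \sum_(i < k j | x j (widen_ord (leqnSn _) i) == v)
             (Num.sqrt (i.+1 * (k j - i))%N%:R : R)%:C
               *: 'X_(x j (lift ord0 i))).

Definition normal_form (Y : ftuple R n) :=
  exists (N0 : pvf R n) (S : ftuple R n),
    [/\ standard_form N0, order_ge 2 S, Y = fadd (ftuple_of_pvf N0) S &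
        forall d : nat, (0 < d)%N ->
          exists d0adj : pvf R n -> pvf R n,
            is_adjoint d (fun U => bracket U N0) d0adj /\
            d0adj (hpart d.+1 S) = (fun=> 0)].

Definition formally_linearizable (X : ftuple R n) N :=
  exists Phi : ftuple R n,
    [/\ formal_transformation Phi, tangent_to_id Phi
      & is_pushforward Phi X (ftuple_of_pvf N)].

End VectorFields.

(* Main.v *)
Require Import Defs.
From mathcomp Require Import all_boot all_order all_algebra.
From mathcomp Require Import reals complex mpoly.
From mathcomp Require Import spectral ring lra zify.
From mathcomp Require exp boolp.

Set Implicit Arguments.
Unset Strict Implicit.
Unset Printing Implicit Defensive.

Import Order.TTheory GRing.Theory Num.Theory.
Local Open Scope ring_scope.

(** Let [a] be the matrix of the linear part, brought to standard form by a
    linear map [P] obtained from rescaled Jordan chains, and let [S] be the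
    nonlinear part in the new coordinates. A map [I + U] conjugates a vector
    field [a + V] to [a + S] when
      [V - theta a U = S o (I + U) - DU.V],
    where [theta a U] is the bracket of [U] with the linear vector field of
    matrix [a]. The normal form condition asks in addition that [V] be killed,
    degree by degree, by the adjoint of [theta a], which for the given inner
    product is [theta] of the adjoint of [a].

    The first point is that this equation is solved without any loss. The
    square roots in the standard form make [a] and [a^*] generate a copy of
    the Lie algebra sl2, and [theta] is a representation; hence on each space
    of homogeneous vector fields the positive operator built from [theta a]
    and its adjoint has integer eigenvalues ([eigenvalue_int]). Its nonzero
    eigenvalues are thus at least 1, and every [W] is [theta a u + r] with [r]
    in the kernel of the adjoint and with [u] and [r] not larger than [W]
    ([sl2_decomposition], [homological_decomposition]). The right hand side
    above depends, in degree [d], only on the parts of [U] and [V] of degree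
    less than [d], so a contraction argument gives [U] and [V] together with a
    bound of their parts of degree [d] by those of [S o (I + U)] and of [DU.V],
    with a constant independent of [d] ([normalization]).

    The second point is that such a bound implies the Gevrey property
    ([gevrey_estimate]). The Bombieri norm is submultiplicative and a
    derivative multiplies it by at most the degree. Substitution in a
    Gevrey-[alpha] series preserves Gevrey-[alpha] growth, whereas the
    derivative in [DU.V] costs a factor of the order of the degree, which is
    compensated when the exponent of the factorial is at least 1
    ([gw_deriv]): this gives the order [1 + alpha].

    If the vector field is formally linearizable, so is [a + V]; its lowest
    nonzero part would then lie both in the image of [theta a] and in the
    kernel of the adjoint, so that [V = 0] ([linear_of_linearizable]). The
    term [DU.V] disappears and the same estimate gives the order [alpha].

    The transformation is [(I + U)^-1 o P]. The inverse [I + W] of [I + U]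
    satisfies [W = - U o (I + W)], and is therefore Gevrey by the same
    estimate without the derivative term. *)

(** * Order of vanishing of polynomials *)

Section Order.
Variables (n : nat) (A : comNzRingType).
Implicit Types (p q : {mpoly A[n]}) (s t : nat).

(** Membership in the [s]-th power of the ideal generated by the variables:
    a congruence up to degree [D] is [mord_ge D.+1 (p - q)]. *)
Definition mord_ge s p := forall m, (mdeg m < s)%N -> p@_m = 0.

Lemma mord_ge_le s t p : (s <= t)%N -> mord_ge t p -> mord_ge s p.
Proof. by move=> st pt m ms; apply: pt; apply: leq_trans ms st. Qed.

Lemma mord_ge0 p : mord_ge 0 p. Proof. by []. Qed.

Lemma mord_ge_zero s : mord_ge s 0.
Proof. by move=> m _; rewrite mcoeff0. Qed.

Lemma mord_geD s p q : mord_ge s p -> mord_ge s q -> mord_ge s (p + q).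
Proof. by move=> ps qs m ms; rewrite mcoeffD ps ?qs ?addr0. Qed.

Lemma mord_ge_sum (I : Type) (r : seq I) (P : pred I) (F : I -> {mpoly A[n]}) s :
  (forall i, P i -> mord_ge s (F i)) -> mord_ge s (\sum_(i <- r | P i) F i).
Proof.
by move=> Fs; elim/big_ind: _ => //; [apply: mord_ge_zero | apply: mord_geD].
Qed.

Lemma mord_geZ s c p : mord_ge s p -> mord_ge s (c *: p).
Proof. by move=> ps m ms; rewrite mcoeffZ ps ?mulr0. Qed.

Lemma mord_geM s t p q : mord_ge s p -> mord_ge t q -> mord_ge (s + t) (p * q).
Proof.
move=> ps qt m ms; rewrite mcoeffM big1 // => -[k1 k2] /= /eqP mE.
case: (ltnP (mdeg k1) s) => [/ps -> | k1s]; first by rewrite mul0r.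
rewrite qt ?mulr0 //; move/(congr1 (@mdeg n)): mE; rewrite mdegD; lia.
Qed.

Lemma mord_geMl s p q : mord_ge s q -> mord_ge s (p * q).
Proof. exact: (@mord_geM 0). Qed.

Lemma mord_geXn p k : mord_ge 1 p -> mord_ge k (p ^+ k).
Proof.
move=> p1; elim: k => [|k IHk]; first by move=> m; rewrite ltn0.
by rewrite exprS; apply: (@mord_geM 1).
Qed.

End Order.

Section OrderComp.
Variables (n k : nat) (A : comNzRingType).
Implicit Types (p : {mpoly A[n]}) (q : n.-tuple {mpoly A[k]}).

Lemma mord_ge_monomial q (m : 'X_{1..n}) :
    (forall i, mord_ge 1 (tnth q i)) ->
  mord_ge (mdeg m) (\prod_(i < n) tnth q i ^+ m i).
Proof.
move=> q1; rewrite mdegE; elim/big_ind2: _ => // [t1 p1 t2 p2|i _].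
  exact: mord_geM.
exact: mord_geXn.
Qed.

Lemma mord_ge_comp p q s :
    mord_ge s p -> (forall i, mord_ge 1 (tnth q i)) -> mord_ge s (p \mPo q).
Proof.
move=> ps q1; rewrite comp_mpolyE; apply: mord_ge_sum => m _.
have [/ps -> | sm] := ltnP (mdeg m) s; first by rewrite scale0r; apply: mord_ge_zero.
by apply: mord_geZ; apply: mord_ge_le sm _; apply: mord_ge_monomial.
Qed.

Lemma mord_ge_monomialB q q' e (m : 'X_{1..n}) :
    (forall i, mord_ge 1 (tnth q i)) -> (forall i, mord_ge 1 (tnth q' i)) ->
    (forall i, mord_ge e.+1 (tnth q i - tnth q' i)) ->
  mord_ge (e + mdeg m)
    (\prod_(i < n) tnth q i ^+ m i - \prod_(i < n) tnth q' i ^+ m i).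
Proof.
move=> q1 q'1 qq'.
pose close t (p p' : {mpoly A[k]}) :=
  [/\ mord_ge t p, mord_ge t p' & mord_ge (e + t) (p - p')].
have closeM t1 t2 (p1 p1' p2 p2' : {mpoly A[k]}) :
    close t1 p1 p1' -> close t2 p2 p2' -> close (t1 + t2)%N (p1 * p2) (p1' * p2').
  move=> [a a' aa'] [b b' bb']; split; do ?exact: mord_geM.
  have -> : p1 * p2 - p1' * p2' = (p1 - p1') * p2 + p1' * (p2 - p2') by ring.
  apply: mord_geD; first by rewrite addnA; apply: mord_geM.
  by rewrite addnCA; apply: mord_geM.
have close1 : close 0 1 1 by split=> //; rewrite subrr; apply: mord_ge_zero.
suff [] : close (mdeg m) (\prod_(i < n) tnth q i ^+ m i)
                         (\prod_(i < n) tnth q' i ^+ m i) by [].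
rewrite mdegE; elim/big_ind3: _ => // [???????|i _]; first exact: closeM.
elim: (m i) => [|j IHj] //; rewrite !exprS -add1n; apply: closeM => //.
by split=> //; rewrite addn1.
Qed.

(** A series of order [s] amplifies a perturbation of order [e] of the inner
    map to order [e + s]: this is why the fixed point equations below are
    triangular with respect to the degree. *)
Lemma mord_ge_compB p q q' e s :
    (0 < s)%N -> mord_ge s p ->
    (forall i, mord_ge 1 (tnth q i)) -> (forall i, mord_ge 1 (tnth q' i)) ->
    (forall i, mord_ge e.+1 (tnth q i - tnth q' i)) ->
  mord_ge (e + s) ((p \mPo q) - (p \mPo q')).
Proof.
move=> s0 ps q1 q'1 qq'; rewrite !comp_mpolyE -sumrB; apply: mord_ge_sum => m _.
rewrite -scalerBr; have [/ps -> | sm] := ltnP (mdeg m) s.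
  by rewrite scale0r; apply: mord_ge_zero.
apply: mord_geZ; apply: (@mord_ge_le _ _ _ (e + mdeg m)); first by rewrite leq_add2l.
exact: mord_ge_monomialB.
Qed.

Lemma mord_ge_compC p q q' e :
    (forall i, mord_ge 1 (tnth q i)) -> (forall i, mord_ge 1 (tnth q' i)) ->
    (forall i, mord_ge e (tnth q i - tnth q' i)) ->
  mord_ge e ((p \mPo q) - (p \mPo q')).
Proof.
case: e => // e q1 q'1 qq'.
pose c : {mpoly A[n]} := (p@_0%MM)%:MP.
have pE (r : n.-tuple {mpoly A[k]}) : p \mPo r = (p@_0%MM)%:MP + ((p - c) \mPo r).
  by rewrite comp_mpolyB comp_mpolyC addrC subrK.
rewrite (pE q) (pE q') opprD addrACA subrr add0r -addn1.
apply: mord_ge_compB => // m; rewrite ltnS leqn0 mdeg_eq0 => /eqP ->.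
by rewrite mcoeffB /c mcoeffC eqxx mulr1 subrr.
Qed.

End OrderComp.

Section Chain.
Variables (n k l : nat) (A : comNzRingType).

Lemma comp_mpolyA (p : {mpoly A[n]}) (q : n.-tuple {mpoly A[k]})
    (r : k.-tuple {mpoly A[l]}) :
  (p \mPo q) \mPo r = p \mPo [tuple tnth q i \mPo r | i < n].
Proof.
rewrite [p \mPo q]comp_mpolyE [RHS]comp_mpolyE raddf_sum; apply: eq_bigr => m _ /=.
rewrite comp_mpolyZ rmorph_prod; congr (_ *: _); apply: eq_bigr => i _.
by rewrite rmorphXn tnth_mktuple.
Qed.

Lemma mderiv_prod (I : finType) (F : I -> {mpoly A[k]}) j :
  (\prod_i F i)^`M(j) = \sum_i (F i)^`M(j) * \prod_(u | u != i) F u.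
Proof.
have H (r : seq I) : uniq r -> (\prod_(i <- r) F i)^`M(j) =
    \sum_(i <- r) (F i)^`M(j) * \prod_(u <- r | u != i) F u.
  elim: r => [_|i r IHr /= /andP[ir ur]].
    by rewrite !big_nil -mpolyC1 mderivC.
  rewrite !big_cons mderivM IHr // mulr_sumr eqxx /=; congr (_ + _).
    congr (_ * _); rewrite [LHS]big_seq_cond [RHS]big_seq_cond.
    by apply: eq_bigl => u; case: eqP => [->|]; rewrite ?(negbTE ir) ?andbT ?andbF.
  rewrite big_seq [RHS]big_seq; apply: eq_bigr => u ur'; rewrite big_cons.
  case: eqP => [iu|_]; first by rewrite iu ur' in ir.
  by rewrite mulrCA.
by rewrite H ?index_enum_uniq.
Qed.

Lemma mderivXn (p : {mpoly A[k]}) j e : (p ^+ e)^`M(j) = p^`M(j) * p ^+ e.-1 *+ e.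
Proof.
elim: e => [|e IHe]; first by rewrite expr0 -mpolyC1 mderivC mulr0n.
rewrite exprS mderivM IHe mulrS mulrnAr; congr (_ + _).
by case: e {IHe} => [|e]; rewrite ?mulr0n //= mulrCA exprS.
Qed.

Lemma mderiv_comp (p : {mpoly A[n]}) (q : n.-tuple {mpoly A[k]}) j :
  (p \mPo q)^`M(j) = \sum_i (p^`M(i) \mPo q) * (tnth q i)^`M(j).
Proof.
rewrite [in LHS](mpolyE p) (raddf_sum (comp_mpoly q)) /=.
rewrite (raddf_sum (mderiv j)) /=.
under [RHS]eq_bigr do rewrite [p in p^`M(_)]mpolyE (raddf_sum (mderiv _)) /= (raddf_sum (comp_mpoly q)) mulr_suml.
rewrite exchange_big; apply: eq_bigr => m _ /=.
rewrite comp_mpolyZ mderivZ comp_mpolyX mderiv_prod scaler_sumr.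
apply: eq_bigr => i _; rewrite mderivZ mderivX !comp_mpolyZ comp_mpolyX.
rewrite -scalerAl; congr (_ *: _).
rewrite mderivXn [X in _ = (_ *: X) * _](bigD1 i) //= mnmBE mnm1E eqxx subn1.
rewrite [X in _ = (_ *: (_ * X)) * _](eq_bigr (fun u => tnth q u ^+ m u)); last first.
  by move=> u ui; rewrite mnmBE mnm1E eq_sym (negbTE ui) subn0.
by rewrite scaler_nat !mulrnAl; congr (_ *+ _); ring.
Qed.

End Chain.

(** * Formal series and formal maps *)

Section FormalSeries.
Variables (R : realType) (n : nat).
Local Notation C := R[i].
Local Notation Id := (@fid R n).
Implicit Types (f g : fps R n) (F G H X Y : ftuple R n) (p q : {mpoly C[n]}).
Implicit Types (D e : nat) (m : 'X_{1..n}).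

Lemma trunc_coef d f m : (trunc d f)@_m = if (mdeg m <= d)%N then f m else 0.
Proof.
case: leqP => md; first by rewrite mcoeff_mpoly.
rewrite raddf_sum /= big1 // => k _; rewrite mcoeffZ mcoeffX.
case: eqP => [km|_]; last by rewrite mulr0.
by have := bmdeg k; rewrite km ltnS leqNgt md.
Qed.

(** Identities between formal series are obtained from the same identities
    between polynomials: all the operations are compatible with agreement up
    to degree [D]. *)
Definition approx D f p := forall m, (mdeg m <= D)%N -> f m = p@_m.

Lemma approx_trunc D f : approx D f (trunc D f).
Proof. by move=> m mD; rewrite trunc_coef mD. Qed.

Lemma approx_le D e f p : (D <= e)%N -> approx e f p -> approx D f p.
Proof. by move=> De fp m mD; apply: fp; apply: leq_trans mD De. Qed.

Lemma approxB D f p q : approx D f p -> approx D f q -> mord_ge D.+1 (p - q).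
Proof. by move=> fp fq m mD; rewrite mcoeffB -fp -?fq ?subrr. Qed.

Lemma approx_congr D f p q : approx D f p -> mord_ge D.+1 (p - q) -> approx D f q.
Proof.
by move=> fp pq m mD; rewrite fp //; apply/eqP; rewrite -subr_eq0 -mcoeffB pq.
Qed.

Lemma fps_eq f g : (forall D, exists2 p, approx D f p & approx D g p) -> f = g.
Proof.
by move=> fg; apply: boolp.funext => m; have [p -> // ->] := fg (mdeg m).
Qed.

Lemma ftuple_eq F G : (forall i m, F i m = G i m) -> F = G.
Proof. by move=> FG; apply: boolp.funext => i; apply: boolp.funext. Qed.

Lemma mord_ge_mulB e p p' q q' :
  mord_ge e (p - p') -> mord_ge e (q - q') -> mord_ge e (p * q - p' * q').
Proof.
move=> pp qq; have -> : p * q - p' * q' = q * (p - p') + p' * (q - q') by ring.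
by apply: mord_geD; apply: mord_geMl.
Qed.

Lemma approx_add D f g p q :
  approx D f p -> approx D g q -> approx D (fun m => f m + g m) (p + q).
Proof. by move=> fp gq m mD; rewrite mcoeffD fp ?gq. Qed.

Lemma approx_mul D f g p q :
  approx D f p -> approx D g q -> approx D (fps_mul f g) (p * q).
Proof.
move=> fp gq m mD; rewrite /fps_mul; apply/eqP; rewrite -subr_eq0 -mcoeffB.
apply/eqP; apply: (@mord_ge_mulB (mdeg m).+1) => //.
  by apply: (approxB (approx_trunc f)); apply: approx_le fp.
by apply: (approxB (approx_trunc g)); apply: approx_le gq.
Qed.

Lemma approx_deriv D f p j : approx D.+1 f p -> approx D (fps_deriv j f) p^`M(j).
Proof.
move=> fp m mD; rewrite mcoeff_deriv /fps_deriv fp //.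
by rewrite mdegD mdeg1 addn1.
Qed.

Lemma approx_sum (I : finType) D (f : I -> fps R n) (p : I -> {mpoly C[n]}) :
  (forall i, approx D (f i) (p i)) -> approx D (fun m => \sum_i f i m) (\sum_i p i).
Proof. by move=> fp m mD; rewrite raddf_sum /=; apply: eq_bigr => i _; apply: fp. Qed.

Lemma approx_comp D f F p (q : n.-tuple {mpoly C[n]}) :
    order_ge 1 F -> (forall i, mord_ge 1 (tnth q i)) ->
    approx D f p -> (forall i, approx D (F i) (tnth q i)) ->
  approx D (fps_comp f F) (p \mPo q).
Proof.
move=> F1 q1 fp Fq m mD; rewrite /fps_comp; apply/eqP; rewrite -subr_eq0 -mcoeffB.
set t := [tuple _ | i < n]; set P := trunc _ f.
have t1 i : mord_ge 1 (tnth t i).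
  by move=> k k0; rewrite tnth_mktuple trunc_coef F1 ?if_same.
have -> : (P \mPo t) - (p \mPo q) = ((P - p) \mPo t) + ((p \mPo t) - (p \mPo q)).
  by rewrite comp_mpolyB addrA subrK.
apply/eqP; apply: (@mord_geD _ _ (mdeg m).+1) => //.
  by apply: mord_ge_comp => //; apply: (approxB (approx_trunc _)); apply: approx_le fp.
apply: mord_ge_compC => // i; rewrite tnth_mktuple.
by apply: (approxB (approx_trunc _)); apply: approx_le (Fq i).
Qed.

Definition trunc_map D F := [tuple trunc D (F i) | i < n].

Lemma trunc_map_approx D F i : approx D (F i) (tnth (trunc_map D F) i).
Proof. by rewrite tnth_mktuple; apply: approx_trunc. Qed.

Lemma trunc_map_mord D F i : order_ge 1 F -> mord_ge 1 (tnth (trunc_map D F) i).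
Proof. by move=> F1 m m0; rewrite tnth_mktuple trunc_coef F1 ?if_same. Qed.

Lemma approx_comp_trunc D f F :
  order_ge 1 F -> approx D (fps_comp f F) (trunc D f \mPo trunc_map D F).
Proof.
move=> F1; apply: (approx_comp F1) => [i||i].
- exact: trunc_map_mord.
- exact: approx_trunc.
- exact: trunc_map_approx.
Qed.

Lemma order_ge_le s t F : (s <= t)%N -> order_ge t F -> order_ge s F.
Proof. by move=> st Ft i m ms; apply: Ft; apply: leq_trans ms st. Qed.

Lemma order_ge_fadd s F G : order_ge s F -> order_ge s G -> order_ge s (fadd F G).
Proof. by move=> Fs Gs i m ms; rewrite /fadd Fs ?Gs ?addr0. Qed.

Lemma order_ge_fcomp s F G : order_ge s F -> order_ge 1 G -> order_ge s (fcomp F G).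
Proof.
move=> Fs G1 i m ms; rewrite /fcomp (approx_comp_trunc _ G1 (leqnn _)).
apply: (mord_ge_comp (s := s)) => // [k ks|j]; last exact: trunc_map_mord.
by rewrite trunc_coef Fs ?if_same.
Qed.

Lemma fcompA F G H : order_ge 1 G -> order_ge 1 H ->
  fcomp (fcomp F G) H = fcomp F (fcomp G H).
Proof.
move=> G1 H1; apply: boolp.funext => i; apply: fps_eq => D.
have GH1 : order_ge 1 (fcomp G H) by apply: order_ge_fcomp.
exists ((trunc D (F i) \mPo trunc_map D G) \mPo trunc_map D H).
  apply: (approx_comp H1) => [j||j].
  - exact: trunc_map_mord.
  - exact: approx_comp_trunc.
  - exact: trunc_map_approx.
rewrite comp_mpolyA; apply: (approx_comp GH1) => [j||j]; rewrite ?tnth_mktuple.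
- apply: mord_ge_comp => [|k]; last exact: trunc_map_mord.
  by rewrite -[trunc D (G j)](tnth_mktuple (fun j => trunc D (G j))); apply: trunc_map_mord.
- exact: approx_trunc.
- exact: approx_comp_trunc.
Qed.

Lemma fcomp_faddl F F' G : order_ge 1 G ->
  fcomp (fadd F F') G = fadd (fcomp F G) (fcomp F' G).
Proof.
move=> G1; apply: boolp.funext => i; apply: fps_eq => D.
exists ((trunc D (F i) + trunc D (F' i)) \mPo trunc_map D G).
  apply: (approx_comp G1) => [j||j]; first exact: trunc_map_mord.
    by apply: approx_add; apply: approx_trunc.
  exact: trunc_map_approx.
by rewrite comp_mpolyD; apply: approx_add; apply: approx_comp_trunc.
Qed.

(** Left composition with the linear map [Q], in a form that makes sense for
    vector fields with a constant term too. *)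
Definition lcomb (Q : 'M[C]_n) F : ftuple R n := fun i m => \sum_j Q i j * F j m.

Lemma flinear_coef (Q : 'M[C]_n) i m :
  flinear Q i m = \sum_j Q i j * (m == U_(j)%MM)%:R.
Proof.
rewrite /flinear /ftuple_of_pvf /fps_of_mpoly raddf_sum; apply: eq_bigr => j _ /=.
by rewrite mcoeffZ mcoeffX eq_sym.
Qed.

Lemma fid_coef i m : Id i m = (m == U_(i)%MM)%:R.
Proof.
rewrite [LHS](flinear_coef 1%:M) (bigD1 i isT) /= [X in _ + X]big1 => [|j ji].
  by rewrite mxE eqxx mul1r addr0.
by rewrite mxE eq_sym (negbTE ji) mul0r.
Qed.

Lemma flinear_lcomb Q : flinear Q = lcomb Q Id.
Proof.
by apply: ftuple_eq => i m; rewrite flinear_coef; apply: eq_bigr => j _; rewrite fid_coef.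
Qed.

Lemma order_ge_flinear (Q : 'M[C]_n) : order_ge 1 (flinear Q).
Proof.
move=> i m; rewrite ltnS leqn0 mdeg_eq0 => /eqP ->; rewrite flinear_coef big1 // => j _.
by rewrite eq_sym mnm1_eq0 mulr0.
Qed.

Lemma order_ge_fid : order_ge 1 Id. Proof. exact: order_ge_flinear. Qed.

Lemma order_ge_lcomb s Q F : order_ge s F -> order_ge s (lcomb Q F).
Proof. by move=> Fs i m ms; apply: big1 => j _; rewrite Fs ?mulr0. Qed.

Lemma approx_flinear D (Q : 'M[C]_n) i : approx D (flinear Q i) (\sum_j Q i j *: 'X_j).
Proof. by []. Qed.

Lemma fcomp_flinear Q F : order_ge 1 F -> fcomp (flinear Q) F = lcomb Q F.
Proof.
move=> F1; apply: boolp.funext => i; apply: fps_eq => D.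
exists ((\sum_j Q i j *: 'X_j) \mPo trunc_map D F).
  apply: (approx_comp F1) => // j; [exact: trunc_map_mord | exact: trunc_map_approx].
move=> m mD; rewrite (raddf_sum (comp_mpoly _)) (raddf_sum (mcoeff m)).
apply: eq_bigr => j _ /=.
rewrite comp_mpolyZ mcoeffZ comp_mpolyXU -tnth_nth.
by rewrite -(@trunc_map_approx D F).
Qed.

Lemma lcomb1 F : lcomb 1%:M F = F.
Proof.
apply: ftuple_eq => i m; rewrite /lcomb (bigD1 i isT) /= [X in _ + X]big1 => [|j ji].
  by rewrite mxE eqxx mul1r addr0.
by rewrite mxE eq_sym (negbTE ji) mul0r.
Qed.

Lemma lcombM P Q F : lcomb P (lcomb Q F) = lcomb (P *m Q) F.
Proof.
apply: ftuple_eq => i m; rewrite /lcomb.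
under eq_bigr do rewrite mulr_sumr.
rewrite exchange_big; apply: eq_bigr => j _ /=; rewrite mxE mulr_suml.
by apply: eq_bigr => k _; rewrite mulrA.
Qed.

Lemma lcomb_fadd Q F G : lcomb Q (fadd F G) = fadd (lcomb Q F) (lcomb Q G).
Proof.
apply: ftuple_eq => i m; rewrite /lcomb /fadd -big_split.
by apply: eq_bigr => j _; rewrite mulrDr.
Qed.

Lemma fcomp_idl F : order_ge 1 F -> fcomp Id F = F.
Proof. by move=> F1; rewrite fcomp_flinear // lcomb1. Qed.

Lemma fcomp_idr F : fcomp F Id = F.
Proof.
apply: boolp.funext => i; apply: fps_eq => D.
exists (trunc D (F i) \mPo [tuple 'X_i | i < n]).
  apply: (approx_comp order_ge_fid) => [j||j]; rewrite ?tnth_mktuple.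
  - move=> m; rewrite ltnS leqn0 mdeg_eq0 => /eqP ->.
    by rewrite mcoeffX mnm1_eq0.
  - exact: approx_trunc.
  - by move=> m _; rewrite fid_coef mcoeffX eq_sym.
by rewrite comp_mpoly_id; apply: approx_trunc.
Qed.

Lemma flinear_mul (P Q : 'M[C]_n) : fcomp (flinear P) (flinear Q) = flinear (P *m Q).
Proof.
by rewrite (fcomp_flinear P (order_ge_flinear Q)) !flinear_lcomb lcombM.
Qed.

Lemma approx_jacobian D F X i p (x : 'I_n -> {mpoly C[n]}) :
    approx D.+1 (F i) p -> (forall j, approx D (X j) (x j)) ->
  approx D (jacobian_apply F X i) (\sum_j p^`M(j) * x j).
Proof.
move=> Fp Xx; apply: approx_sum => j; apply: approx_mul => //.
exact: approx_deriv.
Qed.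

(** The chain rule, in the form used throughout: if [G] semi-conjugates [Y]
    to [X], then [F o G] transports [Y] as [F] transports [X]. *)
Lemma jacobian_fcomp F G X Y :
    order_ge 1 G -> jacobian_apply G Y = fcomp X G ->
  jacobian_apply (fcomp F G) Y = fcomp (jacobian_apply F X) G.
Proof.
move=> G1 GYX; apply: boolp.funext => i; apply: fps_eq => D.
pose f := trunc D.+1 (F i); pose q := trunc_map D.+1 G.
have q1 j : mord_ge 1 (tnth q j) by apply: trunc_map_mord.
have Gq j : approx D (G j) (tnth q j).
  by apply: (approx_le (leqnSn D)); apply: trunc_map_approx.
pose x j := trunc D (X j); pose y j := trunc D (Y j).
exists (\sum_k (f^`M(k) \mPo q) * (x k \mPo q)).
  apply: (@approx_congr _ _ (\sum_j (f \mPo q)^`M(j) * y j)).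
    by apply: approx_jacobian => [|j]; [apply: approx_comp_trunc | apply: approx_trunc].
  have -> : \sum_j (f \mPo q)^`M(j) * y j =
      \sum_k (f^`M(k) \mPo q) * \sum_j (tnth q k)^`M(j) * y j.
    under eq_bigr do rewrite mderiv_comp mulr_suml.
    rewrite exchange_big; apply: eq_bigr => k _ /=; rewrite mulr_sumr.
    by apply: eq_bigr => j _; rewrite mulrA.
  rewrite -sumrB; apply: mord_ge_sum => k _; rewrite -mulrBr; apply: mord_geMl.
  apply: (@approxB _ (fcomp X G k)).
    rewrite -GYX; apply: approx_jacobian => [|j]; last exact: approx_trunc.
    exact: trunc_map_approx.
  by apply: (approx_comp G1) => //; apply: approx_trunc.
rewrite (eq_bigr (fun k => (f^`M(k) * x k) \mPo q)) => [|k _]; last by rewrite rmorphM.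
rewrite -raddf_sum; apply: (approx_comp G1) => //.
by apply: approx_jacobian => [|j]; apply: approx_trunc.
Qed.

Lemma approx_lcomb D Q F i (p : 'I_n -> {mpoly C[n]}) : (forall j, approx D (F j) (p j)) ->
  approx D (lcomb Q F i) (\sum_j Q i j *: p j).
Proof.
move=> Fp m mD; rewrite raddf_sum; apply: eq_bigr => j _ /=.
by rewrite mcoeffZ -Fp.
Qed.

Lemma jacobian_lcomb Q F Y : jacobian_apply (lcomb Q F) Y = lcomb Q (jacobian_apply F Y).
Proof.
apply: boolp.funext => i; apply: fps_eq => D.
exists (\sum_j (\sum_k Q i k *: trunc D.+1 (F k))^`M(j) * trunc D (Y j)).
  apply: approx_jacobian => [|j]; last exact: approx_trunc.
  by apply: approx_lcomb => j; apply: approx_trunc.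
have key (p y : 'I_n -> {mpoly C[n]}) : \sum_j (\sum_k Q i k *: p k)^`M(j) * y j =
    \sum_k Q i k *: \sum_j (p k)^`M(j) * y j.
  under [LHS]eq_bigr => j _ do rewrite (raddf_sum (mderiv j)) mulr_suml.
  rewrite exchange_big; apply: eq_bigr => k _ /=; rewrite scaler_sumr.
  by apply: eq_bigr => j _; rewrite mderivZ scalerAl.
rewrite key.
by apply: approx_lcomb => k; apply: approx_jacobian => [|j]; apply: approx_trunc.
Qed.

Lemma jacobian_fid Y : jacobian_apply Id Y = Y.
Proof.
apply: boolp.funext => i; apply: fps_eq => D.
exists (\sum_j ('X_i : {mpoly C[n]})^`M(j) * trunc D (Y j)).
  apply: approx_jacobian => [|j]; last exact: approx_trunc.
  by move=> m _; rewrite fid_coef mcoeffX eq_sym.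
rewrite (bigD1 i isT) /= [X in _ + X]big1 => [|j ji]; rewrite mderivX mnm1E.
  have -> : (U_(i) - U_(i))%MM = 0%MM :> 'X_{1..n}.
    by apply/mnmP => k; rewrite mnmBE subnn mnm0E.
  by rewrite eqxx scale1r mpolyX0 mul1r addr0; apply: approx_trunc.
by rewrite eq_sym (negbTE ji) scale0r mul0r.
Qed.

(** By the chain rule it is enough to know that the inverse [G] of [Phi]
    transports [Y] to [X], an equation that does not involve [Phi]. *)
Lemma is_pushforward_of_inverse Phi G X Y :
  inverse_map Phi G -> jacobian_apply G Y = fcomp X G -> is_pushforward Phi X Y.
Proof.
move=> [Phi1 G1 PG GP] GY; exists G; first by split.
by rewrite -(jacobian_fcomp _ G1 GY) PG jacobian_fid.
Qed.

Lemma pushforward_jacobian Phi X Y :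
  is_pushforward Phi X Y -> jacobian_apply Phi X = fcomp Y Phi.
Proof. by move=> [G [Phi1 G1 PG GP] ->]; rewrite fcompA // GP fcomp_idr. Qed.

End FormalSeries.

(** * The Bombieri norm *)

Section CauchySchwarz.
Variables (R : realType) (I : Type).
Implicit Types (r : seq I) (P : pred I) (a b w : I -> R).

Lemma cauchy_schwarz r P a b :
  (\sum_(i <- r | P i) a i * b i) ^+ 2 <=
  (\sum_(i <- r | P i) a i ^+ 2) * (\sum_(i <- r | P i) b i ^+ 2).
Proof.
elim: r => [|i r IHr]; first by rewrite !big_nil expr0n mul0r.
rewrite !big_cons; case: (P i) => //; move: IHr.
set S := \sum_(_ <- _ | _) _ * _; set A := \sum_(_ <- _ | _) a _ ^+ 2.
set B := \sum_(_ <- _ | _) b _ ^+ 2; move: (a i) (b i) => x y IHr.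
have A0 : 0 <= A by apply: sumr_ge0 => j _; apply: sqr_ge0.
have B0 : 0 <= B by apply: sumr_ge0 => j _; apply: sqr_ge0.
have cross : 2 * (S * (x * y)) <= A * y ^+ 2 + B * x ^+ 2.
  apply: le_trans (ler_norm _) _; rewrite -[leRHS]ger0_norm; last first.
    by rewrite addr_ge0 // mulr_ge0 // sqr_ge0.
  rewrite -ler_sqr ?nnegrE // !real_normK ?num_real //.
  have -> : (A * y ^+ 2 + B * x ^+ 2) ^+ 2 =
    (2 * (S * (x * y))) ^+ 2 + ((A * y ^+ 2 - B * x ^+ 2) ^+ 2
       + 4 * (x * y) ^+ 2 * (A * B - S ^+ 2)) by ring.
  rewrite lerDl addr_ge0 ?sqr_ge0 // mulr_ge0 ?subr_ge0 //.
  by rewrite mulr_ge0 ?sqr_ge0.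
have -> : (x * y + S) ^+ 2 = S ^+ 2 + 2 * (S * (x * y)) + x ^+ 2 * y ^+ 2 by ring.
have -> : (x ^+ 2 + A) * (y ^+ 2 + B) =
  A * B + (A * y ^+ 2 + B * x ^+ 2) + x ^+ 2 * y ^+ 2 by ring.
by rewrite lerD2r lerD.
Qed.

Definition l2 r w a := Num.sqrt (\sum_(i <- r) w i * a i ^+ 2).

Lemma l2_ge0 r w a : 0 <= l2 r w a. Proof. exact: sqrtr_ge0. Qed.

Lemma l2_sqr r w a : (forall i, 0 <= w i) -> l2 r w a ^+ 2 = \sum_(i <- r) w i * a i ^+ 2.
Proof.
by move=> w0; rewrite sqr_sqrtr // sumr_ge0 // => i _; rewrite mulr_ge0 ?sqr_ge0.
Qed.

Lemma l2D r w a b : (forall i, 0 <= w i) ->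
  l2 r w (fun i => a i + b i) <= l2 r w a + l2 r w b.
Proof.
move=> w0; rewrite -ler_sqr ?nnegrE ?addr_ge0 ?l2_ge0 // sqrrD !l2_sqr //.
have -> : \sum_(i <- r) w i * (a i + b i) ^+ 2 =
   \sum_(i <- r) w i * a i ^+ 2 + (\sum_(i <- r) w i * (a i * b i)) *+ 2
   + \sum_(i <- r) w i * b i ^+ 2.
  rewrite -sumrMnl -!big_split; apply: eq_bigr => i _ /=.
  by ring.
rewrite lerD2r lerD2l lerMn2r orFb.
apply: le_trans (ler_norm _) _; rewrite -[leRHS]ger0_norm ?mulr_ge0 ?l2_ge0 //.
rewrite -ler_sqr ?nnegrE // !real_normK ?num_real // exprMn !l2_sqr //.
pose s i := Num.sqrt (w i); have sE i : s i ^+ 2 = w i by rewrite sqr_sqrtr.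
rewrite (eq_bigr (fun i => (s i * a i) * (s i * b i))) => [|i _]; last first.
  by rewrite -sE; ring.
apply: le_trans (cauchy_schwarz _ _ _ _) _.
by under eq_bigr do rewrite exprMn sE; under [X in _ * X <= _]eq_bigr do rewrite exprMn sE.
Qed.

Lemma l2_0 r w : l2 r w (fun=> 0) = 0.
Proof. by rewrite /l2 big1 ?sqrtr0 // => i _; rewrite expr0n mulr0. Qed.

Lemma l2_sum (J : Type) (s : seq J) (Q : pred J) r w (c : J -> I -> R) :
    (forall i, 0 <= w i) ->
  l2 r w (fun i => \sum_(j <- s | Q j) c j i) <= \sum_(j <- s | Q j) l2 r w (c j).
Proof.
move=> w0; elim: s => [|j s IHs].
  by rewrite big_nil /l2 big1 ?sqrtr0 // => i _; rewrite big_nil expr0n mulr0.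
rewrite big_cons; case: ifPn => Qj; last first.
  apply: le_trans IHs; rewrite /l2 (eq_bigr (fun i => w i * (\sum_(j <- s | Q j) c j i) ^+ 2)) //.
  by move=> i _; rewrite big_cons (negbTE Qj).
apply: le_trans (lerD (lexx _) IHs); apply: le_trans (l2D _ _ _ w0).
rewrite /l2 (eq_bigr (fun i => w i * (c j i + \sum_(j <- s | Q j) c j i) ^+ 2)) //.
by move=> i _; rewrite big_cons Qj.
Qed.

End CauchySchwarz.

Lemma l2_le (R : realType) (I : eqType) (r : seq I) (w a b : I -> R) :
    (forall i, 0 <= w i) -> {in r, forall i, `|a i| <= b i} ->
  l2 r w a <= l2 r w b.
Proof.
move=> w0 ab; rewrite ler_sqrt; last first.
  by apply: sumr_ge0 => i _; rewrite mulr_ge0 ?sqr_ge0.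
rewrite big_seq [leRHS]big_seq; apply: ler_sum => i ir.
rewrite ler_wpM2l // -[a i ^+ 2]real_normK ?num_real // ler_sqr ?nnegrE ?ab //.
exact: le_trans (normr_ge0 _) (ab i ir).
Qed.

Section Monomials.
Variable n : nat.
Implicit Types (m k : 'X_{1..n}) (d : nat).

(** The monomials of degree [d] as a sequence: unlike a range in the type of
    monomials of bounded degree, it does not depend on a bound, so that sums
    taken from different truncations can be compared. *)
Definition mons d : seq 'X_{1..n} :=
  [seq val u | u <- enum {: 'X_{1..n < d.+1}} & mdeg (val u) == d].

Lemma mem_mons d m : (m \in mons d) = (mdeg m == d).
Proof.
apply/mapP/eqP => [[k]|md]; first by rewrite mem_filter => /andP[/eqP kd _] ->.
have mb : (mdeg m < d.+1)%N by rewrite md.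
by exists (BMultinom mb) => //; rewrite mem_filter mem_enum /= md eqxx.
Qed.

Lemma mons_uniq d : uniq (mons d).
Proof. by rewrite map_inj_uniq; [rewrite filter_uniq ?enum_uniq | apply: val_inj]. Qed.

Lemma big_mons (T : Type) (z : T) (op : Monoid.com_law z) b d (F : 'X_{1..n} -> T) :
    (d < b)%N ->
  \big[op/z]_(m : 'X_{1..n < b} | mdeg m == d) F m = \big[op/z]_(m <- mons d) F m.
Proof.
move=> db; rewrite -[LHS]big_filter.
rewrite -(big_map (fun u : 'X_{1..n < b} => val u) xpredT F) /=.
apply: perm_big; apply: uniq_perm; rewrite ?mons_uniq //.
  by rewrite map_inj_uniq; [rewrite filter_uniq ?index_enum_uniq | apply: val_inj].
move=> m; rewrite mem_mons; apply/mapP/eqP => [[k]|md].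
  by rewrite mem_filter => /andP[/eqP kd _] ->.
have mb : (mdeg m < b)%N by rewrite md.
by exists (BMultinom mb) => //; rewrite mem_filter mem_index_enum /= md eqxx.
Qed.

Lemma big_mons_degree (V : nmodType) b (F : 'X_{1..n} -> V) :
  \sum_(m : 'X_{1..n < b}) F m = \sum_(d < b) \sum_(m <- mons d) F m.
Proof.
rewrite (partition_big (fun m : 'X_{1..n < b} => Ordinal (bmdeg m)) xpredT) //=.
by apply: eq_bigr => d _; rewrite -(big_mons _ _ (ltn_ord d)).
Qed.

Lemma mcoeffM_mons (A : comNzRingType) (p q : {mpoly A[n]}) m :
  (p * q)@_m = \sum_(a < (mdeg m).+1) \sum_(k <- mons a) \sum_(l <- mons (mdeg m - a))
     (if (k + l)%MM == m then p@_k * q@_l else 0).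
Proof.
rewrite mcoeffM big_mkcond /=.
rewrite -(pair_bigA _ (fun k l : 'X_{1..n < (mdeg m).+1} =>
  if m == (k + l)%MM then p@_k * q@_l else 0)) /=.
rewrite (@big_mons_degree _ _ (fun k => \sum_(l : 'X_{1..n < (mdeg m).+1})
  if m == (k + l)%MM then p@_k * q@_l else 0)).
apply: eq_bigr => a _; rewrite big_seq [RHS]big_seq; apply: eq_bigr => k.
rewrite mem_mons => /eqP ka.
rewrite (@big_mons_degree _ _ (fun l => if m == (k + l)%MM then p@_k * q@_l else 0)).
have lt_ma : (mdeg m - a < (mdeg m).+1)%N by rewrite ltnS leq_subr.
rewrite (bigD1 (Ordinal lt_ma)) //= [X in _ + X]big1 ?addr0 => [|b bma].
  by apply: eq_bigr => l _; rewrite eq_sym.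
rewrite big_seq big1 // => l; rewrite mem_mons => /eqP lb; case: eqP => // mE.
case/eqP: bma; apply: val_inj => /=.
by move: (congr1 (@mdeg n) mE) (ltn_ord a); rewrite mdegD ka lb; lia.
Qed.

Variable R : realType.

Definition multin m : R := (mdeg m)`!%:R / (\prod_(i < n) (m i)`!)%:R.

(** The weight of the Bombieri norm. *)
Definition bweight m : R := (\prod_(i < n) (m i)`!)%:R / (mdeg m)`!%:R.

Lemma prod_fact_gt0 m : (0 < \prod_(i < n) (m i)`!)%N.
Proof. by rewrite prodn_gt0 // => i; apply: fact_gt0. Qed.

Lemma bweight_gt0 m : 0 < bweight m.
Proof. by rewrite divr_gt0 ?ltr0n ?fact_gt0 ?prod_fact_gt0. Qed.

Lemma bweight_ge0 m : 0 <= bweight m. Proof. exact/ltW/bweight_gt0. Qed.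

Lemma bweightK m : bweight m * multin m = 1.
Proof.
rewrite /bweight /multin mulrA divfK ?divff // pnatr_eq0 -lt0n ?prod_fact_gt0 //.
by rewrite fact_gt0.
Qed.

Lemma bweightV m : multin m = (bweight m)^-1.
Proof. by rewrite -[multin m](mulKf (lt0r_neq0 (bweight_gt0 m))) bweightK mulr1. Qed.

Lemma bweightU m i : (m i).+1%:R * bweight m = (mdeg m).+1%:R * bweight (m + U_(i))%MM.
Proof.
rewrite /bweight mdegD mdeg1 addn1 factS.
have -> : (\prod_(j < n) ((m + U_(i))%MM j)`! = (m i).+1 * \prod_(j < n) (m j)`!)%N.
  rewrite (bigD1 i) //= [in RHS](bigD1 i) //= mnmDE mnm1E eqxx addn1 factS -mulnA.
  congr (_ * (_ * _))%N; apply: eq_bigr => j ji.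
  by rewrite mnmDE mnm1E eq_sym (negbTE ji) addn0.
rewrite !natrM; have f0 : (mdeg m)`!%:R != 0 :> R by rewrite pnatr_eq0 -lt0n fact_gt0.
have d0 : (mdeg m).+1%:R != 0 :> R by rewrite pnatr_eq0.
by move: (mdeg m).+1%:R d0 => d d0; field; rewrite f0 d0.
Qed.

Lemma leq_fact_mul a b : (a`! * b`! <= (a + b)`!)%N.
Proof. by rewrite -(bin_fact (leq_addr b a)) addKn leq_pmull // bin_gt0 leq_addr. Qed.

Lemma bweight_le1 m : bweight m <= 1.
Proof.
rewrite ler_pdivrMr ?mul1r ?ltr0n ?fact_gt0 // ler_nat mdegE.
elim/big_ind2: _ => // a b c d ab cd.
by apply: leq_trans (leq_fact_mul _ _); apply: leq_mul.
Qed.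

(** The powers of the sum of the variables are generating functions of the
    multinomial coefficients; the two summation formulas below are obtained by
    multiplying two of them, and by evaluating one at [(1, .., 1)]. *)
Lemma mcoeff_sumX d m :
  ((\sum_(i < n) 'X_i : {mpoly R[n]}) ^+ d)@_m = if mdeg m == d then multin m else 0.
Proof.
elim: d m => [|d IHd] m.
  rewrite expr0 mcoeff1 mdeg_eq0; case: eqP => [->|//].
  by rewrite /multin mdeg0 big1 ?divr1 // => i _; rewrite mnm0E.
have [i mi | m0] := pickP (fun i => (0 < m i)%N); last first.
  have -> : m = 0%MM by apply/mnmP => i; rewrite mnm0E; have := m0 i; case: (m i).
  rewrite mdeg0 /= exprS mcoeffM big1 // => -[k l] _ /=.
  rewrite raddf_sum /= big1 ?mul0r // => i _; rewrite mcoeffX.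
  case: eqP => // kE; have := bmdeg k.
  by rewrite -kE mdeg1 mdeg0.
pose m' := (m - U_(i))%MM; have mE : m = (m' + U_(i))%MM.
  by rewrite submK //; apply/mnm_lepP => j; rewrite mnm1E; case: eqP => [<-|].
have := congr1 (mcoeff m') (mderivXn (\sum_(i < n) 'X_i : {mpoly R[n]}) i d.+1).
rewrite mcoeff_deriv -mE mcoeffMn /=.
have -> : (\sum_(i < n) 'X_i : {mpoly R[n]})^`M(i) = 1.
  rewrite raddf_sum /= (bigD1 i) //= big1 => [|j ji]; rewrite mderivX mnm1E.
    have -> : (U_(i) - U_(i))%MM = 0%MM :> 'X_{1..n}.
      by apply/mnmP => k; rewrite mnmBE subnn mnm0E.
    by rewrite eqxx scale1r mpolyX0 addr0.
  by rewrite (negbTE ji) scale0r.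
rewrite mul1r IHd => e; apply: (@mulIf _ (m' i).+1%:R); first by rewrite pnatr_eq0.
rewrite mulr_natr e mE mdegD mdeg1 addn1 eqSS; case: eqP => [<-|]; last by rewrite mul0rn mul0r.
rewrite !bweightV -(mulr_natr _ (mdeg m').+1).
have := bweightU m' i; have := bweight_gt0 m'; have := bweight_gt0 (m' + U_(i))%MM.
move: (bweight _) (bweight _) => x y x0 y0 E.
move: (m' i).+1%:R (mdeg m').+1%:R E => u v E.
apply: (@mulIf _ (x * y)); first by rewrite mulf_neq0 ?gt_eqF.
rewrite (_ : _ * (x * y) = v * y); last by field; rewrite gt_eqF.
by rewrite -E; field; rewrite gt_eqF.
Qed.

Lemma vandermonde_multin a b m : mdeg m = (a + b)%N ->
  \sum_(k <- mons a) \sum_(l <- mons b)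
    (if (k + l)%MM == m then multin k * multin l else 0) = multin m.
Proof.
move=> mab; set X := \sum_(i < n) 'X_i : {mpoly R[n]}.
have := mcoeffM_mons (X ^+ a) (X ^+ b) m.
rewrite -exprD mcoeff_sumX mab eqxx => ->.
have lt_a : (a < (mdeg m).+1)%N by rewrite mab ltnS leq_addr.
rewrite -mab (bigD1 (Ordinal lt_a)) //= [X in _ = _ + X]big1 => [|c ca].
  rewrite addr0 mab addKn big_seq [RHS]big_seq; apply: eq_bigr => k; rewrite mem_mons => ka.
  rewrite big_seq [RHS]big_seq; apply: eq_bigr => l; rewrite mem_mons => lb.
  by rewrite !mcoeff_sumX ka lb.
rewrite big_seq big1 // => k; rewrite mem_mons => /eqP kc; rewrite big1 // => l _.
rewrite mcoeff_sumX kc; case: (nat_of_ord c =P a) => [cE|_]; last by rewrite mul0r if_same.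
by case/eqP: ca; apply: val_inj.
Qed.

Lemma sum_multin d : \sum_(m <- mons d) multin m = n%:R ^+ d.
Proof.
set X := \sum_(i < n) 'X_i : {mpoly R[n]}.
have : meval (fun=> 1) (X ^+ d) = n%:R ^+ d.
  rewrite rmorphXn /= raddf_sum /=; congr (_ ^+ _).
  by rewrite (eq_bigr (fun=> 1)) => [|i _]; rewrite ?mevalXU // sumr_const card_ord.
move=> <-; rewrite [X ^+ d in RHS](mpolywE (leq_maxl (msize (X ^+ d)) d.+1)).
rewrite raddf_sum /= (@big_mons_degree _ _ (fun m => ((X ^+ d)@_m *: 'X_[m]).@[fun=> 1])).
have lt_d : (d < maxn (msize (X ^+ d)) d.+1)%N by rewrite leq_maxr.
rewrite (bigD1 (Ordinal lt_d)) //= [X in _ = _ + X]big1 => [|c cd].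
  rewrite addr0 big_seq [RHS]big_seq; apply: eq_bigr => m; rewrite mem_mons => md.
  rewrite mevalZ mevalX mcoeff_sumX md big1 ?mulr1 // => i _; exact: expr1n.
rewrite big_seq big1 // => k; rewrite mem_mons => /eqP kc.
rewrite mevalZ mcoeff_sumX kc; case: (nat_of_ord c =P d) => [cE|_]; last by rewrite mul0r.
by case/eqP: cd; apply: val_inj.
Qed.

End Monomials.

Lemma ler_sum_subset (R : realType) (I : eqType) (s t : seq I) (E : I -> R) :
    uniq s -> uniq t -> {subset s <= t} -> (forall i, 0 <= E i) ->
  \sum_(i <- s) E i <= \sum_(i <- t) E i.
Proof.
move=> us ut st E0; rewrite [leRHS](bigID (mem s)) /= -[X in _ <= X + _]big_filter.
rewrite (perm_big [seq i <- t | i \in s]) ?lerDl ?sumr_ge0 //.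
apply: uniq_perm; rewrite ?filter_uniq // => i.
by rewrite mem_filter; apply/idP/andP => [si|[]//]; rewrite si st.
Qed.

Section BombieriNorm.
Variables (R : realType) (n : nat).
Local Notation C := R[i].
Import Normc.
Local Open Scope complex_scope.
Implicit Types (f g : 'X_{1..n} -> C) (p q : {mpoly C[n]}) (d : nat).
Local Notation w := (bweight R).

Lemma normc_ge0 (z : C) : 0 <= normc z.
Proof. by case: z => a b; apply: sqrtr_ge0. Qed.

Lemma normc_norm (z : C) : `|z| = (normc z)%:C.
Proof. by case: z => a b; rewrite normc_def. Qed.

Lemma normc_sum (I : Type) (r : seq I) (P : pred I) (F : I -> C) :
  normc (\sum_(i <- r | P i) F i) <= \sum_(i <- r | P i) normc (F i).
Proof.
elim/big_rec2: _ => [|i x y Pi xy]; first by rewrite normc0.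
by apply: le_trans (le_normcD _ _) _; rewrite lerD2l.
Qed.

Definition nrm d f : R := l2 (mons n d) w (fun m => normc (f m)).

Lemma nrm_ge0 d f : 0 <= nrm d f. Proof. exact: l2_ge0. Qed.

Lemma eq_nrm d f g : (forall m, mdeg m = d -> f m = g m) -> nrm d f = nrm d g.
Proof.
move=> fg; congr Num.sqrt; rewrite big_seq [RHS]big_seq; apply: eq_bigr => m.
by rewrite mem_mons => /eqP /fg ->.
Qed.

Lemma nrm_le d f (c : 'X_{1..n} -> R) :
  (forall m, mdeg m = d -> normc (f m) <= c m) -> nrm d f <= l2 (mons n d) w c.
Proof.
move=> fc; apply: l2_le => [m|m]; first exact: bweight_ge0.
by rewrite mem_mons => /eqP /fc; rewrite ger0_norm ?normc_ge0.
Qed.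

Lemma nrm0 d f : (forall m, mdeg m = d -> f m = 0) -> nrm d f = 0.
Proof.
move=> f0; rewrite (@eq_nrm _ _ (fun=> 0)) // /nrm -[RHS](l2_0 (mons n d) w).
by congr Num.sqrt; apply: eq_bigr => m _; rewrite normc0.
Qed.

Lemma nrmD d f g : nrm d (fun m => f m + g m) <= nrm d f + nrm d g.
Proof.
have w0 := @bweight_ge0 n R.
apply: le_trans (l2D _ _ _ w0); apply: nrm_le => m _; exact: le_normcD.
Qed.

Lemma nrmN d f : nrm d (fun m => - f m) = nrm d f.
Proof. by congr Num.sqrt; apply: eq_bigr => m _; rewrite normcN. Qed.

Lemma nrm_sum (I : Type) (r : seq I) (P : pred I) d (F : I -> 'X_{1..n} -> C) :
  nrm d (fun m => \sum_(i <- r | P i) F i m) <= \sum_(i <- r | P i) nrm d (F i).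
Proof.
have w0 := @bweight_ge0 n R.
apply: le_trans (l2_sum _ _ _ _ w0); apply: nrm_le => m _; exact: normc_sum.
Qed.

Lemma nrmZ d c f : nrm d (fun m => c * f m) = normc c * nrm d f.
Proof.
rewrite /nrm /l2 -[normc c]ger0_norm ?normc_ge0 // -sqrtr_sqr -sqrtrM ?sqr_ge0 //.
rewrite mulr_sumr; congr Num.sqrt; apply: eq_bigr => m _.
by rewrite normcM exprMn mulrCA.
Qed.

Lemma nrm_coef d f m : mdeg m = d -> normc (f m) <= multin R m * nrm d f.
Proof.
move=> md; have w0 := bweight_gt0 R m.
have : w m * normc (f m) ^+ 2 <= nrm d f ^+ 2.
  rewrite l2_sqr; last by move=> ?; apply: bweight_ge0.
  rewrite (bigD1_seq m) ?mem_mons ?md ?mons_uniq //= lerDl sumr_ge0 // => k _.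
  by rewrite mulr_ge0 ?sqr_ge0 ?bweight_ge0.
move=> le1; rewrite bweightV mulrC ler_pdivlMr //.
have fw0 : 0 <= normc (f m) * w m by apply: mulr_ge0; [exact: normc_ge0 | exact: ltW].
rewrite -ler_sqr ?nnegrE //; last exact: nrm_ge0.
apply: le_trans le1; rewrite exprMn mulrC expr2 -mulrA ler_piMl //; last exact: bweight_le1.
by apply: mulr_ge0; [exact: ltW | exact: sqr_ge0].
Qed.

(** Comparison with the sum of the moduli: the loss is geometric in the
    degree, which the Gevrey property absorbs. *)
Lemma l1_nrm d f : \sum_(m <- mons n d) normc (f m) <= n%:R ^+ d * nrm d f.
Proof.
rewrite -sum_multin mulr_suml big_seq [leRHS]big_seq; apply: ler_sum => m.
by rewrite mem_mons => /eqP; apply: nrm_coef.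
Qed.

(** Submultiplicativity of the Bombieri norm on homogeneous polynomials:
    Cauchy-Schwarz in each coefficient of the product, the inverse weights
    being added up by the Vandermonde identity. *)
Lemma l2_product a b f g :
  l2 (mons n (a + b)) w (fun m => \sum_(k <- mons n a) \sum_(l <- mons n b)
     (if (k + l)%MM == m then normc (f k) * normc (g l) else 0))
  <= nrm a f * nrm b g.
Proof.
have w0 := @bweight_ge0 n R; have wp := @bweight_gt0 n R.
rewrite -ler_sqr ?nnegrE ?mulr_ge0 ?nrm_ge0 ?l2_ge0 // exprMn !l2_sqr //.
pose prs := [seq (k, l) | k <- mons n a, l <- mons n b].
have pairE (F : 'X_{1..n} -> 'X_{1..n} -> R) :
    \sum_(k <- mons n a) \sum_(l <- mons n b) F k l = \sum_(u <- prs) F u.1 u.2.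
  by rewrite big_allpairs_dep.
pose s (m : 'X_{1..n}) := Num.sqrt (w m).
have sE m : s m ^+ 2 = w m by rewrite sqr_sqrtr.
have s0 m : s m != 0 by rewrite sqrtr_eq0 -ltNge.
pose X (u : 'X_{1..n} * 'X_{1..n}) := w u.1 * normc (f u.1) ^+ 2 * (w u.2 * normc (g u.2) ^+ 2).
have X0 u : 0 <= X u by do ?[exact: sqr_ge0 | exact: w0 | apply: mulr_ge0].
apply: (@le_trans _ _ (\sum_(m <- mons n (a + b)) \sum_(u <- prs | (u.1 + u.2)%MM == m) X u)).
  rewrite big_seq [leRHS]big_seq; apply: ler_sum => m; rewrite mem_mons => /eqP mab.
  rewrite pairE -big_mkcond /=.
  rewrite (eq_bigr (fun u => (s u.1 * normc (f u.1) * (s u.2 * normc (g u.2))) *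
                             ((s u.1)^-1 * (s u.2)^-1))) => [|u _]; last first.
    by field; rewrite !s0.
  rewrite -[leRHS]mul1r -(bweightK R m) -mulrA; apply: ler_wpM2l => //.
  apply: le_trans (cauchy_schwarz _ _ _ _) _; rewrite mulrC.
  rewrite -(vandermonde_multin R mab) pairE -big_mkcond /=.
  rewrite (eq_bigr (fun u => multin R u.1 * multin R u.2)) => [|u _]; last first.
    by rewrite exprMn !exprVn !sE !bweightV.
  rewrite [X in _ * X <= _](eq_bigr X) // => u _.
  by rewrite !exprMn !sE.
rewrite (exchange_big_dep xpredT) //= mulr_suml.
rewrite [leRHS](eq_bigr (fun k => \sum_(l <- mons n b) X (k, l))) => [|k _]; last first.
  by rewrite mulr_sumr.
rewrite (pairE (fun k l => X (k, l))); apply: ler_sum => -[k l] _ /=.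
rewrite -big_filter; set r := [seq _ <- _ | _].
have /orP[/eqP -> | /eqP ->] : (r == [::]) || (r == [:: (k + l)%MM]).
- have r_uniq : uniq r by rewrite filter_uniq ?mons_uniq.
  have : {subset r <= [:: (k + l)%MM]}.
    by move=> m; rewrite mem_filter inE eq_sym => /andP[].
  move: r_uniq; clear; case: r => [|x [|y r]] //= xr sub.
    by have := sub x; rewrite !inE eqxx => /(_ isT) /eqP ->; rewrite eqxx.
  have := sub y; have := sub x; rewrite !inE !eqxx orbT => /(_ isT) /eqP xE /(_ isT) /eqP yE.
  by move: xr; rewrite xE yE inE eqxx.
- by rewrite big_nil.
- by rewrite big_seq1.
Qed.

Lemma nrm_mcoeffM d p q :
  nrm d (fps_of_mpoly (p * q)) <=
  \sum_(a < d.+1) nrm a (fps_of_mpoly p) * nrm (d - a) (fps_of_mpoly q).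
Proof.
have w0 := @bweight_ge0 n R.
pose c (a : 'I_d.+1) m := \sum_(k <- mons n a) \sum_(l <- mons n (d - a))
   (if (k + l)%MM == m then normc p@_k * normc q@_l else 0).
apply: (@le_trans _ _ (l2 (mons n d) w (fun m => \sum_a c a m))).
  apply: nrm_le => m md; rewrite /fps_of_mpoly mcoeffM_mons md.
  apply: le_trans (normc_sum _ _ _) _; apply: ler_sum => a _.
  apply: le_trans (normc_sum _ _ _) _; apply: ler_sum => k _.
  apply: le_trans (normc_sum _ _ _) _; apply: ler_sum => l _.
  by case: eqP => _; rewrite ?normcM ?normc0.
apply: le_trans (l2_sum _ _ _ _ w0) _; apply: ler_sum => a _.
have {1}-> : d = (a + (d - a))%N by rewrite subnKC // -ltnS.
exact: l2_product.
Qed.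

(** The map [m |-> m + U_(j)] is injective, and the ratio of the weights of
    [m] and [m + U_(j)] turns the square of the factor [m j + 1] into
    [(d + 1) * (m j + 1)], at most [(d + 1) ^ 2]. *)
Lemma nrm_deriv d f (j : 'I_n) :
  nrm d (fps_deriv j f) <= d.+1%:R * nrm d.+1 f.
Proof.
have w0 := @bweight_ge0 n R.
rewrite -ler_sqr ?nnegrE ?mulr_ge0 ?nrm_ge0 ?ler0n // exprMn !l2_sqr // mulr_sumr.
pose E m := d.+1%:R ^+ 2 * (w m * normc (f m) ^+ 2).
have E0 m : 0 <= E m by do ?[exact: sqr_ge0 | exact: w0 | apply: mulr_ge0].
apply: (@le_trans _ _ (\sum_(m <- mons n d) E (m + U_(j))%MM)).
  rewrite big_seq [leRHS]big_seq; apply: ler_sum => m; rewrite mem_mons => /eqP md.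
  rewrite /fps_deriv normcMn -[normc _ *+ _]mulr_natl exprMn mulrA /E mulrA.
  apply: ler_wpM2r; first exact: sqr_ge0.
  have mj : (m j).+1%:R <= d.+1%:R :> R.
    by rewrite ler_nat ltnS -md mdegE (bigD1 j) //= leq_addr.
  have wU := bweightU R m j; rewrite md in wU.
  have -> : w m * (m j).+1%:R ^+ 2 = (m j).+1%:R * w m * (m j).+1%:R by ring.
  rewrite wU; have -> : d.+1%:R ^+ 2 * w (m + U_(j))%MM = d.+1%:R * w (m + U_(j))%MM * d.+1%:R by ring.
  by apply: ler_wpM2l => //; rewrite mulr_ge0 ?ler0n.
rewrite -(big_map (fun m => m + U_(j))%MM xpredT E).
have mapU : uniq [seq (m + U_(j))%MM | m <- mons n d].
  by rewrite map_inj_uniq ?mons_uniq // => u v; apply: addIm.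
apply: ler_sum_subset => // [|m]; first exact: mons_uniq.
case/mapP => k; rewrite !mem_mons => /eqP kd ->.
by rewrite mdegD mdeg1 kd addn1.
Qed.

End BombieriNorm.

(** * Gevrey weights and weighted norms *)

Section Weights.
Variable R : realType.
Implicit Types (beta : R) (i j : nat).

(** The Gevrey weight [(j!)^beta]. *)
Definition gw beta j : R := exp.powR (j`!%:R) beta.

Lemma gw_gt0 beta j : 0 < gw beta j.
Proof. by rewrite exp.powR_gt0 // ltr0n fact_gt0. Qed.

Lemma gw_ge0 beta j : 0 <= gw beta j. Proof. exact/ltW/gw_gt0. Qed.

Lemma gw_neq0 beta j : gw beta j != 0. Proof. by rewrite gt_eqF ?gw_gt0. Qed.

Lemma gw0 beta : gw beta 0 = 1. Proof. by rewrite /gw exp.powR1. Qed.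

Lemma gw1 beta : gw beta 1 = 1. Proof. by rewrite /gw exp.powR1. Qed.

Lemma gw_le beta i j k : 0 <= beta -> (i`! * j`! <= k`!)%N ->
  gw beta i * gw beta j <= gw beta k.
Proof.
move=> beta0 ijk; rewrite /gw -exp.powRM ?ler0n // -natrM.
by rewrite exp.ge0_ler_powR ?nnegrE ?ler0n ?ler_nat.
Qed.

Lemma gwM_le beta i j : 0 <= beta -> gw beta i * gw beta j <= gw beta (i + j).
Proof. by move=> beta0; apply: gw_le => //; apply: leq_fact_mul. Qed.

Lemma gw_mono beta i j : 0 <= beta -> (i <= j)%N -> gw beta i <= gw beta j.
Proof.
move=> beta0 ij; rewrite -[leLHS]mulr1 -(gw0 beta) gw_le // muln1.
by rewrite -(subnK ij); apply: leq_trans (leq_fact_mul _ _); rewrite leq_pmull ?fact_gt0.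
Qed.

Lemma fact_mul_pred x y : (0 < y)%N -> (x.+1`! * y`! <= (x + y)`!)%N.
Proof.
move=> y0; elim: x => [|x IHx]; first by rewrite mul1n.
rewrite factS -mulnA addSn factS; apply: leq_mul IHx.
by rewrite ltnS -[x.+1]addn1 leq_add2l.
Qed.

(** The factor [a + 1] lost in a derivative is paid for by one extra power of the
    factorial: this is where the Gevrey order grows from [alpha] to
    [1 + alpha]. *)
Lemma gw_deriv beta a b : 1 <= beta -> (0 < b)%N ->
  a.+1%:R * (gw beta a * gw beta b) <= gw beta (a + b).
Proof.
move=> beta1 b0; have beta0 : 0 <= beta by apply: le_trans beta1.
apply: (@le_trans _ _ (gw beta a.+1 * gw beta b)); last first.
  by apply: gw_le => //; apply: fact_mul_pred.
rewrite mulrA ler_wpM2r ?gw_ge0 // /gw factS natrM exp.le1r_powRZ ?ler0n //.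
by rewrite ler1n.
Qed.

(** Lowering the index of the weight only costs a geometric factor. *)
Lemma gw_pred beta k : 0 <= beta -> (0 < k)%N ->
  gw beta k <= exp.powR 2 beta ^+ k * gw beta k.-1.
Proof.
case: k => // k beta0 _ /=; rewrite /gw factS natrM exp.powRM ?ler0n //.
rewrite ler_wpM2r ?exp.powR_ge0 //.
have -> : exp.powR 2 beta ^+ k.+1 = exp.powR (2 ^+ k.+1) beta.
  elim: k.+1 => [|j IHj]; first by rewrite !expr0 exp.powR1.
  by rewrite !exprS IHj exp.powRM ?exprn_ge0.
rewrite exp.ge0_ler_powR ?nnegrE ?ler0n ?exprn_ge0 //.
by rewrite -natrX ler_nat; apply: ltnW; apply: ltn_expl.
Qed.

Lemma gw_exponent alpha beta k : alpha <= beta -> gw alpha k <= gw beta k.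
Proof. by move=> ab; rewrite exp.ler_powR // ler1n fact_gt0. Qed.

Lemma sum_convolution_le N (A B : nat -> R) :
    (forall i, 0 <= A i) -> (forall i, 0 <= B i) ->
  \sum_(d < N) \sum_(a < d.+1) A a * B (d - a)%N <= (\sum_(a < N) A a) * \sum_(b < N) B b.
Proof.
move=> A0 B0.
have -> : \sum_(d < N) \sum_(a < d.+1) A a * B (d - a)%N =
    \sum_(d < N) \sum_(a < N | (a <= d)%N) A a * B (d - a)%N.
  apply: eq_bigr => d _; rewrite (big_ord_widen_cond N xpredT (fun a => A a * B (d - a)%N)) //.
rewrite (exchange_big_dep xpredT) //= mulr_suml; apply: ler_sum => a _.
rewrite -mulr_sumr ler_wpM2l //.
have -> : \sum_(d < N | (a <= d)%N) B (d - a)%N = \sum_(a <= d < N) B (d - a)%N.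
  by rewrite big_geq_mkord.
rewrite -{1}[nat_of_ord a]add0n big_addn; under eq_bigr do rewrite addnK.
rewrite big_mkord (big_ord_widen _ B (leq_subr a N)).
by rewrite [leRHS](bigID (fun b : 'I_N => (b < N - a)%N)) /= lerDl sumr_ge0.
Qed.

Lemma sum_geometric_le (x : R) N : 0 <= x -> 2 * x <= 1 ->
  \sum_(k < N | (2 <= k)%N) x ^+ k <= 2 * x ^+ 2.
Proof.
move=> x0 x1.
have geo M : \sum_(k < M) x ^+ k <= 2.
  have := subrX1 x M; set s := \sum_(i < M) _ => sE.
  have xM : 0 <= x ^+ M by rewrite exprn_ge0.
  have s0 : 0 <= s by rewrite sumr_ge0 // => i _; rewrite exprn_ge0.
  by nra.
have -> : \sum_(k < N | (2 <= k)%N) x ^+ k = \sum_(k < N - 2) x ^+ 2 * x ^+ k.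
  rewrite -(big_geq_mkord 2 N xpredT (fun k => x ^+ k)) -{1}[2%N]add0n big_addn big_mkord.
  by apply: eq_bigr => k _; rewrite exprD mulrC.
by rewrite -mulr_sumr mulrC ler_wpM2r // sqr_ge0.
Qed.

End Weights.

Section WeightedNorm.
Variables (R : realType) (n : nat) (beta tau : R) (D : nat).
Hypotheses (beta_ge0 : 0 <= beta) (tau_gt0 : 0 < tau).
Local Notation C := R[i].
Import Normc.
Implicit Types (f : fps R n) (p q : {mpoly C[n]}) (k l : nat).
Local Notation gw := (gw beta).

(** For series of order [k], the index of the weight is shifted by [k]; the
    family of norms so obtained is submultiplicative, and a product of [k]
    series without constant term gains a factor [1 / (k - 1)!^beta] that
    compensates for the growth of the coefficients of the outer series of a
    composition. *)
Definition snorm k f : R :=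
  \sum_(d < D.+1 | (k <= d)%N) nrm d f * tau ^+ d / gw (d - k)%N.

Lemma tauX_ge0 d : 0 <= tau ^+ d. Proof. by rewrite exprn_ge0 ?ltW. Qed.

Lemma snorm_ge0 k f : 0 <= snorm k f.
Proof.
apply: sumr_ge0 => d _; apply: divr_ge0; last exact: gw_ge0.
by apply: mulr_ge0; [exact: nrm_ge0 | rewrite exprn_ge0 ?ltW].
Qed.

Lemma snorm_le k f c : (forall d, (k <= d <= D)%N -> nrm d f <= c d) ->
  snorm k f <= \sum_(d < D.+1 | (k <= d)%N) c d * tau ^+ d / gw (d - k)%N.
Proof.
move=> fc; apply: ler_sum => d kd; rewrite ler_wpM2r ?invr_ge0 ?gw_ge0 //.
by rewrite ler_wpM2r ?tauX_ge0 // fc // kd -ltnS ltn_ord.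
Qed.

Lemma eq_snorm k f g : (forall m, (mdeg m <= D)%N -> f m = g m) -> snorm k f = snorm k g.
Proof.
move=> fg; apply: eq_bigr => d _; rewrite (@eq_nrm _ _ _ _ g) // => m md.
by apply: fg; rewrite md -ltnS ltn_ord.
Qed.

Lemma snorm_sum (I : Type) (r : seq I) (P : pred I) k (F : I -> fps R n) :
  snorm k (fun m => \sum_(i <- r | P i) F i m) <= \sum_(i <- r | P i) snorm k (F i).
Proof.
apply: le_trans (snorm_le (c := fun d => \sum_(i <- r | P i) nrm d (F i)) _) _.
  by move=> d _; apply: nrm_sum.
rewrite le_eqVlt [X in _ == X]exchange_big /=; apply/orP; left; apply/eqP.
by apply: eq_bigr => d _; rewrite !mulr_suml.
Qed.

Lemma snormZ k c f : snorm k (fun m => c * f m) = normc c * snorm k f.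
Proof. by rewrite /snorm mulr_sumr; apply: eq_bigr => d _; rewrite nrmZ !mulrA. Qed.

Lemma nrm_mord k d p : mord_ge k p -> (d < k)%N -> nrm d (fps_of_mpoly p) = 0.
Proof. by move=> pk dk; apply: nrm0 => m md; apply: pk; rewrite md. Qed.

Lemma snormM k l p q : mord_ge k p -> mord_ge l q ->
  snorm (k + l) (fps_of_mpoly (p * q)) <= snorm k (fps_of_mpoly p) * snorm l (fps_of_mpoly q).
Proof.
move=> pk ql; have t0 d : 0 <= tau ^+ d by rewrite exprn_ge0 ?ltW.
pose T j (r : {mpoly C[n]}) (a : nat) : R :=
  if (j <= a)%N then nrm a (fps_of_mpoly r) * tau ^+ a / gw (a - j)%N else 0.
have T0 j r a : 0 <= T j r a.
  rewrite /T; case: ifP => // _; apply: divr_ge0; last exact: gw_ge0.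
  by apply: mulr_ge0; [exact: nrm_ge0 | ].
have snormE j r : snorm j (fps_of_mpoly r) = \sum_(a < D.+1) T j r a.
  by rewrite /snorm big_mkcond.
rewrite (snormE k) (snormE l); apply: le_trans (sum_convolution_le _ (T0 k p) (T0 l q)).
rewrite snormE; apply: ler_sum => d _; rewrite {1}/T; case: ifP => kld; last first.
  by apply: sumr_ge0 => a _; apply: mulr_ge0.
rewrite -mulrA; apply: le_trans (ler_wpM2r _ (nrm_mcoeffM _ _ _)) _.
  by apply: divr_ge0; [ | exact: gw_ge0].
rewrite mulr_suml; apply: ler_sum => a _.
have ad : (a <= d)%N by rewrite -ltnS.
rewrite /T; case: leqP => ka; last by rewrite (nrm_mord pk) ?mul0r.
case: leqP => la; last by rewrite (nrm_mord ql) ?mulr0 ?mul0r.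
have -> : tau ^+ d = tau ^+ a * tau ^+ (d - a) by rewrite -exprD subnKC.
have -> : nrm a (fps_of_mpoly p) * tau ^+ a / gw (a - k)%N *
    (nrm (d - a) (fps_of_mpoly q) * tau ^+ (d - a) / gw (d - a - l)%N) =
    nrm a (fps_of_mpoly p) * nrm (d - a) (fps_of_mpoly q) *
    (tau ^+ a * tau ^+ (d - a) / (gw (a - k)%N * gw (d - a - l)%N)).
  by rewrite invfM; ring.
apply: ler_wpM2l; first by apply: mulr_ge0; apply: nrm_ge0.
apply: ler_wpM2l; first exact: mulr_ge0.
rewrite lef_pV2 ?posrE ?mulr_gt0 ?gw_gt0 //.
have -> : (d - (k + l) = (a - k) + (d - a - l))%N by lia.
exact: gwM_le.
Qed.

Lemma nrm_mpolyX d (m : 'X_{1..n}) :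
  nrm d (fps_of_mpoly ('X_[m] : {mpoly C[n]})) <= (mdeg m == d)%:R.
Proof.
case: eqP => [md|md]; last first.
  rewrite nrm0 // => k kd; rewrite /fps_of_mpoly mcoeffX; case: eqP => // mk.
  by case: md; rewrite mk.
rewrite -sqrtr1 ler_sqrt // (bigD1_seq m) ?mem_mons ?md ?mons_uniq //=.
rewrite /fps_of_mpoly mcoeffX eqxx big1 => [|k km]; last first.
  by rewrite mcoeffX eq_sym (negbTE km) mulr0n normc0 expr0n mulr0.
by rewrite addr0 mulr1n normc1 expr1n mulr1 bweight_le1.
Qed.

Lemma snorm_monomial (q : n.-tuple {mpoly C[n]}) s (m : 'X_{1..n}) :
    0 <= s -> (forall i, mord_ge 1 (tnth q i)) ->
    (forall i, snorm 1 (fps_of_mpoly (tnth q i)) <= s) ->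
  snorm (mdeg m) (fps_of_mpoly (\prod_(i < n) tnth q i ^+ m i)) <= s ^+ mdeg m.
Proof.
move=> s0 q1 qs.
pose good k (p : {mpoly C[n]}) := mord_ge k p /\ snorm k (fps_of_mpoly p) <= s ^+ k.
have goodM k l p p' : good k p -> good l p' -> good (k + l)%N (p * p').
  move=> [pk ps] [pl ps']; split; first exact: mord_geM.
  by apply: le_trans (snormM pk pl) _; rewrite exprD ler_pM ?snorm_ge0.
have good1 : good 0 1.
  split=> //; rewrite expr0.
  apply: le_trans (snorm_le (c := fun d => (d == 0)%:R) _) _.
    move=> d _; rewrite -mpolyX0; apply: le_trans (nrm_mpolyX _ _) _.
    by rewrite mdeg0 eq_sym.
  rewrite (bigD1 ord0) //= big1 => [|d]; first by rewrite addr0 ?eqxx subn0 gw0 expr0 mulr1 divr1.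
  by rewrite -val_eqE /= => /negbTE ->; rewrite !mul0r.
suff [] : good (mdeg m) (\prod_(i < n) tnth q i ^+ m i) by [].
rewrite mdegE; elim/big_ind2: _ => // [????|i _]; first exact: goodM.
by elim: (m i) => [|j IHj] //; rewrite exprS -add1n; apply: goodM.
Qed.

Definition l1 k f : R := \sum_(m <- mons n k) normc (f m).

(** The norm of index 1 of a monomial of degree [k] in the [q i] is smaller
    than its norm of index [k] by the factor [gw (k - 1)], since
    [gw (d - k) * gw (k - 1) <= gw (d - 1)]. This is what makes the sum on the
    right geometric when [f] is Gevrey-[beta]. *)
Lemma snorm_comp f (q : n.-tuple {mpoly C[n]}) s t :
    (0 < t)%N -> (forall m, (mdeg m < t)%N -> f m = 0) ->
    0 <= s -> (forall i, mord_ge 1 (tnth q i)) ->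
    (forall i, snorm 1 (fps_of_mpoly (tnth q i)) <= s) ->
  snorm 1 (fps_of_mpoly (trunc D f \mPo q)) <=
    \sum_(k < D.+1 | (t <= k)%N) l1 k f * s ^+ k / gw k.-1.
Proof.
move=> t0 ft s0 q1 qs.
pose Q (m : 'X_{1..n}) := \prod_(i < n) tnth q i ^+ m i.
have -> : fps_of_mpoly (trunc D f \mPo q) =
    (fun u => \sum_(m : 'X_{1..n < D.+1}) f m * fps_of_mpoly (Q m) u).
  apply: boolp.funext => u; rewrite /fps_of_mpoly /trunc (raddf_sum (comp_mpoly q)).
  rewrite (raddf_sum (mcoeff u)); apply: eq_bigr => m _ /=.
  by rewrite comp_mpolyZ comp_mpolyX mcoeffZ.
apply: le_trans (snorm_sum _ _ _ _) _.
rewrite (big_mons_degree _ (fun m => snorm 1 (fun u => f m * fps_of_mpoly (Q m) u))).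
rewrite [leRHS]big_mkcond /=; apply: ler_sum => k _; rewrite /l1.
case: leqP => tk; last first.
  rewrite big_seq big1 // => m; rewrite mem_mons => /eqP mk.
  by rewrite snormZ ft ?mk // normc0 mul0r.
rewrite !mulr_suml big_seq [leRHS]big_seq; apply: ler_sum => m.
rewrite mem_mons => /eqP mk; rewrite snormZ -mulrA ler_wpM2l ?normc_ge0 //.
have Qk : mord_ge k (Q m) by rewrite -mk; apply: mord_ge_monomial.
apply: (@le_trans _ _ (snorm k (fps_of_mpoly (Q m)) / gw k.-1)); last first.
  by rewrite ler_wpM2r ?invr_ge0 ?gw_ge0 // -mk; apply: snorm_monomial.
rewrite /snorm mulr_suml big_mkcond [leRHS]big_mkcond; apply: ler_sum => d _.
case: (leqP k d) => kd; last first.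
  by case: ifP => // _; rewrite (nrm_mord Qk) ?mul0r.
have k0 : (0 < k)%N by apply: leq_trans tk.
rewrite (leq_trans k0 kd) -[leRHS]mulrA -invfM.
apply: ler_wpM2l; first by apply: mulr_ge0; [exact: nrm_ge0 | rewrite exprn_ge0 ?ltW].
rewrite lef_pV2 ?posrE ?mulr_gt0 ?gw_gt0 //.
by have -> : (d - 1 = (d - k) + k.-1)%N by [lia|]; apply: gwM_le.
Qed.

End WeightedNorm.

(** * The Gevrey estimate *)

Section GevreyEstimate.
Variables (R : realType) (n : nat).
Local Notation C := R[i].
Local Notation Id := (@fid R n).
Import Normc.
Local Open Scope complex_scope.
Implicit Types (F U V X : ftuple R n) (d : nat).

Lemma gevreyP (alpha : R) F : gevrey alpha F <->
  exists B r : R, [/\ 0 < B, 1 <= r &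
    forall k, \sum_i l1 k (F i) <= B * r ^+ k * gw alpha k].
Proof.
have l1E i l : \sum_(m : 'X_{1..n < l.+1} | mdeg m == l) `|F i m| = (l1 l (F i))%:C.
  rewrite (big_mons _ (fun m => `|F i m|) (ltnSn l)) /l1 rmorph_sum /=.
  by apply: eq_bigr => m _; rewrite normc_norm.
have l1_ge0 k i : 0 <= l1 k (F i) by apply: sumr_ge0 => m _; apply: normc_ge0.
split=> [gF|[B [r [B0 r1 Fk]]] i]; last first.
  exists B, r; split=> //; first exact: lt_le_trans r1.
  move=> l; rewrite l1E lecR; apply: le_trans (Fk l).
  by rewrite (bigD1 i) //= lerDl sumr_ge0.
have {gF} /fin_all_exists[B /fin_all_exists[r gF]] : forall i, exists B r : R,
    [/\ 0 < B, 0 < r & forall k, l1 k (F i) <= B * r ^+ k * gw alpha k].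
  move=> i; have [B [r [B0 r0 Fk]]] := gF i; exists B, r; split=> // k.
  by have := Fk k; rewrite l1E lecR.
have B0 i : 0 <= B i by have [/ltW] := gF i.
have r0 i : 0 <= r i by have [_ /ltW] := gF i.
exists (1 + \sum_i B i), (1 + \sum_i r i); split.
- by apply: ltr_pwDl => //; apply: sumr_ge0.
- by rewrite lerDl sumr_ge0.
move=> k; apply: (@le_trans _ _ (\sum_i B i * (1 + \sum_i r i) ^+ k * gw alpha k)).
  apply: ler_sum => i _; have [_ _ Fk] := gF i; apply: le_trans (Fk k) _.
  rewrite ler_wpM2r ?gw_ge0 // ler_wpM2l // lerXn2r ?nnegrE //.
    by rewrite addr_ge0 // sumr_ge0.
  by rewrite (bigD1 i) //= addrCA lerDl addr_ge0 // sumr_ge0.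
rewrite -!mulr_suml ler_wpM2r ?gw_ge0 // ler_wpM2r ?exprn_ge0 ?lerDr //.
by rewrite addr_ge0 // sumr_ge0.
Qed.

Lemma gevrey_nrm (beta : R) U (B r : R) : 0 < B -> 0 < r ->
    (forall d i, nrm d (U i) <= B * r ^+ d * gw beta d) -> gevrey beta U.
Proof.
move=> B0 r0 Ud i.
have n0 : 0 < n%:R :> R by rewrite ltr0n; case: (i) => j; case: (n).
exists B, (n%:R * r); split=> // [|l]; first exact: mulr_gt0.
rewrite (big_mons _ (fun m => `|U i m|) (ltnSn l)).
rewrite (eq_bigr (fun m => (normc (U i m))%:C)) => [|m _]; last by rewrite normc_norm.
rewrite -rmorph_sum lecR; apply: le_trans (l1_nrm _ _) _.
apply: le_trans (ler_wpM2l _ (Ud l i)) _; first by rewrite exprn_ge0 ?ltW.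
have -> : n%:R ^+ l * (B * r ^+ l * gw beta l) = B * (n%:R * r) ^+ l * gw beta l.
  by rewrite exprMn; ring.
exact: lexx.
Qed.

(** The index [k - 1] is the one that appears in the composition estimate
    [snorm_comp]; the shift is paid for by a larger [r]. *)
Lemma gevrey_pred (alpha beta : R) F : 0 <= alpha -> alpha <= beta -> gevrey alpha F ->
  exists B r : R, [/\ 0 < B, 1 <= r &
    forall k, (0 < k)%N -> \sum_i l1 k (F i) <= B * r ^+ k * gw beta k.-1].
Proof.
move=> a0 ab /gevreyP[B [r [B0 r1 Fk]]]; have b0 := le_trans a0 ab.
have p1 : 1 <= exp.powR 2 beta :> R.
  have := @exp.ler_powR R 2 (ler1n _ 2) _ _ b0.
  by rewrite exp.powRr0.
exists B, (r * exp.powR 2 beta); split=> // [|k k0]; first exact: mulr_ege1.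
apply: le_trans (Fk k) _; rewrite -!mulrA; apply: ler_wpM2l; first exact: ltW.
rewrite exprMn -mulrA; apply: ler_wpM2l; first by rewrite exprn_ge0 ?(le_trans _ r1).
exact: le_trans (gw_exponent _ ab) (gw_pred b0 k0).
Qed.

Lemma nrm_fps_mul d (f g : fps R n) :
  nrm d (fps_mul f g) <= \sum_(a < d.+1) nrm a f * nrm (d - a) g.
Proof.
rewrite (@eq_nrm _ _ _ _ (fps_of_mpoly (trunc d f * trunc d g))) => [|m md]; last first.
  by rewrite /fps_mul md.
apply: le_trans (nrm_mcoeffM _ _ _) _; rewrite le_eqVlt; apply/orP; left; apply/eqP.
apply: eq_bigr => a _; have ad : (a <= d)%N by rewrite -ltnS.
by congr (_ * _); apply: eq_nrm => m md; rewrite /fps_of_mpoly trunc_coef md ?ad ?leq_subr.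
Qed.

Lemma nrm_fid i : nrm 1 (Id i) <= 1.
Proof.
rewrite (@eq_nrm _ _ _ _ (fps_of_mpoly ('X_i : {mpoly C[n]}))) => [|m _]; last first.
  by rewrite fid_coef /fps_of_mpoly mcoeffX eq_sym.
by have := nrm_mpolyX R 1 (U_(i)%MM : 'X_{1..n}); rewrite mdeg1 eqxx.
Qed.

Definition size2 d U V : R := \sum_i (nrm d (U i) + nrm d (V i)).

Lemma size2_ge0 d U V : 0 <= size2 d U V.
Proof. by apply: sumr_ge0 => i _; rewrite addr_ge0 ?nrm_ge0. Qed.

(** Boundedness of these partial sums for some [tau > 0] is the Gevrey
    property; the index [d - 1] is the weight of [snorm] for series without
    constant term. *)
Definition weighted_size (beta tau : R) U V D : R :=
  \sum_(d < D.+1 | (2 <= d)%N) size2 d U V * tau ^+ d / gw beta d.-1.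

Section Estimate.
Variables (beta K : R) (F U V : ftuple R n).
Hypotheses (beta_ge0 : 0 <= beta) (K_ge1 : 1 <= K).
Hypotheses (F2 : order_ge 2 F) (U2 : order_ge 2 U) (V2 : order_ge 2 V).
Hypothesis bound : forall d, (2 <= d)%N ->
  size2 d U V <= K * (\sum_i nrm d (fcomp F (fadd Id U) i)
                    + \sum_i nrm d (jacobian_apply U V i)).
Hypothesis V0_or : 1 <= beta \/ (forall i m, V i m = 0).

Lemma order_ge_fid_add W : order_ge 2 W -> order_ge 1 (fadd Id W).
Proof.
move=> W2; apply: order_ge_fadd; first exact: order_ge_fid.
exact: order_ge_le W2.
Qed.

Variable tau : R.
Hypothesis tau_gt0 : 0 < tau.

Let term d : R := size2 d U V * tau ^+ d / gw beta d.-1.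
Let Z D : R := weighted_size beta tau U V D.

Let term_ge0 d : 0 <= term d.
Proof. by apply: divr_ge0; rewrite ?gw_ge0 // mulr_ge0 ?size2_ge0 ?tauX_ge0. Qed.

Let Z_ge0 D : 0 <= Z D. Proof. by apply: sumr_ge0 => d _; apply: term_ge0. Qed.

(** The inner map [I + U]: the identity contributes [tau]. *)
Lemma snorm_inner D i : (0 < D)%N ->
  snorm beta tau D.+1 1 (fps_of_mpoly (tnth (trunc_map D (fadd Id U)) i)) <= tau + Z D.
Proof.
move=> D0; pose c d : R := if d == 1%N then 1 else if (d <= D)%N then size2 d U V else 0.
apply: le_trans (snorm_le beta tau_gt0 (c := c) _) _ => [d /andP[d1 dD]|].
  rewrite /c tnth_mktuple; case: eqP => [->|/eqP dn1].
    rewrite (@eq_nrm _ _ _ _ (Id i)) ?nrm_fid // => m m1.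
    by rewrite /fps_of_mpoly trunc_coef m1 D0 /fadd U2 ?addr0 ?m1.
  case: leqP => [dD'|Dd]; last first.
    by rewrite nrm0 // => m md; rewrite /fps_of_mpoly trunc_coef md leqNgt Dd.
  rewrite (@eq_nrm _ _ _ _ (U i)) => [|m md].
    by rewrite /size2 (bigD1 i) //= -addrA lerDl addr_ge0 ?nrm_ge0 // sumr_ge0 // => j _;
       rewrite addr_ge0 ?nrm_ge0.
  rewrite /fps_of_mpoly trunc_coef md dD' /fadd fid_coef.
  case: eqP => [mE|_]; last by rewrite add0r.
  by move: dn1; rewrite -md mE mdeg1 eqxx.
rewrite big_mkcond big_ord_recl /= add0r big_ord_recl /= subn1 gw0 expr1 /c /= mul1r divr1.
rewrite lerD2l /Z /weighted_size big_mkcond [leRHS]big_mkcond /=.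
rewrite [leRHS]big_ord_recl /= add0r.
case: D D0 {c} => // D _; rewrite [leRHS]big_ord_recl /= add0r big_ord_recr /=.
rewrite /bump /= !add1n ltnn mul0r mul0r addr0.
apply: ler_sum => d _; rewrite /bump /=.
have -> : (1 + (1 + d) <= D.+1)%N = true by rewrite !add1n ltnS ltn_ord.
by rewrite subn1.
Qed.

(** As [F] has order two, the part of degree [D + 1] of [F o (I + U)] involves
    only the parts of [U] of degree at most [D]: the bound is in terms of
    [Z D] although the sum runs to [D + 1]. *)
Lemma composition_term D : (0 < D)%N ->
  \sum_(d < D.+2 | (2 <= d)%N)
     (\sum_i nrm d (fcomp F (fadd Id U) i)) * tau ^+ d / gw beta d.-1
  <= \sum_(k < D.+2 | (2 <= k)%N) (\sum_i l1 k (F i)) * (tau + Z D) ^+ k / gw beta k.-1.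
Proof.
move=> D0; have phi1 := order_ge_fid_add U2.
pose q := trunc_map D (fadd Id U).
have q1 i : mord_ge 1 (tnth q i) by apply: trunc_map_mord.
apply: (@le_trans _ _ (\sum_i snorm beta tau D.+1 1 (fps_of_mpoly (trunc D.+1 (F i) \mPo q)))).
  rewrite /snorm exchange_big /= big_mkcond [leRHS]big_mkcond; apply: ler_sum => d _ /=.
  case: (leqP 2 d) => d2; last first.
    case: ifP => // _; apply: sumr_ge0 => i _; apply: divr_ge0; last exact: gw_ge0.
    by apply: mulr_ge0; rewrite ?nrm_ge0 ?tauX_ge0.
  rewrite (ltnW d2) subn1 !mulr_suml; apply: ler_sum => i _.
  suff E : nrm d (fcomp F (fadd Id U) i) = nrm d (fps_of_mpoly (trunc D.+1 (F i) \mPo q)).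
    by rewrite [X in X * _ * _ <= _]E.
  apply: eq_nrm => m md.
  have mD : (mdeg m <= D.+1)%N by rewrite md -ltnS.
  rewrite /fcomp (approx_comp_trunc (F i) phi1 mD) /fps_of_mpoly.
  apply/eqP; rewrite -subr_eq0 -mcoeffB; apply/eqP.
  apply: (mord_ge_compB (e := D) (s := 2)) => // [|u|u|].
  - by move=> u u2; rewrite trunc_coef F2 ?if_same.
  - exact: trunc_map_mord.
  - apply: (approxB (f := fadd Id U u)); last exact: trunc_map_approx.
    exact: (approx_le (leqnSn D) (trunc_map_approx _ _)).
  - by rewrite addn2.
apply: (@le_trans _ _ (\sum_i \sum_(k < D.+2 | (2 <= k)%N)
    l1 k (F i) * (tau + Z D) ^+ k / gw beta k.-1)).
  apply: ler_sum => i _; apply: snorm_comp => // [m m2||j].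
  - exact: F2.
  - by apply: addr_ge0; [exact: ltW | exact: Z_ge0].
  - exact: snorm_inner.
rewrite exchange_big le_eqVlt; apply/orP; left; apply/eqP => /=.
by apply: eq_bigr => k _; rewrite !mulr_suml.
Qed.

Lemma nrm_jacobian d :
  \sum_i nrm d (jacobian_apply U V i) <=
  \sum_(a < d.+1) a.+1%:R * (\sum_i nrm a.+1 (U i)) * (\sum_j nrm (d - a) (V j)).
Proof.
apply: (@le_trans _ _ (\sum_i \sum_j \sum_(a < d.+1)
   a.+1%:R * nrm a.+1 (U i) * nrm (d - a) (V j))).
  apply: ler_sum => i _; apply: le_trans (nrm_sum _ _ _ _) _; apply: ler_sum => j _.
  apply: le_trans (nrm_fps_mul _ _ _) _; apply: ler_sum => a _.
  by apply: ler_wpM2r; [exact: nrm_ge0 | exact: nrm_deriv].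
rewrite le_eqVlt; apply/orP; left; apply/eqP.
under eq_bigr do rewrite exchange_big /=.
rewrite exchange_big; apply: eq_bigr => a _ /=.
rewrite -mulrA mulr_suml mulr_sumr; apply: eq_bigr => i _.
by rewrite -mulr_sumr mulrA.
Qed.

(** Here [U] and [V] have order two, so [DU.V] also involves only lower
    degrees. The factor [a + 1] of the derivative is absorbed by [gw_deriv]
    when [beta >= 1]; when [V = 0] there is nothing to bound. *)
Lemma jacobian_term D : (0 < D)%N ->
  \sum_(d < D.+2 | (2 <= d)%N)
     (\sum_i nrm d (jacobian_apply U V i)) * tau ^+ d / gw beta d.-1
  <= Z D ^+ 2 / tau.
Proof.
move=> D0.
case: V0_or => [beta1|V0]; last first.
  rewrite big1 ?divr_ge0 ?sqr_ge0 ?ltW // => d _.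
  rewrite big1 ?mul0r // => i _; apply: nrm0 => m _.
  apply: big1 => j _; rewrite /fps_mul (_ : trunc _ (V j) = 0) ?mulr0 ?mcoeff0 //.
  by apply/mpolyP => k; rewrite trunc_coef V0 if_same mcoeff0.
pose A a := if (a < D)%N && (0 < a)%N then term a.+1 else 0.
pose B b := if (b <= D)%N && (1 < b)%N then term b else 0.
have A0 a : 0 <= A a by rewrite /A; case: ifP.
have B0 b : 0 <= B b by rewrite /B; case: ifP.
have ZA : \sum_(a < D.+2) A a = Z D.
  rewrite /Z /weighted_size [RHS]big_mkcond [RHS]big_ord_recl /= add0r.
  rewrite !big_ord_recr /= {2 3}/A /= ltnn !ltnNge leqnSn /= !addr0.
  by apply: eq_bigr => a _; rewrite /A ltn_ord /= /bump /= add1n ltnS.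
have ZB : \sum_(b < D.+2) B b = Z D.
  rewrite big_ord_recr /= {2}/B ltnn /= addr0 /Z /weighted_size [RHS]big_mkcond.
  by apply: eq_bigr => b _; rewrite /B -ltnS ltn_ord.
apply: (@le_trans _ _ ((\sum_(d < D.+2) \sum_(a < d.+1) A a * B (d - a)%N) / tau)); last first.
  apply: ler_wpM2r; first by rewrite invr_ge0 ltW.
  by rewrite expr2 -{1}ZA -ZB; apply: sum_convolution_le.
rewrite mulr_suml big_mkcond; apply: ler_sum => d _.
have AB0 : 0 <= \sum_(a < d.+1) A a * B (d - a)%N.
  by apply: sumr_ge0 => a _; apply: mulr_ge0.
have tau_ge0 := ltW tau_gt0.
case: ifP => d2; last by apply: divr_ge0.
rewrite -mulrA; apply: le_trans (ler_wpM2r _ (nrm_jacobian d)) _.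
  by apply: divr_ge0; rewrite ?gw_ge0 ?tauX_ge0.
rewrite !mulr_suml; apply: ler_sum => a _.
have ad : (a <= d)%N by rewrite -ltnS.
pose u b : R := \sum_i nrm b (U i); pose v b : R := \sum_j nrm b (V j).
have u0 b : (b < 2)%N -> u b = 0.
  by move=> b2; apply: big1 => i _; apply: nrm0 => m mb; rewrite U2 ?mb.
have v0 b : (b < 2)%N -> v b = 0.
  by move=> b2; apply: big1 => i _; apply: nrm0 => m mb; rewrite V2 ?mb.
have u_ge0 b : 0 <= u b by apply: sumr_ge0 => i _; apply: nrm_ge0.
have v_ge0 b : 0 <= v b by apply: sumr_ge0 => i _; apply: nrm_ge0.
have sE b : size2 b U V = u b + v b by rewrite /size2 big_split.
rewrite -/(u a.+1) -/(v (d - a)%N).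
case: (posnP a) => [a0|a0].
  by rewrite u0 ?a0 // mulr0 !mul0r; apply: divr_ge0 => //; apply: mulr_ge0.
case: (ltnP (d - a) 2) => da.
  by rewrite v0 // mulr0 !mul0r; apply: divr_ge0 => //; apply: mulr_ge0.
have dD : (d < D.+2)%N by [].
have -> : A a = term a.+1 by rewrite /A a0 andbT; case: ltnP => //; lia.
have -> : B (d - a)%N = term (d - a)%N by rewrite /B da andbT; case: leqP => //; lia.
rewrite /term !sE /=.
apply: (@le_trans _ _ ((u a.+1 * v (d - a)%N) * (tau ^+ d / (gw beta a * gw beta (d - a).-1)))).
  have -> : a.+1%:R * u a.+1 * v (d - a)%N * (tau ^+ d / gw beta d.-1) =
      (u a.+1 * v (d - a)%N) * (tau ^+ d * (a.+1%:R / gw beta d.-1)) by ring.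
  apply: ler_wpM2l; first exact: mulr_ge0.
  apply: ler_wpM2l; first exact: tauX_ge0.
  rewrite ler_pdivrMr ?gw_gt0 // mulrC ler_pdivlMr ?mulr_gt0 ?gw_gt0 //.
  have -> : d.-1 = (a + (d - a).-1)%N by lia.
  by apply: gw_deriv => //; lia.
have -> : tau ^+ d = tau ^+ a * tau ^+ (d - a) by rewrite -exprD subnKC.
have -> : (u a.+1 + v a.+1) * tau ^+ a.+1 / gw beta a *
    ((u (d - a)%N + v (d - a)%N) * tau ^+ (d - a) / gw beta (d - a).-1) / tau =
  ((u a.+1 + v a.+1) * (u (d - a)%N + v (d - a)%N)) *
     (tau ^+ a * tau ^+ (d - a) / (gw beta a * gw beta (d - a).-1)).
  by rewrite exprS; field; rewrite !gw_neq0 gt_eqF.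
apply: ler_wpM2r.
  by rewrite divr_ge0 ?mulr_ge0 ?tauX_ge0 ?gw_ge0.
by apply: ler_pM => //; rewrite ?lerDl ?lerDr.
Qed.

Lemma weighted_size_step D : (0 < D)%N ->
  Z D.+1 <= K * (\sum_(k < D.+2 | (2 <= k)%N)
                   (\sum_i l1 k (F i)) * (tau + Z D) ^+ k / gw beta k.-1 + Z D ^+ 2 / tau).
Proof.
move=> D0; apply: le_trans (ler_wpM2l _ (lerD (composition_term D0) (jacobian_term D0))).
  rewrite -big_split mulr_sumr; apply: ler_sum => d d2 /=.
  rewrite -!mulrDl !mulrA; do 2?[apply: ler_wpM2r]; last exact: bound.
    by rewrite invr_ge0 gw_ge0.
  exact: tauX_ge0.
exact: le_trans K_ge1.
Qed.

End Estimate.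

(** The main estimate. A pair [(U, V)] whose part of degree [d] is controlled,
    uniformly in [d], by that of [F o (I + U)] and of [DU.V] is of Gevrey
    order [beta]. By induction on the degree, the weighted sums
    [weighted_size beta tau U V D] stay below [eps * tau] with
    [eps = 1 / (2 K)]: the composition contributes [O(tau^2)] because [F] has
    order two, and the quadratic term contributes
    [K * eps ^ 2 * tau = eps * tau / 2]. *)
Lemma gevrey_estimate (alpha beta K : R) F U V :
    0 <= alpha -> alpha <= beta -> 1 <= K ->
    order_ge 2 F -> order_ge 2 U -> order_ge 2 V -> gevrey alpha F ->
    (forall d, (2 <= d)%N ->
      size2 d U V <= K * (\sum_i nrm d (fcomp F (fadd Id U) i)
                        + \sum_i nrm d (jacobian_apply U V i))) ->
    1 <= beta \/ (forall i m, V i m = 0) ->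
  gevrey beta U /\ gevrey beta V.
Proof.
move=> a0 ab K1 F2 U2 V2 Fg bound V0_or; have b0 := le_trans a0 ab.
have [B [r [B0 r1 Fk]]] := gevrey_pred a0 ab Fg.
have K0 : 0 < K by apply: lt_le_trans K1.
have r0 : 0 < r by apply: lt_le_trans r1.
pose eps := (2 * K)^-1; have eps0 : 0 < eps by rewrite invr_gt0 mulr_gt0.
have Keps : 2 * K * eps = 1 by rewrite divff // gt_eqF ?mulr_gt0.
have eps1 : eps <= 1 by nra.
(* [4 * r * tau <= 1] makes the ratio of the geometric series of the
   composition at most 1/2, and [32 * K ^ 2 * B * r ^ 2 * tau <= 1] makes
   [K] times the composition term at most half of [eps * tau]. *)
pose M := 4 * r + 32 * K ^+ 2 * B * r ^+ 2.
have M0 : 0 < M by rewrite addr_gt0 ?mulr_gt0 ?exprn_gt0.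
pose tau := M^-1; have tau0 : 0 < tau by rewrite invr_gt0.
have tau_ge0 := ltW tau0; have K_ge0 := ltW K0; have r_ge0 := ltW r0.
have B_ge0 := ltW B0; have eps_ge0 := ltW eps0.
have tauM : tau * M = 1 by rewrite mulVf // gt_eqF.
have tau4 : 4 * r * tau <= 1.
  apply: (@le_trans _ _ (tau * M)); last by rewrite tauM.
  rewrite mulrC ler_wpM2l // /M lerDl.
  by rewrite !mulr_ge0 ?exprn_ge0.
have tau32 : 32 * K ^+ 2 * B * r ^+ 2 * tau <= 1.
  apply: (@le_trans _ _ (tau * M)); last by rewrite tauM.
  rewrite mulrC ler_wpM2l // /M lerDr.
  by rewrite !mulr_ge0.
have Z_le D : weighted_size beta tau U V D <= eps * tau.
  elim: D => [|D IHD].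
    rewrite /weighted_size big1 => [|d]; last by case: d => -[].
    by rewrite mulr_ge0.
  case: (posnP D) => [->|D0].
    rewrite /weighted_size big1 => [|d]; last by case: d => -[|[]].
    by rewrite mulr_ge0.
  apply: le_trans (weighted_size_step b0 K1 F2 U2 V2 bound V0_or tau0 D0) _.
  set Z := weighted_size _ _ _ _ _ in IHD *.
  have Z0 : 0 <= Z.
    apply: sumr_ge0 => d _; apply: divr_ge0; last exact: gw_ge0.
    by rewrite mulr_ge0 ?size2_ge0 ?exprn_ge0.
  have sum_le : \sum_(k < D.+2 | (2 <= k)%N)
      (\sum_i l1 k (F i)) * (tau + Z) ^+ k / gw beta k.-1 <= B * (8 * r ^+ 2 * tau ^+ 2).
    apply: (@le_trans _ _ (\sum_(k < D.+2 | (2 <= k)%N) B * (2 * r * tau) ^+ k)).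
      apply: ler_sum => k k2; rewrite ler_pdivrMr ?gw_gt0 //.
      have -> : B * (2 * r * tau) ^+ k * gw beta k.-1 =
        B * r ^+ k * gw beta k.-1 * (2 * tau) ^+ k by rewrite !exprMn; ring.
      apply: ler_pM; rewrite ?exprn_ge0 ?addr_ge0 //.
      - by apply: sumr_ge0 => i _; apply: sumr_ge0 => m _; apply: normc_ge0.
      - by apply: Fk; apply: ltnW.
      - rewrite lerXn2r ?nnegrE ?addr_ge0 ?mulr_ge0 //.
        by nra.
    rewrite -mulr_sumr ler_wpM2l //.
    apply: le_trans (sum_geometric_le _ _ _) _.
    - by rewrite !mulr_ge0.
    - by apply: le_trans tau4; nra.
    - by rewrite !exprMn; nra.
  have Z2 : Z ^+ 2 / tau <= eps ^+ 2 * tau.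
    rewrite ler_pdivrMr // -mulrA -expr2 -exprMn lerXn2r ?nnegrE //.
    by rewrite mulr_ge0.
  apply: le_trans (ler_wpM2l (ltW K0) (lerD sum_le Z2)) _.
  have -> : K * (B * (8 * r ^+ 2 * tau ^+ 2) + eps ^+ 2 * tau) =
     (32 * K ^+ 2 * B * r ^+ 2 * tau) * (4 * K)^-1 * tau + K * eps * eps * tau.
    by field; rewrite gt_eqF.
  have -> : K * eps = 2^-1 by rewrite /eps; field; rewrite gt_eqF.
  have -> : (4 * K)^-1 = 2^-1 * eps by rewrite /eps; field; rewrite gt_eqF.
  move: tau32; set y := 32 * _ * _ * _ * _ => y1.
  have et : 0 <= eps * tau by rewrite mulr_ge0.
  by nra.
have tauV_ge0 : 0 <= tau^-1 by rewrite invr_ge0.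
have size_le d : size2 d U V <= tau * tau^-1 ^+ d * gw beta d.
  case: (ltnP d 2) => d2.
    rewrite /size2 big1 => [|i _]; first by apply: mulr_ge0; rewrite ?gw_ge0 // mulr_ge0 ?exprn_ge0.
    by rewrite !nrm0 ?addr0 // => m md; rewrite (U2, V2) ?md.
  have := Z_le d; rewrite /weighted_size (bigD1 ord_max) //= => Zd.
  have term_le : size2 d U V * tau ^+ d / gw beta d.-1 <= tau.
    apply: le_trans (_ : eps * tau <= _); last by rewrite ler_piMl.
    apply: le_trans Zd; rewrite lerDl sumr_ge0 // => k _.
    by rewrite divr_ge0 ?gw_ge0 // mulr_ge0 ?size2_ge0 ?exprn_ge0.
  rewrite ler_pdivrMr ?gw_gt0 // in term_le.
  rewrite -(ler_pM2r (exprn_gt0 d tau0)); apply: le_trans term_le _.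
  have -> : tau * tau^-1 ^+ d * gw beta d * tau ^+ d = tau * gw beta d.
    by rewrite exprVn; field; rewrite expf_neq0 ?gt_eqF.
  by rewrite ler_wpM2l // gw_mono // leq_pred.
split; apply: (gevrey_nrm (B := tau) (r := tau^-1)) => //; rewrite ?invr_gt0 // => d i;
  apply: le_trans (size_le d); rewrite /size2 (bigD1 i) //=.
- rewrite -addrA lerDl addr_ge0 ?nrm_ge0 // sumr_ge0 // => j _.
  by rewrite addr_ge0 ?nrm_ge0.
- rewrite addrAC lerDr addr_ge0 ?nrm_ge0 // sumr_ge0 // => j _.
  by rewrite addr_ge0 ?nrm_ge0.
Qed.

End GevreyEstimate.

(** * Spectral gap for a representation of sl2 *)

Section SpectralGap.
Variable C : numClosedFieldType.
Local Open Scope sesquilinear_scope.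

Definition sqn D (v : 'rV[C]_D) : C := (v *m v ^t*) 0 0.

Lemma sqnE D (v : 'rV[C]_D) : sqn v = \sum_i `|v 0 i| ^+ 2.
Proof. by rewrite /sqn mxE; apply: eq_bigr => i _; rewrite !mxE normCK. Qed.

Lemma sqn_ge0 D (v : 'rV[C]_D) : 0 <= sqn v.
Proof. by rewrite sqnE; apply: sumr_ge0 => i _; rewrite exprn_ge0. Qed.

Lemma sqn_eq0 D (v : 'rV[C]_D) : sqn v = 0 -> v = 0.
Proof.
rewrite sqnE => /eqP; rewrite psumr_eq0 => [/allP v0|i _]; last exact: exprn_ge0.
apply/rowP => i; rewrite mxE; have := v0 i; rewrite mem_index_enum => /(_ isT).
by rewrite expf_eq0 /= normr_eq0 => /eqP.
Qed.

Lemma mulmx_trmxC m n p (A : 'M[C]_(m, n)) (B : 'M_(n, p)) : (A *m B)^t* = B^t* *m A^t*.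
Proof. by rewrite trmx_mul map_mxM. Qed.

Lemma trmxCK m n (A : 'M[C]_(m, n)) : A^t* ^t* = A.
Proof. by apply/matrixP => i j; rewrite !mxE conjCK. Qed.

(** Matrices act on row vectors by right multiplication. The hypotheses say
    that the operator [A : v |-> v *m M], its adjoint [v |-> v *m M^t*] and the
    diagonal operator [H] satisfy the relations of sl2; [T = M^t* *m M]
    represents [A A^*]. *)
Section Triple.
Variables (D : nat) (M : 'M[C]_D) (h : 'I_D -> int).
Let H : 'M[C]_D := diag_mx (\row_i (h i)%:~R).
Hypothesis MM : M^t* *m M - M *m M^t* = H.
Hypothesis MH : M *m H - H *m M = 2 *: M.

Let HC : H^t* = H.
Proof.
apply/matrixP => i j; rewrite !mxE eq_sym; case: eqP => [->|_]; last by rewrite mulr0n rmorph0.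
by rewrite !mulr1n rmorph_int.
Qed.

Let MsH : M^t* *m H = H *m M^t* - 2 *: M^t*.
Proof.
have := congr1 (fun A => A^t*) MH.
rewrite linearB /= map_mxB !mulmx_trmxC HC.
rewrite (_ : (2 *: M)^t* = 2 *: M^t*) => [E|]; last first.
  by apply/matrixP => i j; rewrite !mxE rmorphM rmorph_nat.
by rewrite -E opprB addrC subrK.
Qed.

(** The operator [A^*] maps a common eigenvector of [A A^*] and [H] to
    another one, both eigenvalues being shifted by integers, and it lowers the
    weight, so that it is nilpotent. The last nonzero iterate is killed by
    [A^*], hence its eigenvalue for [A A^*] is 0, and all the previous ones are
    integers. *)
Lemma eigenvalue_int_weight (x : 'rV[C]_D) (lam : C) (mu : int) :
    x != 0 -> x *m (M^t* *m M) = lam *: x -> x *m H = mu%:~R *: x ->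
  exists z : int, lam = z%:~R.
Proof.
have [N] := ubnP #|[set i | (h i < mu)%R]|.
elim: N x lam mu => // N IHN x lam mu cardN x0 xT xH.
have [y0|y0] := eqVneq (x *m M^t*) 0.
  exists 0; move: xT; rewrite mulmxA y0 mul0mx => /esym/eqP.
  by rewrite scaler_eq0 (negbTE x0) orbF => /eqP.
have yH : (x *m M^t*) *m H = (mu - 2)%:~R *: (x *m M^t*).
  by rewrite -mulmxA MsH mulmxBr mulmxA xH -scalemxAl -scalemxAr intrB scalerBl.
have yT : (x *m M^t*) *m (M^t* *m M) = (lam + (mu - 2)%:~R) *: (x *m M^t*).
  have -> : M^t* *m M = H + M *m M^t* by rewrite -MM subrK.
  rewrite mulmxDr yH !mulmxA -(mulmxA x) xT -scalemxAl -scalerDl.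
  by rewrite addrC.
have [i yi] : exists i, (x *m M^t*) 0 i != 0.
  apply/existsP; apply: contraR y0 => /existsPn y0; apply/eqP/rowP => i.
  by rewrite [RHS]mxE; have := y0 i; rewrite negbK => /eqP.
have hi : h i = mu - 2.
  have /rowP/(_ i) := yH; rewrite mul_mx_diag mxE [RHS]mxE mulrC [X in X * _]mxE.
  by move=> /(mulIf yi) /eqP; rewrite eqr_int => /eqP.
have [|z zE] := IHN _ _ _ _ y0 yT yH.
  rewrite -ltnS; apply: leq_trans cardN; rewrite ltnS; apply: proper_card.
  apply/properP; split.
    by apply/subsetP => j; rewrite !inE => /lt_trans; apply; rewrite gtrDl.
  by exists i; rewrite !inE hi ?ltxx // gtrDl.
by exists (z - (mu - 2)); rewrite intrB -zE addrK.
Qed.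

(** [A A^*] commutes with [H]; projecting an eigenvector to an eigenspace of
    [H] reduces to the previous lemma. *)
Lemma eigenvalue_int (x : 'rV[C]_D) (lam : C) :
  x != 0 -> x *m (M^t* *m M) = lam *: x -> exists z : int, lam = z%:~R.
Proof.
move=> x0 xT; set T := M^t* *m M in xT *.
have TH : T *m H = H *m T.
  have MH' : M *m H = H *m M + 2 *: M by rewrite -MH addrC subrK.
  rewrite /T -mulmxA MH' mulmxDr mulmxA MsH mulmxBl -scalemxAl -scalemxAr.
  by rewrite subrK mulmxA.
have [i0 xi0] : exists i, x 0 i != 0.
  apply/existsP; apply: contraR x0 => /existsPn x0; apply/eqP/rowP => i.
  by rewrite mxE; have := x0 i; rewrite negbK => /eqP.
pose E : 'M[C]_D := diag_mx (\row_j (h j == h i0)%:R).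
have comE (S : 'M[C]_D) : S *m H = H *m S -> S *m E = E *m S.
  move=> /matrixP SH; apply/matrixP => i j; move: (SH i j).
  rewrite !mul_mx_diag !mul_diag_mx !mxE.
  have [-> _ | Sij] := eqVneq (S i j) 0; first by rewrite mul0r mulr0.
  rewrite [RHS]mulrC => /(mulfI Sij)/eqP; rewrite eqr_int => /eqP ->.
  exact: mulrC.
have TE := comE _ TH.
apply: (@eigenvalue_int_weight (x *m E) lam (h i0)).
- apply: contra_neq xi0 => /rowP/(_ i0).
  by rewrite mul_mx_diag !mxE eqxx mulr1.
- by rewrite -/T -mulmxA -TE mulmxA xT -scalemxAl.
- apply/rowP => j; rewrite !mul_mx_diag !mxE.
  by case: (h j =P h i0) => [->|_]; rewrite ?mulr1 ?mulr0 ?mul0r // mulrC.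
Qed.

(** The nonzero eigenvalues of [A A^*] are positive integers, so at least 1,
    and the pseudo-inverse of [A] does not increase norms. *)
Lemma sl2_decomposition (w : 'rV[C]_D) : exists u r : 'rV[C]_D,
  [/\ w = u *m M + r, r *m M^t* = 0, sqn u <= sqn w & sqn r <= sqn w].
Proof.
set T := M^t* *m M.
have Therm : T \is hermsymmx.
  by apply/is_hermitianmxP; rewrite expr0 scale1r mulmx_trmxC trmxCK.
have /orthomx_spectralP := hermitian_normalmx Therm.
set P := spectralmx T; set d := spectral_diag T => TE.
have Pu : P \is unitarymx := spectral_unitarymx T.
have Pinv : invmx P = P^t* := invmx_unitary Pu.
have PV : P *m P^t* = 1%:M by apply/unitarymxP.
have VP : P^t* *m P = 1%:M by rewrite -Pinv mulVmx ?spectral_unit.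
have d_real i : (d 0 i)^* = d 0 i.
  have /mxOverP/(_ 0 i) := hermitian_spectral_diag_real Therm.
  by rewrite CrealE => /eqP.
have rowT i : row i P *m T = d 0 i *: row i P.
  rewrite TE Pinv -row_mul !mulmxA PV mul1mx.
  by apply/rowP => j; rewrite mul_diag_mx !mxE.
have rowP0 i : row i P != 0.
  by apply/negP => /eqP e; have := row_mul i P (P^t*); rewrite PV e mul0mx =>
    /rowP/(_ i); rewrite !mxE eqxx => /eqP; rewrite oner_eq0.
have d_int i : exists z : int, d 0 i = z%:~R := eigenvalue_int (rowP0 i) (rowT i).
have d_ge0 i : 0 <= d 0 i.
  have : 0 <= sqn (row i P *m M^t*) by apply: sqn_ge0.
  rewrite /sqn mulmx_trmxC trmxCK mulmxA -(mulmxA (row i P)) -/T rowT -scalemxAl mxE.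
  have -> : (row i P *m (row i P)^t*) 0 0 = 1.
    have /matrixP/(_ i i) := PV; rewrite !mxE eqxx mulr1n => <-.
    by apply: eq_bigr => j _; rewrite !mxE.
  by rewrite mulr1.
have d_inv i : 0 <= (d 0 i)^-1 <= 1.
  rewrite invr_ge0 d_ge0 /=; have [->|dn0] := eqVneq (d 0 i) 0; first by rewrite invr0.
  have d0 : 0 < d 0 i by rewrite lt0r dn0 d_ge0.
  by rewrite invf_le1 //; have [z zE] := d_int i; move: d0; rewrite zE ltr0z ler1z gtz0_ge1.
pose y := w *m P^t*.
have sqnP (z : 'rV[C]_D) : sqn (z *m P) = sqn z.
  by rewrite /sqn mulmx_trmxC mulmxA -(mulmxA z) PV mulmx1.
have wy : w = y *m P by rewrite -mulmxA VP mulmx1.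
(* As [0^-1 = 0], inverting the eigenvalues one by one gives the
   pseudo-inverse of [T]. *)
pose di : 'rV[C]_D := \row_i (d 0 i)^-1.
pose Tp := P^t* *m diag_mx di *m P.
pose u := w *m Tp *m M^t*.
pose e : 'rV[C]_D := \row_i (1 - (d 0 i)^-1 * d 0 i).
have rE : w - u *m M = y *m diag_mx e *m P.
  rewrite /u -!mulmxA -/T TE Pinv {1}wy /Tp -!mulmxA (mulmxA P) PV mul1mx.
  rewrite -mulmxBr; congr (w *m _); rewrite -mulmxBr; congr (_ *m _).
  rewrite -[X in X - _]mul1mx mulmxA -mulmxBl; congr (_ *m _).
  apply/matrixP => i j; rewrite mul_diag_mx !mxE; case: (i =P j) => [->|_].
    by rewrite !mulr1n.
  by rewrite !mulr0n mulr0 subrr.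
have TM z : sqn (z *m P *m M^t*) = \sum_i d 0 i * `|z 0 i| ^+ 2.
  have PTP : P *m T *m P^t* = diag_mx d.
    by rewrite TE Pinv !mulmxA PV mul1mx -mulmxA PV mulmx1.
  rewrite /sqn !mulmx_trmxC trmxCK.
  rewrite (_ : _ *m _ = z *m (P *m T *m P^t*) *m z^t*); last by rewrite /T !mulmxA.
  rewrite PTP mxE; apply: eq_bigr => i _.
  by rewrite mul_mx_diag !mxE normCK; ring.
have e01 i : e 0 i = 0 /\ d 0 i != 0 \/ e 0 i = 1 /\ d 0 i = 0.
  rewrite mxE; have [->|dn0] := eqVneq (d 0 i) 0; [right | left].
    by rewrite mulr0 subr0.
  by rewrite mulVf // subrr.
exists u, (w - u *m M); split.
- by rewrite addrC subrK.
- apply: sqn_eq0; rewrite rE TM big1 // => i _; rewrite mul_mx_diag mxE.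
  case: (e01 i) => [[-> _]|[_ ->]]; last by rewrite mul0r.
  by rewrite mulr0 normr0 expr0n /= mulr0.
- have -> : u = (y *m diag_mx di) *m P *m M^t* by rewrite /u /Tp /y !mulmxA.
  rewrite TM wy sqnP sqnE; apply: ler_sum => i _.
  have -> : (y *m diag_mx di) 0 i = y 0 i * (d 0 i)^-1.
    by rewrite mul_mx_diag mxE [di 0 i]mxE.
  have /andP[di0 di1] := d_inv i.
  rewrite normrM exprMn [X in _ * (_ * X ^+ 2)]ger0_norm //.
  rewrite mulrCA ler_piMr ?exprn_ge0 //.
  have [->|dn0] := eqVneq (d 0 i) 0; first by rewrite mul0r.
  by rewrite expr2 mulrA divff // mul1r.
- rewrite rE sqnP wy sqnP !sqnE; apply: ler_sum => i _.
  rewrite mul_mx_diag mxE normrM exprMn ler_piMr ?exprn_ge0 //.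
  by case: (e01 i) => -[-> _]; rewrite ?normr0 ?normr1 ?expr0n ?expr1n.
Qed.

End Triple.
End SpectralGap.

(** * The homological operator *)

Section Homological.
Variables (R : realType) (n : nat).
Local Notation C := R[i].
Local Open Scope sesquilinear_scope.
Implicit Types (V W : pvf R n) (p q : {mpoly C[n]}) (a b : 'M[C]_n) (d e : nat).
Implicit Types (m : 'X_{1..n}).

Definition linvf b : pvf R n := fun i => \sum_l b i l *: 'X_l.

Lemma mderivXi (i j : 'I_n) : ('X_i : {mpoly C[n]})^`M(j) = (i == j)%:R.
Proof.
rewrite mderivX mnm1E; case: eqP => [->|_]; last by rewrite scale0r.
have -> : (U_(j) - U_(j))%MM = 0%MM :> 'X_{1..n}.
  by apply/mnmP => k; rewrite mnmBE subnn mnm0E.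
by rewrite scale1r mpolyX0.
Qed.

Lemma mderiv_linvf b i j : (linvf b i)^`M(j) = (b i j)%:MP.
Proof.
rewrite /linvf (raddf_sum (mderiv j)) /= (bigD1 j) //= big1 => [|l lj]; rewrite mderivZ mderivXi.
  by rewrite eqxx addr0 -mul_mpolyC mulr1.
by rewrite (negbTE lj) scaler0.
Qed.

Lemma vf_apply_linvf V b i : vf_apply V (linvf b i) = \sum_j b i j *: V j.
Proof. by apply: eq_bigr => j _; rewrite mderiv_linvf mulrC mul_mpolyC. Qed.

(** The Lie derivative along the linear vector field of matrix [b]. *)
Definition lie b p : {mpoly C[n]} := vf_apply (linvf b) p.

(** The operator [U |-> [U, N0]] for [N0] linear of matrix [b]
    ([bracket_linvf]). *)
Definition theta b V : pvf R n := fun i => \sum_j b i j *: V j - lie b (V i).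

Lemma bracket_linvf V b : bracket V (linvf b) = theta b V.
Proof. by apply: boolp.funext => i; rewrite /bracket vf_apply_linvf. Qed.

Lemma lieE b p : lie b p = \sum_j \sum_l b j l *: ('X_l * p^`M(j)).
Proof.
apply: eq_bigr => j _; rewrite mulr_suml; apply: eq_bigr => l _.
by rewrite scalerAl.
Qed.

Lemma lie_sum (I : Type) (r : seq I) b (c : I -> C) (P : I -> {mpoly C[n]}) :
  lie b (\sum_(k <- r) c k *: P k) = \sum_(k <- r) c k *: lie b (P k).
Proof.
rewrite /lie /vf_apply; under eq_bigr => j _ do rewrite (raddf_sum (mderiv j)) mulr_sumr.
rewrite exchange_big; apply: eq_bigr => k _ /=; rewrite scaler_sumr.
by apply: eq_bigr => j _; rewrite mderivZ scalerAr.
Qed.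

Lemma theta_sum (I : Type) (r : seq I) b (c : I -> C) (V : I -> pvf R n) :
  theta b (fun i => \sum_(k <- r) c k *: V k i) =
  (fun i => \sum_(k <- r) c k *: theta b (V k) i).
Proof.
apply: boolp.funext => i; rewrite /theta lie_sum.
under [RHS]eq_bigr do rewrite scalerBr; rewrite sumrB; congr (_ - _).
under eq_bigr do rewrite scaler_sumr; rewrite exchange_big; apply: eq_bigr => k _ /=.
by rewrite scaler_sumr; apply: eq_bigr => j _; rewrite !scalerA mulrC.
Qed.

Lemma lieB b p q : lie b (p - q) = lie b p - lie b q.
Proof.
by rewrite /lie /vf_apply -sumrB; apply: eq_bigr => j _; rewrite mderivB mulrBr.
Qed.

Lemma lie_comm a b p : lie a (lie b p) - lie b (lie a p) = - lie (a *m b - b *m a) p.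
Proof.
have step u v : lie u (lie v p) = \sum_k (\sum_l (v *m u) k l *: 'X_l) * p^`M(k) +
   \sum_j \sum_k linvf u j * (linvf v k * p^`M(k)^`M(j)).
  rewrite /lie /vf_apply.
  rewrite (eq_bigr (fun j => \sum_k ((v k j *: linvf u j) * p^`M(k) +
      linvf u j * (linvf v k * p^`M(k)^`M(j))))) => [|j _]; last first.
    rewrite (raddf_sum (mderiv j)) mulr_sumr; apply: eq_bigr => k _ /=.
    by rewrite mderivM mderiv_linvf mulrDr mul_mpolyC -scalerAr scalerAl.
  under eq_bigr do rewrite big_split /=.
  rewrite big_split /=; congr (_ + _); rewrite exchange_big; apply: eq_bigr => k _ /=.
  rewrite -mulr_suml; congr (_ * _).
  rewrite (eq_bigr (fun j => \sum_l v k j *: (u j l *: 'X_l))) => [|j _]; last exact: scaler_sumr.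
  rewrite exchange_big; apply: eq_bigr => l _ /=.
  by rewrite mxE scaler_suml; apply: eq_bigr => j _; rewrite scalerA.
rewrite !step.
have -> : \sum_j \sum_k linvf a j * (linvf b k * p^`M(k)^`M(j)) =
          \sum_j \sum_k linvf b j * (linvf a k * p^`M(k)^`M(j)).
  rewrite exchange_big; apply: eq_bigr => j _; apply: eq_bigr => k _.
  by rewrite mderiv_comm mulrCA.
rewrite opprD addrACA subrr addr0 -sumrB -sumrN; apply: eq_bigr => k _.
rewrite -mulrBl -mulNr; congr (_ * _); rewrite -sumrB -sumrN; apply: eq_bigr => l _.
by rewrite -scalerBl -scaleNr !mxE opprB.
Qed.

(** [theta] is a representation of the Lie algebra of matrices: this is the
    Jacobi identity. *)
Lemma theta_comm a b V i :
  theta a (theta b V) i - theta b (theta a V) i = theta (a *m b - b *m a) V i.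
Proof.
have step u v : theta u (theta v V) i = \sum_l (u *m v) i l *: V l
    - (\sum_j u i j *: lie v (V j) + \sum_j v i j *: lie u (V j)) + lie u (lie v (V i)).
  have -> : theta u (theta v V) i = \sum_j u i j *: theta v V j - lie u (theta v V i) by [].
  have -> : \sum_j u i j *: theta v V j = \sum_l (u *m v) i l *: V l - \sum_j u i j *: lie v (V j).
    under eq_bigr do rewrite /theta scalerBr; rewrite sumrB; congr (_ - _).
    under eq_bigr do rewrite scaler_sumr; rewrite exchange_big; apply: eq_bigr => l _ /=.
    by rewrite mxE scaler_suml; apply: eq_bigr => j _; rewrite scalerA.
  by rewrite /theta lieB lie_sum opprB opprD !addrA [in LHS]addrAC.
rewrite !step.
set ab := \sum_l (a *m b) i l *: V l; set ba := \sum_l (b *m a) i l *: V l.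
have -> : theta (a *m b - b *m a) V i = ab - ba + (lie a (lie b (V i)) - lie b (lie a (V i))).
  rewrite lie_comm /theta; congr (_ + _); rewrite -sumrB; apply: eq_bigr => l _.
  by rewrite !mxE scalerBl.
set P := \sum_j a i j *: _; set Q := \sum_j b i j *: _.
have reorder (T : zmodType) (x y z s t : T) : x - z + s - (y - z + t) = x - y + (s - t).
  by rewrite opprD addrACA opprB (addrA (x - z)) subrK.
by rewrite (addrC Q P); apply: reorder.
Qed.

(** ** Adjunction *)

Lemma sum_mulX (T : comNzRingType) e (l : 'I_n) (r : {mpoly T[n]}) (g : 'X_{1..n} -> T) :
  \sum_(m <- mons n e.+1) ('X_l * r)@_m * g m =
  \sum_(k <- mons n e) r@_k * g (k + U_(l))%MM.
Proof.
rewrite (bigID (fun m : 'X_{1..n} => (0 < m l)%N)) /= [X in _ + X]big1 ?addr0 => [|m]; last first.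
  rewrite -leqNgt leqn0 => /eqP ml; rewrite mcoeffM big1 ?mul0r // => -[k1 k2] /= /eqP mE.
  rewrite mcoeffX; case: eqP => [kE|]; last by rewrite mul0r.
  have := congr1 (fun u : 'X_{1..n} => u l) mE.
  by rewrite ml mnmDE -kE mnm1E eqxx.
rewrite -big_filter (perm_big [seq (k + U_(l))%MM | k <- mons n e]).
  by rewrite big_map; apply: eq_bigr => k _; rewrite ['X_l * r]mulrC addmC mcoeffMX addmC.
apply: uniq_perm; first by rewrite filter_uniq ?mons_uniq.
  by rewrite map_inj_uniq ?mons_uniq // => u v; apply: addIm.
move=> m; rewrite mem_filter mem_mons; apply/andP/mapP => [[ml /eqP me]|[k]].
  exists (m - U_(l))%MM; last by rewrite submK // lep1mP -lt0n.
  rewrite mem_mons; have := congr1 (@mdeg n) (submK (_ : (U_(l) <= m)%MM)).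
  by rewrite lep1mP -lt0n ml => /(_ isT); rewrite mdegD mdeg1 me addn1 => -[->].
rewrite mem_mons => /eqP ke ->; rewrite mnmDE mnm1E eqxx addn1; split=> //.
by rewrite mdegD mdeg1 ke addn1.
Qed.

Definition bweightC (m : 'X_{1..n}) : C := (bweight R m)%:C%C.

Lemma conjCM (x y : C) : (x * y)^* = x^* * y^*. Proof. exact: rmorphM. Qed.

Lemma conjCMn (x : C) k : (x *+ k)^* = x^* *+ k. Proof. exact: rmorphMn. Qed.

Lemma w_conj m : (bweightC m)^* = bweightC m. Proof. exact: conjc_real. Qed.

Lemma hinnerE e p q : hinner e p q = \sum_(m <- mons n e) p@_m * (q@_m)^* * bweightC m.
Proof.
rewrite /hinner (big_mons _ (fun u => p@_u * (q@_u)^* *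
   ((\prod_(i < n) (u i)`!)%N%:R / (e`!%N)%:R)) (ltnSn e)).
rewrite big_seq [RHS]big_seq; apply: eq_bigr => m; rewrite mem_mons => /eqP me.
by rewrite /bweightC /bweight me rmorphM fmorphV !rmorph_nat.
Qed.

Lemma w_U m i : (m i).+1%:R * bweightC m = (mdeg m).+1%:R * bweightC (m + U_(i))%MM.
Proof.
transitivity (((m i).+1%:R * bweight R m)%:C)%C; first by rewrite rmorphM rmorph_nat.
by rewrite bweightU rmorphM rmorph_nat.
Qed.

(** Multiplication by a variable and derivation are adjoint to each other, up
    to the degree: this is what makes the Bombieri product suited to linear
    vector fields. *)
Lemma hinner_mulX_deriv e p q (j l : 'I_n) :
  hinner e ('X_l * p^`M(j)) q = hinner e p ('X_j * q^`M(l)).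
Proof.
case: e => [|e].
  have X0 i (r : {mpoly C[n]}) : ('X_i * r)@_0%MM = 0.
    have Xi1 : mord_ge 1 ('X_i : {mpoly C[n]}).
      by move=> m; rewrite ltnS leqn0 mdeg_eq0 => /eqP ->; rewrite mcoeffX mnm1_eq0.
    by apply: (mord_geM Xi1 (@mord_ge0 _ _ r)); rewrite mdeg0.
  rewrite !hinnerE !big_seq !big1 // => m; rewrite mem_mons mdeg_eq0 => /eqP ->.
    by rewrite X0 rmorph0 mulr0 mul0r.
  by rewrite X0 !mul0r.
rewrite !hinnerE.
under eq_bigr do rewrite -mulrA; rewrite sum_mulX.
have -> : \sum_(m <- mons n e.+1) p@_m * (('X_j * q^`M(l))@_m)^* * bweightC m =
   (\sum_(m <- mons n e.+1) ('X_j * q^`M(l))@_m * ((p@_m)^* * bweightC m))^*.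
  rewrite rmorph_sum; apply: eq_bigr => m _ /=.
  by rewrite !conjCM conjCK w_conj; ring.
rewrite sum_mulX rmorph_sum /= big_seq [RHS]big_seq; apply: eq_bigr => k.
rewrite mem_mons => /eqP ke; rewrite !mcoeff_deriv !conjCM conjCK w_conj conjCMn.
have e0 : e.+1%:R != 0 :> C by rewrite pnatr_eq0.
apply: (mulfI e0).
have := w_U k l; have := w_U k j; rewrite ke => wj wl.
have -> : e.+1%:R * (p@_(k + U_(j)) *+ (k j).+1 * ((q@_(k + U_(l)))^* * bweightC (k + U_(l))%MM)) =
  p@_(k + U_(j)) *+ (k j).+1 * ((q@_(k + U_(l)))^* * (e.+1%:R * bweightC (k + U_(l))%MM)) by ring.
rewrite -wl -[p@_(_) *+ _]mulr_natl -[(q@_(k + U_(l)))^* *+ _]mulr_natl.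
have -> : e.+1%:R * ((k l).+1%:R * (q@_(k + U_(l)))^* * (p@_(k + U_(j)) * bweightC (k + U_(j))%MM)) =
  (k l).+1%:R * (q@_(k + U_(l)))^* * (p@_(k + U_(j)) * (e.+1%:R * bweightC (k + U_(j))%MM)) by ring.
by rewrite -wj; ring.
Qed.

Lemma hinner_sumZl (I : Type) (r : seq I) e (c : I -> C) (P : I -> {mpoly C[n]}) q :
  hinner e (\sum_(k <- r) c k *: P k) q = \sum_(k <- r) c k * hinner e (P k) q.
Proof.
rewrite hinnerE; under [RHS]eq_bigr do rewrite hinnerE mulr_sumr.
rewrite exchange_big; apply: eq_bigr => m _ /=; rewrite raddf_sum !mulr_suml /=.
by apply: eq_bigr => k _; rewrite mcoeffZ !mulrA.
Qed.

Lemma hinner_conj e p q : hinner e q p = (hinner e p q)^*.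
Proof.
rewrite !hinnerE rmorph_sum; apply: eq_bigr => m _ /=.
by rewrite !conjCM conjCK w_conj; congr (_ * _); rewrite mulrC.
Qed.

Lemma hinner_sumZr (I : Type) (r : seq I) e (c : I -> C) (P : I -> {mpoly C[n]}) q :
  hinner e q (\sum_(k <- r) c k *: P k) = \sum_(k <- r) (c k)^* * hinner e q (P k).
Proof.
rewrite hinner_conj hinner_sumZl rmorph_sum; apply: eq_bigr => k _ /=.
by rewrite rmorphM /= -hinner_conj.
Qed.

Lemma hinnerBl e p p' q : hinner e (p - p') q = hinner e p q - hinner e p' q.
Proof.
by rewrite !hinnerE -sumrB; apply: eq_bigr => m _; rewrite mcoeffB !mulrBl.
Qed.

Lemma hinnerBr e p q q' : hinner e p (q - q') = hinner e p q - hinner e p q'.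
Proof. by rewrite hinner_conj hinnerBl rmorphB /= -!hinner_conj. Qed.

Lemma hinner_lie e b p q : hinner e (lie b p) q = hinner e p (lie (b^t*) q).
Proof.
have lieE2 c r : lie c r = \sum_(u : 'I_n * 'I_n) c u.1 u.2 *: ('X_u.2 * r^`M(u.1)).
  by rewrite lieE pair_bigA.
rewrite !lieE2 hinner_sumZl hinner_sumZr.
rewrite (reindex_inj (inv_inj (_ : involutive (fun u : 'I_n * 'I_n => (u.2, u.1))))) /=.
  by apply: eq_bigr => u _; rewrite !mxE hinner_mulX_deriv conjCK.
by case.
Qed.

Lemma theta_adjoint d b V W : vinner d (theta b V) W = vinner d V (theta (b^t*) W).
Proof.
rewrite /vinner /theta.
under eq_bigr do rewrite hinnerBl hinner_sumZl hinner_lie.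
rewrite sumrB; under [RHS]eq_bigr do rewrite hinnerBr hinner_sumZr.
rewrite [RHS]sumrB; congr (_ - _); rewrite exchange_big; apply: eq_bigr => j _ /=.
by apply: eq_bigr => i _; rewrite !mxE conjCK.
Qed.

(** Linear vector fields preserve the degree. *)
Lemma lie_coef0 b p m : (forall k, mdeg k = mdeg m -> p@_k = 0) -> (lie b p)@_m = 0.
Proof.
move=> p0; rewrite lieE raddf_sum big1 // => j _; rewrite raddf_sum big1 // => l _ /=.
rewrite mcoeffZ; have [ml|ml] := posnP (m l).
  rewrite mcoeffM big1 ?mulr0 // => -[k1 k2] /= /eqP mE.
  rewrite mcoeffX; case: eqP => [kE|]; last by rewrite mul0r.
  have := congr1 (fun u : 'X_{1..n} => u l) mE.
  by rewrite ml mnmDE -kE mnm1E eqxx.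
have mE : m = (U_(l) + (m - U_(l)))%MM by rewrite addmC submK // lep1mP -lt0n.
have e : mdeg (m - U_(l) + U_(j))%MM = mdeg m.
  by rewrite [in RHS]mE !mdegD !mdeg1 addnC.
by rewrite [in LHS]mE ['X_l * _]mulrC mcoeffMX mcoeff_deriv (p0 _ e) mul0rn mulr0.
Qed.

Lemma in_V_theta d b V : in_V d V -> in_V d (theta b V).
Proof.
move=> Vd i; rewrite /theta rpredB //.
  by apply: rpred_sum => j _; rewrite rpredZ.
apply/dhomogP => m; rewrite mcoeff_msupp; apply: contraNeq => md.
by rewrite lie_coef0 // => k km; apply: (dhomog_nemf_coeff (Vd i));
   exact: (eq_ind_r (fun x => x != d.+1) md km).
Qed.

Lemma theta_is_adjoint d b : is_adjoint d (fun V => bracket V (linvf b)) (theta (b^t*)).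
Proof.
split=> [W|V W _ _]; first exact: in_V_theta.
by rewrite bracket_linvf theta_adjoint.
Qed.

End Homological.

Lemma trmxCE (C : numClosedFieldType) m n (A : 'M[C]_(m, n)) i j :
  ((map_mx Num.conj A^T) i j = (A j i)^*)%R.
Proof. by rewrite !mxE. Qed.

Lemma rowB (T : zmodType) m n (A B : 'M[T]_(m, n)) k : row k (A - B) = row k A - row k B.
Proof. by apply/rowP => l; rewrite !mxE. Qed.

Section HomologicalMatrix.
Variables (R : realType) (n d : nat).
Local Notation C := R[i].
Local Open Scope sesquilinear_scope.
Implicit Types (V W : pvf R n) (a b : 'M[C]_n).
Local Notation e := d.+1.

(** The indices [(i, m)] of the orthonormal basis of the space of homogeneous
    vector fields formed by the [x^m / sqrt (bweight m) d/dx_i]. *)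
Definition vfbasis : seq ('I_n * 'X_{1..n}) :=
  [seq (i, m) | i <- enum 'I_n, m <- mons n e].

Local Notation D := (size vfbasis).
Definition bidx (k : 'I_D) : 'I_n * 'X_{1..n} := tnth (in_tuple vfbasis) k.

Lemma vfbasis_uniq : uniq vfbasis.
Proof. by apply: allpairs_uniq; rewrite ?enum_uniq ?mons_uniq // => -[? ?] [? ?]. Qed.

Lemma bidx_inj : injective bidx.
Proof. by apply/tuple_uniqP; apply: vfbasis_uniq. Qed.

Lemma mdeg_bidx k : mdeg (bidx k).2 = e.
Proof.
have : bidx k \in vfbasis by apply: mem_tnth.
by case/allpairsP => -[i m] /= [_ mm ->] /=; apply/eqP; rewrite -mem_mons.
Qed.

Lemma sum_bidx (T : nmodType) (F : 'I_n -> 'X_{1..n} -> T) :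
  \sum_k F (bidx k).1 (bidx k).2 = \sum_i \sum_(m <- mons n e) F i m.
Proof.
rewrite -(big_tnth _ _ vfbasis xpredT (fun u => F u.1 u.2)) big_allpairs /=.
by rewrite big_enum.
Qed.

Definition sw (m : 'X_{1..n}) : C := (Num.sqrt (bweight R m))%:C%C.

Lemma sw_sqr m : sw m * sw m = bweightC R m.
Proof. by rewrite -rmorphM -expr2 sqr_sqrtr ?bweight_ge0. Qed.

Lemma sw_neq0 m : sw m != 0.
Proof.
have w0 : bweightC R m != 0.
  by rewrite /bweightC fmorph_eq0 gt_eqF ?bweight_gt0.
by apply: contra_neq w0 => s0; rewrite -sw_sqr s0 mul0r.
Qed.

Lemma sw_conj m : (sw m)^* = sw m. Proof. exact: conjc_real. Qed.

Definition vec V : 'rV[C]_D := \row_k ((V (bidx k).1)@_((bidx k).2) * sw (bidx k).2).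

Definition bv (k : 'I_D) : pvf R n := fun i =>
  if i == (bidx k).1 then (sw (bidx k).2)^-1 *: 'X_[(bidx k).2] else 0.

Definition unvec (v : 'rV[C]_D) : pvf R n := fun i => \sum_k v 0 k *: bv k i.

Lemma in_V_bv k : in_V d (bv k).
Proof.
move=> i; rewrite /bv; case: ifP => _; last exact: rpred0.
by rewrite rpredZ // dhomogX /= mdeg_bidx.
Qed.

Lemma in_V_unvec v : in_V d (unvec v).
Proof. by move=> i; apply: rpred_sum => k _; rewrite rpredZ // in_V_bv. Qed.

Lemma vec_bv k : vec (bv k) = delta_mx 0 k.
Proof.
apply/rowP => l; rewrite !mxE /bv eqxx /=.
case: (l =P k) => [->|lk].
  by rewrite eqxx mcoeffZ mcoeffX eqxx mulr1 mulVf ?sw_neq0.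
case: eqP => [e1|]; last by rewrite mcoeff0 mul0r.
rewrite mcoeffZ mcoeffX; case: eqP => [e2|]; last by rewrite mulr0 mul0r.
by case: lk; apply: bidx_inj; rewrite [LHS]surjective_pairing e1 -e2 -surjective_pairing.
Qed.

Lemma vec_sum (I : Type) (r : seq I) (c : I -> C) (V : I -> pvf R n) :
  vec (fun i => \sum_(k <- r) c k *: V k i) = \sum_(k <- r) c k *: vec (V k).
Proof.
apply/rowP => l; rewrite mxE summxE raddf_sum mulr_suml; apply: eq_bigr => k _ /=.
by rewrite !mxE mcoeffZ mulrA.
Qed.

Lemma vecB V W : vec (fun i => V i - W i) = vec V - vec W.
Proof. by apply/rowP => l; rewrite !mxE mcoeffB mulrBl. Qed.

Lemma unvecK v : vec (unvec v) = v.
Proof.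
rewrite /unvec vec_sum; apply/rowP => l; rewrite summxE (bigD1 l) //= big1 => [|k kl].
  by rewrite mxE vec_bv mxE !eqxx mulr1 addr0.
by rewrite mxE vec_bv mxE eqxx eq_sym (negbTE kl) mulr0.
Qed.

Lemma vecK V : in_V d V -> unvec (vec V) = V.
Proof.
move=> Vd; apply: boolp.funext => i; apply/mpolyP => m; rewrite /unvec raddf_sum /=.
rewrite (eq_bigr (fun k => (fun j u => if (i == j) && (u == m) then (V j)@_u else 0)
   (bidx k).1 (bidx k).2)) => [|k _]; last first.
  rewrite mcoeffZ mxE /bv; case: eqP => [_|_] /=; last by rewrite mcoeff0 mulr0.
  rewrite mcoeffZ mcoeffX; case: eqP => [_|_]; last by rewrite !mulr0.
  by rewrite mulr1 -mulrA divff ?mulr1 ?sw_neq0.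
rewrite (sum_bidx (fun j u => if (i == j) && (u == m) then (V j)@_u else 0)).
rewrite (bigD1 i) //= [X in _ + X]big1 => [|j ji]; last first.
  by apply: big1 => u _; rewrite eq_sym (negbTE ji).
rewrite eqxx addr0 /= -big_mkcond /=.
have [me|me] := eqVneq (mdeg m) e.
  rewrite -big_filter (perm_big [:: m]) ?big_seq1 //; apply: uniq_perm => //.
    by rewrite filter_uniq ?mons_uniq.
  move=> u; rewrite mem_filter mem_mons inE; case: eqP => [->|//].
  by rewrite me eqxx.
rewrite (dhomog_nemf_coeff (Vd i)) // big_seq_cond big1 // => u /andP[].
by rewrite mem_mons => /eqP ue /eqP um; move: me; rewrite -um ue eqxx.
Qed.

Lemma vinner_vec V W : vinner d V W = \sum_k vec V 0 k * (vec W 0 k)^*.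
Proof.
rewrite /vinner; under eq_bigr do rewrite hinnerE.
rewrite -(sum_bidx (fun i m => (V i)@_m * ((W i)@_m)^* * bweightC R m)).
by apply: eq_bigr => k _; rewrite !mxE conjCM sw_conj -sw_sqr; ring.
Qed.

Lemma vinner_bvr V k : vinner d V (bv k) = vec V 0 k.
Proof.
rewrite vinner_vec vec_bv (bigD1 k) //= big1 => [|l lk]; rewrite [delta_mx _ _ _ _]mxE eqxx /=.
  by rewrite eqxx rmorph1 mulr1 addr0.
by rewrite (negbTE lk) rmorph0 mulr0.
Qed.

Lemma vinner_bvl V k : vinner d (bv k) V = (vec V 0 k)^*.
Proof.
rewrite vinner_vec vec_bv (bigD1 k) //= big1 => [|l lk]; rewrite [delta_mx _ _ _ _]mxE eqxx /=.
  by rewrite eqxx mul1r addr0.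
by rewrite (negbTE lk) mul0r.
Qed.

Definition thetamx b : 'M[C]_D := locked (\matrix_(k, l) vec (theta b (bv k)) 0 l).

Lemma thetamxE b k l : thetamx b k l = vec (theta b (bv k)) 0 l.
Proof. by rewrite /thetamx -lock mxE. Qed.

Lemma vec_theta b V : in_V d V -> vec (theta b V) = vec V *m thetamx b.
Proof.
move=> Vd; rewrite -{1}(vecK Vd) /unvec theta_sum vec_sum.
apply/rowP => l; rewrite summxE mxE; apply: eq_bigr => k _.
by rewrite thetamxE [LHS]mxE.
Qed.

Lemma thetamx_adjoint b : (thetamx b)^t* = thetamx (b^t*).
Proof.
apply/matrixP => k l; rewrite [RHS]thetamxE.
transitivity ((thetamx b l k)^*); first exact: trmxCE.
rewrite thetamxE -[RHS](vinner_bvr (theta (b^t*) (bv k)) l) theta_adjoint trmxCK.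
by rewrite [RHS]vinner_bvl.
Qed.

Lemma row_thetamx b k : row k (thetamx b) = vec (theta b (bv k)).
Proof. by apply/rowP => l; rewrite mxE thetamxE. Qed.

(** Matrices act on the right, hence the order of the products. *)
Lemma thetamx_comm a b :
  thetamx b *m thetamx a - thetamx a *m thetamx b = thetamx (a *m b - b *m a).
Proof.
apply/row_matrixP => k; rewrite [RHS]row_thetamx.
have mulE c c' : row k (thetamx c *m thetamx c') = vec (theta c' (theta c (bv k))).
  have -> : row k (thetamx c *m thetamx c') = row k (thetamx c) *m thetamx c' by exact: row_mul.
  by rewrite row_thetamx -vec_theta //; apply: in_V_theta; apply: in_V_bv.
transitivity (vec (theta a (theta b (bv k))) - vec (theta b (theta a (bv k)))).
  apply: etrans (rowB _ _ _) _.
  by apply: (f_equal2 (fun x y : 'rV[C]_D => x - y)); apply: mulE.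
rewrite -vecB; congr vec; apply: boolp.funext => i.
exact: theta_comm.
Qed.

Lemma thetamxZ c b : thetamx (c *: b) = c *: thetamx b.
Proof.
apply/row_matrixP => k; rewrite row_thetamx.
have -> : theta (c *: b) (bv k) = (fun i => \sum_(u <- [:: tt]) c *: theta b (bv k) i).
  apply: boolp.funext => i; rewrite big_seq1 /theta scalerBr scaler_sumr !lieE scaler_sumr.
  congr (_ - _); apply: eq_bigr => j _; first by rewrite mxE scalerA.
  by rewrite scaler_sumr; apply: eq_bigr => l _; rewrite mxE scalerA.
rewrite (vec_sum _ (fun=> c) (fun=> theta b (bv k))) big_seq1 -row_thetamx.
by apply/rowP => l; rewrite !mxE.
Qed.

(** The fields [x^m d/dx_i] are eigenvectors, of integer weight, of the
    diagonal linear fields. *)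
Lemma thetamx_diag (h : 'I_n -> int) :
  thetamx (diag_mx (\row_i (h i)%:~R)) =
  diag_mx (\row_k (h (bidx k).1 - \sum_j ((bidx k).2 j)%:Z * h j)%:~R).
Proof.
set b := diag_mx _; apply/row_matrixP => k; rewrite row_thetamx.
pose wt := h (bidx k).1 - \sum_j ((bidx k).2 j)%:Z * h j.
have bE i (P : 'I_n -> {mpoly C[n]}) : \sum_j b i j *: P j = (h i)%:~R *: P i.
  rewrite (bigD1 i) //= big1 => [|j ji]; rewrite !mxE.
    by rewrite eqxx mulr1n addr0.
  by rewrite eq_sym (negbTE ji) mulr0n scale0r.
have lieX (m : 'X_{1..n}) : lie b 'X_[m] = (\sum_j (m j)%:Z * h j)%:~R *: 'X_[m].
  rewrite /lie /vf_apply; under eq_bigr do rewrite /linvf bE.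
  rewrite rmorph_sum scaler_suml; apply: eq_bigr => j _ /=.
  rewrite mderivX -scalerAl -scalerAr scalerA rmorphM /= mulrC.
  have [mj|mj] := posnP (m j); first by rewrite mj !mul0r !scale0r.
  by rewrite -mpolyXD addmC submK // lep1mP -lt0n.
have -> : theta b (bv k) = (fun i => \sum_(u <- [:: tt]) wt%:~R *: bv k i).
  apply: boolp.funext => i; rewrite big_seq1 /theta bE /bv.
  case: eqP => [->|_]; last first.
    rewrite !scaler0 add0r /lie /vf_apply big1 ?oppr0 // => j _.
    by rewrite mderiv0 mulr0.
  have -> : lie b ((sw (bidx k).2)^-1 *: 'X_[(bidx k).2]) =
     (sw (bidx k).2)^-1 *: lie b 'X_[(bidx k).2].
    have := lie_sum [:: tt] b (fun=> (sw (bidx k).2)^-1) (fun=> 'X_[(bidx k).2]).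
    by rewrite !big_seq1.
  have swap (x y : C) (p : {mpoly C[n]}) : x *: (y *: p) = y *: (x *: p).
    by rewrite !scalerA mulrC.
  by rewrite lieX [X in _ - X]swap -scalerBl /wt rmorphB.
rewrite (vec_sum _ (fun=> _) (fun=> bv k)) big_seq1 vec_bv.
apply/rowP => l; rewrite !mxE eqxx /= eq_sym; have [kl|kl] := eqVneq k l.
  by rewrite !mulr1n mulr1.
by rewrite !mulr0n mulr0.
Qed.

Lemma sqn_vec V :
  sqn (vec V) = (\sum_i nrm e (fps_of_mpoly (V i)) ^+ 2)%:C%C.
Proof.
rewrite sqnE rmorph_sum /=.
rewrite (eq_bigr (fun k => (fun i m => ((bweight R m * Normc.normc (V i)@_m ^+ 2)%:C)%C)
   (bidx k).1 (bidx k).2)) => [|k _]; last first.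
  rewrite mxE normrM exprMn mulrC rmorphM rmorphXn /= -normc_norm; congr (_ * _).
  by rewrite ger0_norm ?lecR ?sqrtr_ge0 // expr2 sw_sqr.
rewrite (sum_bidx (fun i m => ((bweight R m * Normc.normc (V i)@_m ^+ 2)%:C)%C)).
apply: eq_bigr => i _; rewrite l2_sqr ?rmorph_sum // => m; exact: bweight_ge0.
Qed.

(** When [a], its adjoint and the diagonal matrix of weights [h] satisfy the
    relations of sl2, so do their images by [theta], and the decomposition of
    [W] along the image of [theta a] and the kernel of its adjoint does not
    increase norms. *)
Lemma homological_decomposition a (h : 'I_n -> int) W :
    a *m a^t* - a^t* *m a = diag_mx (\row_i (h i)%:~R) ->
    diag_mx (\row_i (h i)%:~R) *m a - a *m diag_mx (\row_i (h i)%:~R) = 2 *: a ->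
    in_V d W ->
  exists u r : pvf R n,
    [/\ in_V d u, in_V d r, forall i, W i = theta a u i + r i, theta (a^t*) r = (fun=> 0) &
      \sum_i nrm e (fps_of_mpoly (u i)) ^+ 2 <= \sum_i nrm e (fps_of_mpoly (W i)) ^+ 2 /\
      \sum_i nrm e (fps_of_mpoly (r i)) ^+ 2 <= \sum_i nrm e (fps_of_mpoly (W i)) ^+ 2].
Proof.
move=> aa ha Wd; pose M := thetamx a.
pose hk k := h (bidx k).1 - \sum_j ((bidx k).2 j)%:Z * h j.
have MM : M^t* *m M - M *m M^t* = diag_mx (\row_k (hk k)%:~R).
  by rewrite thetamx_adjoint thetamx_comm aa thetamx_diag.
have MH : M *m diag_mx (\row_k (hk k)%:~R) - diag_mx (\row_k (hk k)%:~R) *m M = 2 *: M.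
  by rewrite -[diag_mx _]thetamx_diag thetamx_comm ha thetamxZ.
have [u [r [wE rM ule rle]]] := sl2_decomposition MM MH (vec W).
have uE : unvec (u *m M) = theta a (unvec u).
  by rewrite -{1}(unvecK u) -vec_theta ?vecK //; [apply: in_V_theta | ]; apply: in_V_unvec.
exists (unvec u), (unvec r); split; try exact: in_V_unvec.
- move=> i; rewrite -uE -{1}(vecK Wd) wE /unvec -big_split; apply: eq_bigr => k _ /=.
  by rewrite mxE scalerDl.
- have tr : in_V d (theta (a^t*) (unvec r)) by apply: in_V_theta; apply: in_V_unvec.
  rewrite -(vecK tr) vec_theta ?unvecK -?thetamx_adjoint ?rM; last exact: in_V_unvec.
  by apply: boolp.funext => i; apply: big1 => k _; rewrite mxE scale0r.
- by rewrite -!(lecR _ (\sum_i nrm e (fps_of_mpoly (W i)) ^+ 2)) -!sqn_vec !unvecK.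
Qed.

End HomologicalMatrix.

(** * Standard form of nilpotent matrices *)

Section Chains.
Variables (F : fieldType) (V : vectType F) (f : 'End(V)).
Implicit Types (U W : {vspace V}) (c : V * nat).

Definition chain c : seq V := [seq iter i f c.1 | i <- iota 0 c.2.+1].

Lemma iter_linear i : exists g : 'End(V), forall u, g u = iter i f u.
Proof.
elim: i => [|i [g gE]]; first by exists \1%VF => u; rewrite id_lfunE.
by exists (f \o g)%VF => u; rewrite comp_lfunE gE.
Qed.

(** The classical splitting argument: if [k] is maximal such that [f^k] is not
    zero on [U], and [f^k v <> 0], choose a linear form [phi] with
    [phi (f^k v) <> 0]; then the space [W] of all [u] in [U] with
    [phi (f^j u) = 0] for all [j] is a stable complement of the chain of [v].
    The flag [W_ t] below interpolates between [U] and [W], its dimension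
    dropping at each step. *)
Lemma nilpotent_chains N : (forall u, iter N f u = 0) -> forall U,
    (forall u, u \in U -> f u \in U) ->
  exists L : seq (V * nat),
    [/\ forall c, c \in L -> iter c.2.+1 f c.1 = 0,
        (<<flatten (map chain L)>>)%VS = U
      & (size (flatten (map chain L)) <= \dim U)%N].
Proof.
move=> fN U; have [D] := ubnP (\dim U); elim: D U => // D IHD U dimU fU.
have fiU i u : u \in U -> iter i f u \in U by move=> uU; elim: i => //= i; apply: fU.
have [U0|U0] := eqVneq U 0%VS.
  by exists [::]; split=> //=; rewrite span_nil U0.
pose P i := all (fun u => iter i f u == 0) (vbasis U).
have PU i : P i -> forall u, u \in U -> iter i f u = 0.
  move=> /allP Pi u uU; have [g gE] := iter_linear i.
  rewrite (coord_vbasis uU) -gE linear_sum big1 // => j _.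
  by rewrite linearZ /= gE (eqP (Pi _ _)) ?scaler0 // mem_nth // size_tuple.
have exP : exists i, P i by exists N; apply/allP => u _; rewrite fN.
case: (ex_minnP exP) => -[|k] Pk minP.
  case/eqP: U0; apply/eqP; rewrite -subv0; apply/subvP => u uU.
  by rewrite memv0; have /= -> := PU _ Pk u uU.
have [v vU fkv] : exists2 v, v \in U & iter k f v != 0.
  have /allPn[v vU fkv] : ~~ P k by apply: contraTN isT => /minP; rewrite ltnn.
  by exists v => //; apply: vbasis_mem.
pose X := vbasis {:V}.
have [j0 phi0] : exists j, coord X j (iter k f v) != 0.
  apply/existsP; apply: contraR fkv => /existsPn c0; apply/eqP.
  rewrite (coord_vbasis (memvf (iter k f v))) big1 // => j _.
  by have := c0 j; rewrite negbK => /eqP ->; rewrite scale0r.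
pose h : 'Hom(V, F^o) := @linfun _ V (F^o : vectType F) (coord X j0).
have [fp fpE] : exists fp : nat -> 'End(V), forall i u, fp i u = iter i f u.
  exists (fun i => iter i (fun g => f \o g)%VF \1%VF) => i u.
  by elim: i => [|i IHi] /=; rewrite ?id_lfunE // comp_lfunE IHi.
pose phi i u : F := coord X j0 (iter i f u).
have phiE i u : (h \o fp i)%VF u = phi i u by rewrite comp_lfunE lfunE /= fpE.
have phi_lin i a x y : phi i (x - a *: y) = phi i x - a * phi i y.
  by rewrite -!phiE linearB linearZ.
have phi_add i t u : phi i (iter t f u) = phi (i + t)%N u by rewrite /phi iterD.
have phi_big i u : (k < i)%N -> u \in U -> phi i u = 0.
  move=> ki uU; rewrite /phi -(subnK ki) iterD (PU _ Pk) //.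
  by have [g gE] := iter_linear (i - k.+1); rewrite -gE linear0 linear0.
pose W_ t := (U :&: \bigcap_(j < k.+1 | (k < j + t)%N) lker (h \o fp j))%VS.
have memW t u : reflect (u \in U /\ forall j, (j <= k)%N -> (k < j + t)%N -> phi j u = 0)
    (u \in W_ t).
  rewrite /W_ memv_cap; apply: (iffP andP) => -[uU uW]; split=> //.
    move=> j jk jt; move: uW; rewrite memvE => /subv_bigcapP/(_ (Ordinal (jk : (j < k.+1)%N)) jt).
    by rewrite -memvE memv_ker phiE => /eqP.
  rewrite memvE; apply/subv_bigcapP => j jt; rewrite -memvE memv_ker phiE.
  by rewrite uW // -ltnS.
have W0 : W_ 0%N = U.
  apply/eqP; rewrite eqEsubv capvSl /=; apply/subvP => u uU; apply/memW; split=> // j.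
  by rewrite addn0 ltnNge => ->.
have fvW t : (t <= k)%N -> iter t f v \in W_ t.
  move=> tk; apply/memW; split; first exact: fiU.
  by move=> j _ jt; rewrite phi_add phi_big.
have phik t : (t <= k)%N -> phi (k - t)%N (iter t f v) != 0.
  by move=> tk; rewrite phi_add subnK.
have dimW t : (t <= k.+1)%N -> (\dim (W_ t) + t <= \dim U)%N.
  elim: t => [_|t IHt tk]; first by rewrite W0 addn0.
  apply: leq_trans (IHt (ltnW tk)); rewrite addnS ltn_add2r ltnNge.
  apply/negP => le_dim.
  have sub : (W_ t.+1 <= W_ t)%VS.
    apply/subvP => u /memW[uU uW]; apply/memW; split=> // j jk jt.
    by apply: uW => //; rewrite addnS ltnS ltnW.
  have eqW : W_ t.+1 = W_ t by apply/eqP; rewrite eqEdim sub.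
  have := fvW t tk; rewrite -eqW => /memW[_ /(_ (k - t)%N)].
  rewrite leq_subr addnS ltnS subnK // => /(_ isT (leqnn k)) /eqP.
  by rewrite (negbTE (phik _ tk)).
pose W := W_ k.+1.
have fW u : u \in W -> f u \in W.
  move=> /memW[uU uW]; apply/memW; split=> [|j jk _]; first exact: fU.
  have -> : phi j (f u) = phi j.+1 u by rewrite /phi iterSr.
  move: jk; rewrite leq_eqVlt => /orP[/eqP ->|jk]; first by rewrite phi_big.
  by apply: uW => //; rewrite addnS ltnS leq_addl.
have [L [Lnil Lspan Lsize]] : exists L : seq (V * nat),
    [/\ forall c, c \in L -> iter c.2.+1 f c.1 = 0,
        (<<flatten (map chain L)>>)%VS = W
      & (size (flatten (map chain L)) <= \dim W)%N].
  apply: IHD fW; apply: leq_trans (_ : \dim U <= D)%N; last by rewrite -ltnS.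
  by apply: leq_trans (dimW _ (leqnn _)); rewrite addnS ltnS leq_addr.
have chainU u : u \in chain (v, k) -> u \in U by case/mapP => i _ ->; apply: fiU.
have catL : flatten (map chain ((v, k) :: L)) = chain (v, k) ++ flatten (map chain L) by [].
exists ((v, k) :: L); split; rewrite ?catL.
- by move=> c; rewrite inE => /predU1P[->|/Lnil//]; apply: (PU k.+1 Pk).
- rewrite span_cat Lspan; apply/eqP; rewrite eqEsubv; apply/andP; split.
    rewrite subv_add capvSl andbT; apply/span_subvP => u; exact: chainU.
  apply/subvP => u uU.
  suff [s sC sW] : exists2 s, s \in (<<chain (v, k)>>)%VS & u - s \in W.
    by rewrite -(subrK s u) addrC memv_add.
  have step t : (t <= k.+1)%N ->
      exists2 s, s \in (<<chain (v, k)>>)%VS & u - s \in W_ t.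
    elim: t => [_|t IHt tk]; first by exists 0; rewrite ?mem0v // subr0 W0.
    have [s sC /memW[usU usW]] := IHt (ltnW tk).
    pose a := phi (k - t)%N (u - s) / phi (k - t)%N (iter t f v).
    exists (s + a *: iter t f v).
      rewrite memvD // memvZ // memv_span //; apply/mapP; exists t => //.
      by rewrite mem_iota.
    rewrite opprD addrA; apply/memW; split=> [|j jk jt].
      by rewrite memvB ?memvZ ?fiU.
    rewrite phi_lin; have [->|jkt] := eqVneq j (k - t)%N.
      by rewrite /a divfK ?subrr // phik.
    have lt_kjt : (k < j + t)%N by move: jt jkt; rewrite addnS ltnS leq_eqVlt => /orP[/eqP ->|//]; rewrite addnK eqxx.
    by rewrite usW // phi_add phi_big ?mulr0 ?subr0.
  exact: step (leqnn _).
- rewrite size_cat size_map size_iota.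
  by apply: leq_trans (dimW _ (leqnn _)); rewrite addnC leq_add2r.
Qed.

End Chains.

Section StandardBlocks.
Variables (R : realType) (n s : nat) (k : 'I_s -> nat).
Variable x : forall j : 'I_s, 'I_(k j).+1 -> 'I_n.
Variables (blk : 'I_n -> 'I_s) (pos : 'I_n -> nat).
Hypothesis xE : forall (j : 'I_s) (i : 'I_(k j).+1) v, (x i == v) = (blk v == j) && (pos v == i).
Hypothesis pos_le : forall v, (pos v <= k (blk v))%N.
Local Notation C := R[i].
Local Open Scope sesquilinear_scope.

Lemma block_pos_inj u v : blk u = blk v -> pos u = pos v -> u = v.
Proof.
move=> buv puv; have e v' : x (Ordinal (pos_le v' : (pos v' < (k (blk v')).+1)%N)) = v'.
  by apply/eqP; rewrite xE !eqxx.
by apply/eqP; rewrite -(e u) xE /= buv puv !eqxx.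
Qed.

Lemma block_pos_surj (j : 'I_s) i : (i <= k j)%N -> exists2 v, blk v = j & pos v = i.
Proof.
move=> ik; exists (x (Ordinal (ik : (i < (k j).+1)%N))).
  by have := xE (Ordinal (ik : (i < (k j).+1)%N)) (x (Ordinal (ik : (i < (k j).+1)%N)));
     rewrite eqxx => /esym/andP[/eqP].
by have := xE (Ordinal (ik : (i < (k j).+1)%N)) (x (Ordinal (ik : (i < (k j).+1)%N)));
   rewrite eqxx => /esym/andP[_ /eqP].
Qed.

(** Coordinates are described by the block that contains them and their
    position in that block, counted from 0. *)
Definition follows v u := (blk u == blk v) && (pos u == (pos v).+1).

Definition arrow v : C := (Num.sqrt ((pos v).+1 * (k (blk v) - pos v))%N%:R : R)%:C%C.

Definition stdmx : 'M[C]_n := \matrix_(v, u) (if follows v u then arrow v else 0).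

Lemma linvf_stdmx : linvf stdmx =
  (fun v => \sum_(j < s) \sum_(i < k j | x (widen_ord (leqnSn _) i) == v)
     (Num.sqrt (i.+1 * (k j - i))%N%:R : R)%:C%C *: 'X_(x (lift ord0 i))).
Proof.
apply: boolp.funext => v; rewrite /linvf.
rewrite (bigD1 (blk v)) //= [X in _ = _ + X]big1 ?addr0 => [|j jv]; last first.
  by rewrite big_pred0 // => i; rewrite xE eq_sym (negbTE jv).
case: (ltnP (pos v) (k (blk v))) => kv; last first.
  rewrite [RHS]big_pred0 => [|i]; last by rewrite xE eqxx /=; apply/eqP => pv; move: kv; rewrite pv leqNgt ltn_ord.
  apply: big1 => u _; rewrite mxE; case: ifP; rewrite ?scale0r // => /andP[/eqP bu /eqP pu].
  by have := pos_le u; rewrite bu pu ltnNge kv.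
rewrite (big_pred1 (Ordinal kv)) => [|i] /=; last by rewrite xE eqxx /= -val_eqE /= eq_sym.
rewrite (bigD1 (x (lift ord0 (Ordinal kv)))) //= big1 ?addr0 => [|u ux]; rewrite mxE.
  have := xE (lift ord0 (Ordinal kv)) (x (lift ord0 (Ordinal kv))).
  by rewrite /follows eqxx => <-.
by move: ux; rewrite eq_sym xE /= /bump add1n => /negbTE; rewrite /follows => ->; rewrite scale0r.
Qed.

(** The coordinates of a block of length [k + 1] have the weights
    [k, k - 2, .., - k] of the irreducible representation of sl2. *)
Definition weight v : int := (k (blk v))%:Z - (pos v)%:Z *+ 2.

Lemma arrow_sqr v : arrow v * (arrow v)^* = ((pos v).+1 * (k (blk v) - pos v))%N%:R.
Proof.
have -> : (arrow v)^* = arrow v by exact: conjc_real.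
by rewrite /arrow -rmorphM -expr2 sqr_sqrtr ?ler0n // rmorph_nat.
Qed.

Lemma stdmx_row_norm v w :
  (stdmx *m stdmx^t*) v w = (((pos v).+1 * (k (blk v) - pos v))%N%:R) *+ (v == w).
Proof.
rewrite mxE; case: (ltnP (pos v) (k (blk v))) => kv; last first.
  rewrite (eqP (kv : (_ - _ == 0)%N)) muln0 mul0rn big1 // => u _.
  rewrite !mxE; case: ifP; rewrite ?mul0r // => /andP[/eqP bu /eqP pu].
  by have := pos_le u; rewrite bu pu ltnNge kv.
have [u0 bu pu] := block_pos_surj kv.
rewrite (bigD1 u0) //= big1 ?addr0 => [|u uu]; rewrite !mxE /follows.
  rewrite bu pu !eqxx /= eqSS; case: (v =P w) => [<-|vw]; first by rewrite !eqxx arrow_sqr.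
  case: ifP => [/andP[/eqP bw /eqP pw]|]; last by rewrite rmorph0 mulr0.
  by case: vw; apply: block_pos_inj.
case: ifP; rewrite ?mul0r // => /andP[/eqP bu' /eqP pu'].
by case/eqP: uu; apply: block_pos_inj; rewrite ?bu ?pu.
Qed.

Lemma stdmx_col_norm v w :
  (stdmx^t* *m stdmx) v w = ((pos v * (k (blk v) - (pos v).-1))%N%:R) *+ (v == w).
Proof.
rewrite mxE; case: (posnP (pos v)) => pv.
  by rewrite pv mul0n mul0rn big1 // => u _; rewrite !mxE /follows pv andbF rmorph0 mul0r.
have [|u0 bu pu] := @block_pos_surj (blk v) (pos v).-1.
  exact: leq_trans (leq_pred _) (pos_le v).
rewrite (bigD1 u0) //= big1 ?addr0 => [|u uu]; rewrite !mxE /follows.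
  rewrite bu pu prednK // !eqxx /= ![_ == blk v]eq_sym.
  case: (v =P w) => [<-|vw]; first by rewrite !eqxx mulrC arrow_sqr bu pu prednK.
  case: ifP => [/andP[/eqP bw /eqP pw]|]; last by rewrite mulr0.
  by case: vw; apply: block_pos_inj.
case: ifP; rewrite ?rmorph0 ?mul0r // => /andP[/eqP bu' /eqP pu'].
by case/eqP: uu; apply: block_pos_inj; rewrite ?bu ?pu // pu'.
Qed.

(** This is where the square roots of the standard form matter:
    [(p + 1) * (k - p) - p * (k - p + 1) = k - 2 * p]. *)
Lemma stdmx_commutator :
  stdmx *m stdmx^t* - stdmx^t* *m stdmx = diag_mx (\row_i (weight i)%:~R).
Proof.
apply/matrixP => v w; rewrite [LHS]mxE stdmx_row_norm [X in _ + X]mxE stdmx_col_norm !mxE.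
case: (v =P w) => [_|_]; rewrite ?subr0 //= !mulr1n.
have pk := pos_le v; rewrite /weight.
transitivity ((((pos v).+1 * (k (blk v) - pos v))%N%:Z -
   (pos v * (k (blk v) - (pos v).-1))%N%:Z)%:~R : C); first by rewrite rmorphB.
congr (_%:~R); case: (posnP (pos v)) => [->|p0]; first by rewrite mul0n subn0; lia.
have -> : (k (blk v) - (pos v).-1 = (k (blk v) - pos v).+1)%N by lia.
have -> : k (blk v) = ((k (blk v) - pos v) + pos v)%N by rewrite subnK.
by rewrite addnK; lia.
Qed.

Lemma stdmx_weight : diag_mx (\row_i (weight i)%:~R) *m stdmx
  - stdmx *m diag_mx (\row_i (weight i)%:~R) = 2 *: stdmx.
Proof.
apply/matrixP => v u; rewrite mul_diag_mx mul_mx_diag !mxE.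
case: ifP => [/andP[/eqP bu /eqP pu]|_]; last by rewrite !mulr0 mul0r subrr.
rewrite mulrC -mulrBr -rmorphB mulrC /weight bu pu; congr (_ * _).
have -> : (k (blk v))%:Z - (pos v)%:Z *+ 2 - ((k (blk v))%:Z - (pos v).+1%:Z *+ 2) = 2%:Z by lia.
by [].
Qed.

End StandardBlocks.

(** The rows of [P] are the vectors of Jordan chains of [b], rescaled so that
    the coefficients of the standard form appear. The chains span the whole
    space and have [n] vectors in all, so that [P] is invertible. *)
Lemma nilpotent_standard_form (R : realType) n (b : 'M[R[i]]_n) :
    nilpotent_vf (linvf b) -> exists (P a : 'M[R[i]]_n) (h : 'I_n -> int),
  [/\ P \in unitmx, P *m b = a *m P, standard_form (linvf a),
      (a *m a^t* - a^t* *m a)%sesqui = diag_mx (\row_i (h i)%:~R)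
    & diag_mx (\row_i (h i)%:~R) *m a - a *m diag_mx (\row_i (h i)%:~R) = 2 *: a].
Proof.
move=> /(_ 1%N isT)[N nilN].
pose f : 'End('rV[R[i]]_n) := linfun (mulmxr b).
have fE c : f c = c *m b by rewrite lfunE.
have fN c : iter N f c = 0.
  pose lin (c : 'rV[R[i]]_n) : {mpoly R[i][n]} := \sum_i c 0 i *: 'X_i.
  have lin_f i : lin (iter i f c) = iter i (vf_apply (linvf b)) (lin c).
    elim: i => //= i <-; set c' := iter i f c; rewrite fE /lin.
    rewrite -[RHS]/(lie b _) lie_sum.
    have lieX (j : 'I_n) : lie b 'X_j = linvf b j.
      rewrite /lie /vf_apply (bigD1 j) //= big1 => [|l lj]; rewrite mderivXi.
        by rewrite eqxx mulr1 addr0.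
      by rewrite eq_sym (negbTE lj) mulr0.
    under [RHS]eq_bigr do rewrite lieX scaler_sumr; rewrite exchange_big.
    apply: eq_bigr => l _ /=; rewrite mxE scaler_suml.
    by apply: eq_bigr => j _; rewrite scalerA.
  have lin_hom : lin c \is 1.-homog.
    apply: rpred_sum => i _; apply: rpredZ; rewrite dhomogX /= mdeg1 //.
  have := lin_f N; rewrite nilN // => lin0; apply/rowP => i; rewrite [RHS]mxE.
  have := congr1 (fun p : {mpoly R[i][n]} => p@_(U_(i))) lin0.
  rewrite mcoeff0 /lin raddf_sum (bigD1 i) //= big1 => [|j ji]; rewrite mcoeffZ mcoeffX.
    by rewrite eqxx mulr1 addr0.
  case: eqP => [|_]; rewrite ?mulr0 // => /(congr1 (fun m : 'X_{1..n} => m i)).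
  by rewrite !mnm1E eqxx (negbTE ji).
have [|L [Lnil Lspan Lsize]] := nilpotent_chains fN (U := {:'rV[R[i]]_n}%VS).
  by move=> u _; apply: memvf.
pose s := size L; pose c0 : 'rV[R[i]]_n * nat := (0, 0%N).
pose k (j : 'I_s) := (nth c0 L j).2; (* The positions in the chains; there are [n] of them, which numbers the
   coordinates. *)
pose T : finType := {j : 'I_s & 'I_(k j).+1}.
have cardT : #|T| = n.
  have dimn : \dim {:'rV[R[i]]_n} = n by rewrite dimvf /dim /= mul1n.
  have cE : #|T| = size (flatten (map (chain f) L)).
    rewrite card_tagged size_flatten /shape -map_comp; congr (sumn _).
    apply: (@eq_from_nth _ 0%N) => [|i]; rewrite size_map -?cardE ?card_ord ?size_map // => iL.
    have iLs : (i < size L)%N by [].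
    rewrite (nth_map c0) // (nth_map (Ordinal iLs)) -?cardE ?card_ord //=.
    by rewrite size_map size_iota /k nth_enum_ord.
  apply/eqP; rewrite eqn_leq; apply/andP; split.
    by rewrite cE -[X in (_ <= X)%N]dimn.
  by rewrite cE -[X in (X <= _)%N]dimn -Lspan dim_span.
pose x (j : 'I_s) (i : 'I_(k j).+1) : 'I_n := cast_ord cardT (enum_rank (Tagged (fun j => 'I_(k j).+1) i)).
pose y (v : 'I_n) : T := enum_val (cast_ord (esym cardT) v).
have xK u : y (x (tag u) (tagged u)) = u.
  by rewrite /y /x cast_ordK enum_rankK; case: (u).
have yK v : x (tag (y v)) (tagged (y v)) = v.
  rewrite /x (_ : Tagged _ _ = y v); last by case: (y v).
  by rewrite enum_valK cast_ordKV.
pose blk v := tag (y v); pose pos v : nat := tagged (y v).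
have xyE j i v : (x j i == v) = (blk v == j) && (pos v == i).
  apply/eqP/andP => [<-|[/eqP bv /eqP pv]].
    by rewrite /blk /pos (xK (Tagged (fun j => 'I_(k j).+1) i)).
  rewrite -[RHS](yK v); move: bv pv; rewrite /blk /pos; case: (y v) => j' i' /= jj.
  by case: j / jj i => i ii; congr (x _ _); apply/val_inj.
have pos_le v : (pos v <= k (blk v))%N by rewrite -ltnS ltn_ord.
pose a := stdmx R k blk pos.
pose e (j : 'I_s) : 'rV[R[i]]_n := (nth c0 L j).1.
have e_nil j : iter (k j).+1 f (e j) = 0 by apply: Lnil; rewrite mem_nth.
(* The scalar by which the [i]-th iterate of [f] on the head of the chain is
   multiplied. *)
pose rho (j : 'I_s) i : R[i] := \prod_(l < i) (Num.sqrt (l.+1 * (k j - l))%N%:R : R)%:C%C^-1.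
pose P : 'M[R[i]]_n := \matrix_v (rho (blk v) (pos v) *: iter (pos v) f (e (blk v))).
have Pb : P *m b = a *m P.
  apply/row_matrixP => v; rewrite !row_mul rowK -scalemxAl -fE -iterS.
  rewrite mulmx_sum_row; case: (ltnP (pos v) (k (blk v))) => kv; last first.
    have -> : pos v = k (blk v) by apply/eqP; rewrite eqn_leq pos_le.
    rewrite e_nil scaler0 big1 // => u _; rewrite !mxE; case: ifP; rewrite ?scale0r //.
    move=> /andP[/eqP bu /eqP pu].
    by have := pos_le u; rewrite bu pu ltnNge kv.
  have [u0 bu pu] := block_pos_surj xyE kv.
  rewrite (bigD1 u0) //= big1 ?addr0 => [|u uu]; rewrite !mxE /follows.
    rewrite rowK bu pu !eqxx /= scalerA; congr (_ *: _).
    rewrite /rho big_ord_recr /= /arrow mulrCA mulfV ?mulr1 //.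
    rewrite fmorph_eq0 sqrtr_eq0 -ltNge ltr0n muln_gt0 /= subn_gt0 //.
  case: ifP; rewrite ?scale0r // => /andP[/eqP bu' /eqP pu'].
  by case/eqP: uu; apply: (block_pos_inj xyE pos_le); rewrite ?bu ?pu.
have Pfull : row_full P.
  rewrite -sub1mx; apply/row_subP => i; move: (row i _) => {i} u.
  have : u \in <<flatten (map (chain f) L)>>%VS by rewrite Lspan memvf.
  move/(coord_span (X := in_tuple _)) => ->; apply: summx_sub => i _; apply: scalemx_sub.
  have /flatten_mapP[c cL] : (in_tuple (flatten (map (chain f) L)))`_i \in flatten (map (chain f) L).
    by rewrite mem_nth.
  case/mapP => t; rewrite mem_iota add0n => /andP[_ tc] ->.
  have jL : (index c L < s)%N by rewrite index_mem.
  pose j := Ordinal jL; have cE : nth c0 L j = c by rewrite nth_index.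
  have tk : (t <= k j)%N by rewrite /k cE -ltnS.
  have [v bv pv] := block_pos_surj xyE tk.
  have rho0 : rho j t != 0.
    apply/prodf_neq0 => l _; rewrite invr_eq0 fmorph_eq0 sqrtr_eq0 -ltNge ltr0n muln_gt0 /=.
    by rewrite subn_gt0 (leq_trans (ltn_ord l)).
  have -> : iter t f c.1 = (rho j t)^-1 *: row v P.
    by rewrite rowK bv pv scalerA mulVf // scale1r /e cE.
  exact/scalemx_sub/row_sub.
exists P, a, (weight k blk pos); split.
- by rewrite -row_full_unit.
- exact: Pb.
- exists s, k, x; split; last exact: (linvf_stdmx R xyE pos_le).
  by exists y => // v; apply: yK.
- exact: (stdmx_commutator R xyE pos_le).
- exact: stdmx_weight.
Qed.

(** * Solving formal equations degree by degree *)

Section Contraction.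
Variables (R : realType) (n : nat).
Local Notation C := R[i].
Local Notation Id := (@fid R n).
Implicit Types (F G U V W : ftuple R n) (d : nat) (m : 'X_{1..n}).

Definition agree d F G := forall i m, (mdeg m < d)%N -> F i m = G i m.

(** Banach's fixed point theorem for the adic distance: the coefficients of
    degree [d] of the iterates are constant from the [d + 1]-st on. *)
Lemma contraction_fixpoint (T : ftuple R n -> ftuple R n) :
  (forall d F G, agree d F G -> agree d.+1 (T F) (T G)) -> exists F, T F = F.
Proof.
move=> contr; pose z : ftuple R n := fun _ _ => 0; pose A k := iter k T z.
have AA k j : agree k (A k) (A (k + j)%N).
  by elim: k => [|k IHk]; [move=> i m; rewrite ltn0 | rewrite addSn; apply: contr].
pose F : ftuple R n := fun i m => A (mdeg m).+1 i m.
have FA d : agree d F (A d).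
  by move=> i m md; rewrite /F -(subnKC md); apply: AA.
exists F; apply: ftuple_eq => i m.
exact: (contr _ _ _ (FA (mdeg m)) i m (ltnSn _)).
Qed.

Lemma agree_comp d F G G' :
    order_ge 2 F -> order_ge 1 G -> order_ge 1 G' -> agree d G G' ->
  agree d.+1 (fcomp F G) (fcomp F G').
Proof.
move=> F2 G1 G'1 GG' i m; case: d GG' => [_ m0|d GG' md].
  by rewrite !(order_ge_fcomp F2) // (leq_trans m0).
pose D := d.+1; have mD : (mdeg m <= D)%N by [].
rewrite /fcomp (approx_comp_trunc _ G1 mD) (approx_comp_trunc _ G'1 mD).
apply/eqP; rewrite -subr_eq0 -mcoeffB; apply/eqP.
apply: (mord_ge_compB (e := d) (s := 2)) => // [k k2|j|j|j k kd|].
- by rewrite trunc_coef F2 ?if_same.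
- exact: trunc_map_mord.
- exact: trunc_map_mord.
- by rewrite mcoeffB !tnth_mktuple !trunc_coef (GG' _ _ kd) subrr.
- by rewrite addn2.
Qed.

Lemma mord_ge_deriv s (p : {mpoly C[n]}) j : mord_ge s p -> mord_ge s.-1 p^`M(j).
Proof.
move=> ps m ms; rewrite mcoeff_deriv ps ?mul0rn //.
by rewrite mdegD mdeg1 addn1; case: s ms {ps}.
Qed.

Lemma mord_ge_trunc s D F i : order_ge s F -> mord_ge s (trunc D (F i)).
Proof. by move=> Fs m ms; rewrite trunc_coef Fs ?if_same. Qed.

Lemma jacobian_trunc U V i m :
  jacobian_apply U V i m =
  (\sum_j (trunc (mdeg m).+1 (U i))^`M(j) * trunc (mdeg m) (V j))@_m.
Proof.
by apply: (approx_jacobian (D := mdeg m)) => // [|j]; apply: approx_trunc.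
Qed.

Lemma order_ge_jacobian s t U V :
  order_ge s U -> order_ge t V -> order_ge (s.-1 + t) (jacobian_apply U V).
Proof.
move=> Us Vt i m ms; rewrite jacobian_trunc.
suff: mord_ge (s.-1 + t) (\sum_j (trunc (mdeg m).+1 (U i))^`M(j) * trunc (mdeg m) (V j)).
  by apply.
apply: mord_ge_sum => j _; apply: mord_geM; last exact: mord_ge_trunc.
exact/mord_ge_deriv/mord_ge_trunc.
Qed.

Lemma trunc_add D (f g : fps R n) : trunc D (fun m => f m + g m) = trunc D f + trunc D g.
Proof.
by apply/mpolyP => m; rewrite mcoeffD !trunc_coef; case: ifP; rewrite ?addr0.
Qed.

Lemma jacobian_faddl F G V :
  jacobian_apply (fadd F G) V = fadd (jacobian_apply F V) (jacobian_apply G V).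
Proof.
apply: ftuple_eq => i m; rewrite /fadd !jacobian_trunc -mcoeffD -big_split.
congr (_ @_ _); apply: eq_bigr => j _ /=.
by rewrite trunc_add mderivD mulrDl.
Qed.

Lemma jacobian_faddr F V W :
  jacobian_apply F (fadd V W) = fadd (jacobian_apply F V) (jacobian_apply F W).
Proof.
apply: ftuple_eq => i m; rewrite /fadd !jacobian_trunc -mcoeffD -big_split.
congr (_ @_ _); apply: eq_bigr => j _ /=.
by rewrite trunc_add mulrDr.
Qed.

Definition fsub F G : ftuple R n := fun i m => F i m - G i m.

Lemma agree_jacobian d U U' V V' :
    order_ge 2 U -> order_ge 2 U' -> order_ge 2 V -> order_ge 2 V' ->
    agree d U U' -> agree d V V' ->
  agree d.+1 (jacobian_apply U V) (jacobian_apply U' V').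
Proof.
move=> U2 U'2 V2 V'2 UU' VV' i m md.
have UE : U = fadd (fsub U U') U' by apply: ftuple_eq => j k; rewrite /fadd subrK.
have VE : V = fadd (fsub V V') V' by apply: ftuple_eq => j k; rewrite /fadd subrK.
have dU : order_ge d (fsub U U') by move=> j k kd; rewrite /fsub UU' ?subrr.
have dV : order_ge d (fsub V V') by move=> j k kd; rewrite /fsub VV' ?subrr.
rewrite {1}UE jacobian_faddl {1}/fadd (order_ge_jacobian dU V2) ?add0r; last first.
  by apply: leq_trans md _; lia.
by rewrite VE jacobian_faddr /fadd (order_ge_jacobian U'2 dV) ?add0r.
Qed.

(** Precomposed with this projection, the operator whose fixed point gives the
    inverse of a map is contracting on all tuples of series, and not only on
    those of order two. *)
Definition cut F : ftuple R n := fun i m => if (mdeg m < 2)%N then 0 else F i m.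

Lemma order_ge_cut F : order_ge 2 (cut F).
Proof. by move=> i m m2; rewrite /cut m2. Qed.

Lemma cut_id F : order_ge 2 F -> cut F = F.
Proof. by move=> F2; apply: ftuple_eq => i m; rewrite /cut; case: ifP => // /F2. Qed.

Lemma agree_fadd d F F' G G' : agree d F F' -> agree d G G' -> agree d (fadd F G) (fadd F' G').
Proof. by move=> FF GG i m md; rewrite /fadd FF ?GG. Qed.

Lemma agree_cut d F G : agree d F G -> agree d (cut F) (cut G).
Proof. by move=> FG i m md; rewrite /cut FG. Qed.

Lemma fcomp0 F G : (forall i m, F i m = 0) -> forall i m, fcomp F G i m = 0.
Proof.
move=> F0 i m; rewrite /fcomp /fps_comp (_ : trunc _ _ = 0) ?comp_mpoly0 ?mcoeff0 //.
by apply/mpolyP => k; rewrite trunc_coef F0 if_same mcoeff0.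
Qed.

Definition fopp F : ftuple R n := fun i m => - F i m.

Lemma right_inverse U : order_ge 2 U ->
  exists W, [/\ order_ge 2 W, W = fcomp (fopp U) (fadd Id W) &
                fcomp (fadd Id U) (fadd Id W) = Id].
Proof.
move=> U2; have oU2 : order_ge 2 (fopp U) by move=> i m m2; rewrite /fopp U2 ?oppr0.
have [W WE] : exists W, fcomp (fopp U) (fadd Id (cut W)) = W.
  apply: contraction_fixpoint => d F G FG; apply: agree_comp => //.
  - exact/order_ge_fid_add/order_ge_cut.
  - exact/order_ge_fid_add/order_ge_cut.
  - by apply: agree_fadd => //; apply: agree_cut.
have W2 : order_ge 2 W.
  by rewrite -WE; apply: order_ge_fcomp => //; apply/order_ge_fid_add/order_ge_cut.
rewrite cut_id // in WE; have W1 := order_ge_fid_add W2.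
exists W; split=> //; rewrite fcomp_faddl // fcomp_idl //.
apply: ftuple_eq => i m; rewrite /fadd -addrA -{1}WE.
transitivity (Id i m + fcomp (fadd (fopp U) U) (fadd Id W) i m).
  by rewrite fcomp_faddl.
by rewrite fcomp0 ?addr0 // => j k; rewrite /fadd /fopp addNr.
Qed.

(** The right inverse [I + W] of [I + U] has itself a right inverse, which by
    associativity can only be [I + U]. *)
Lemma tangent_inverse U : order_ge 2 U ->
  exists W, [/\ order_ge 2 W, W = fcomp (fopp U) (fadd Id W) &
                inverse_map (fadd Id W) (fadd Id U)].
Proof.
move=> U2; have [W [W2 WE UW]] := right_inverse U2; exists W.
split; [exact: W2 | exact: WE |].
have U1 := order_ge_fid_add U2; have W1 := order_ge_fid_add W2.
have [V [V2 _ WV]] := right_inverse W2; have V1 := order_ge_fid_add V2.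
split; [exact: W1 | exact: U1 | | exact: UW].
suff -> : fadd Id U = fadd Id V by exact: WV.
transitivity (fcomp (fcomp (fadd Id U) (fadd Id W)) (fadd Id V)).
  by rewrite (fcompA _ W1 V1) WV fcomp_idr.
by rewrite UW fcomp_idl.
Qed.

End Contraction.

(** * The normal form with control of the norms *)

Section Normalization.
Variables (R : realType) (n : nat).
Local Notation C := R[i].
Local Notation Id := (@fid R n).
Local Open Scope sesquilinear_scope.
Implicit Types (F S U V W : ftuple R n) (p : {mpoly C[n]}) (d : nat) (m : 'X_{1..n}).

Lemma hpart_coef d F i m : (hpart d F i)@_m = if mdeg m == d then F i m else 0.
Proof.
rewrite /hpart (big_mons _ (fun k => F i k *: 'X_[k]) (ltnSn d)) raddf_sum /=.
case: eqP => md; last first.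
  rewrite big_seq big1 // => k; rewrite mem_mons => /eqP kd.
  by rewrite mcoeffZ mcoeffX; case: eqP => [km|_]; [case: md; rewrite -km | rewrite mulr0].
rewrite (bigD1_seq m) ?mons_uniq ?mem_mons ?md //= mcoeffZ mcoeffX eqxx mulr1.
by rewrite big1 ?addr0 // => k km; rewrite mcoeffZ mcoeffX (negbTE km) mulr0.
Qed.

Lemma in_V_hpart d F : in_V d (hpart d.+1 F).
Proof.
move=> i; apply/dhomogP => m; rewrite mcoeff_msupp hpart_coef.
by case: ifP => [/eqP //|_]; rewrite eqxx.
Qed.

Lemma jacobian_flinear a U i m :
  jacobian_apply U (flinear a) i m = (lie a (hpart (mdeg m) U i))@_m.
Proof.
transitivity ((lie a (trunc (mdeg m).+1 (U i)))@_m).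
  have := @approx_jacobian R n (mdeg m) U (flinear a) i _ (linvf a) (approx_trunc _).
  move=> /(_ (fun j => @approx_flinear R n _ a j) m (leqnn _)) ->.
  by congr (_ @_ _); apply: eq_bigr => j _; rewrite mulrC.
apply/eqP; rewrite -subr_eq0 -mcoeffB -lieB; apply/eqP; apply: lie_coef0 => k km.
by rewrite mcoeffB trunc_coef hpart_coef km eqxx leqnSn subrr.
Qed.

Lemma jacobian_fopp F V : jacobian_apply (fopp F) V = fopp (jacobian_apply F V).
Proof.
apply: ftuple_eq => i m; rewrite {2}/fopp !jacobian_trunc -mcoeffN -sumrN.
congr (_ @_ _); apply: eq_bigr => j _; rewrite -mulNr -mderivN; congr (_^`M(_) * _).
by apply/mpolyP => k; rewrite mcoeffN !trunc_coef; case: ifP; rewrite ?oppr0.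
Qed.

Lemma le_sum_of_sqr (x : R) (w : 'I_n -> R) :
    0 <= x -> (forall j, 0 <= w j) -> x ^+ 2 <= \sum_j w j ^+ 2 -> x <= \sum_j w j.
Proof.
move=> x0 w0 xw; have s0 : 0 <= \sum_j w j by apply: sumr_ge0.
rewrite -ler_sqr ?nnegrE //; apply: le_trans xw _; rewrite [leRHS]expr2 mulr_suml.
apply: ler_sum => j _; rewrite expr2; apply: ler_wpM2l => //.
by rewrite (bigD1 j) //= lerDl sumr_ge0.
Qed.

Variables (a : 'M[C]_n) (h : 'I_n -> int).
Hypothesis aa : a *m a^t* - a^t* *m a = diag_mx (\row_i (h i)%:~R).
Hypothesis ha : diag_mx (\row_i (h i)%:~R) *m a - a *m diag_mx (\row_i (h i)%:~R) = 2 *: a.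

(** The homological equation for formal vector fields, solved one degree at a
    time by a fixed choice of solutions, so that each part of the solution
    depends only on the part of the datum of the same degree. *)
Lemma formal_decomposition : exists fu fr : ftuple R n -> ftuple R n,
  [/\ forall W, order_ge 2 (fu W) /\ order_ge 2 (fr W),
      forall d W W', agree d W W' -> agree d (fu W) (fu W') /\ agree d (fr W) (fr W'),
      forall W, order_ge 2 W -> forall i m,
        W i m = lcomb a (fu W) i m - jacobian_apply (fu W) (flinear a) i m + fr W i m,
      forall W d, (0 < d)%N -> theta (a^t*) (hpart d.+1 (fr W)) = (fun=> 0)
    & forall W d i, nrm d (fu W i) <= \sum_j nrm d (W j) /\
                    nrm d (fr W i) <= \sum_j nrm d (W j)].
Proof.
pose good d (W : pvf R n) (ur : pvf R n * pvf R n) :=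
  [/\ in_V d ur.1 /\ in_V d ur.2, forall i, W i = theta a ur.1 i + ur.2 i,
      theta (a^t*) ur.2 = (fun=> 0) &
      forall i, nrm d.+1 (fps_of_mpoly (ur.1 i)) <= \sum_j nrm d.+1 (fps_of_mpoly (W j)) /\
                nrm d.+1 (fps_of_mpoly (ur.2 i)) <= \sum_j nrm d.+1 (fps_of_mpoly (W j))].
have [|sol solP] := @boolp.choice (nat * pvf R n)%type (pvf R n * pvf R n)%type
    (fun dV ur => in_V dV.1 dV.2 -> good dV.1 dV.2 ur).
  move=> -[d V] /=.
  have [Vd|nVd] := boolp.pselect (in_V d V); last by exists (V, V) => /nVd.
  have [u [r [uV rV WE rK [ule rle]]]] := homological_decomposition aa ha Vd.
  exists (u, r) => _; split=> // i; split; apply: le_sum_of_sqr => [|j|]; try exact: nrm_ge0.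
    by apply: le_trans ule; rewrite (bigD1 i) //= lerDl sumr_ge0 // => j _; apply: sqr_ge0.
  by apply: le_trans rle; rewrite (bigD1 i) //= lerDl sumr_ge0 // => j _; apply: sqr_ge0.
(* The space [V_d] consists of vector fields with components of degree
   [d + 1]: the part of degree [mdeg m] is solved in [V_(mdeg m).-1]. *)
pose glue (part : pvf R n * pvf R n -> pvf R n) W : ftuple R n := fun i m =>
  if (mdeg m < 2)%N then 0 else (part (sol ((mdeg m).-1, hpart (mdeg m) W)) i)@_m.
have glue2 part W : order_ge 2 (glue part W) by move=> i m m2; rewrite /glue m2.
have glue_agree part d W W' : agree d W W' -> agree d (glue part W) (glue part W').
  move=> WW i m md; rewrite /glue; suff -> : hpart (mdeg m) W = hpart (mdeg m) W' by [].
  by apply: boolp.funext => j; apply: eq_bigr => k /eqP km; rewrite WW // km.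
have glue_hpart part W d : (0 < d)%N -> in_V d (part (sol (d, hpart d.+1 W))) ->
    hpart d.+1 (glue part W) = part (sol (d, hpart d.+1 W)).
  move=> d0 Vd; apply: boolp.funext => i; apply/mpolyP => m; rewrite hpart_coef.
  case: eqP => md; first by rewrite /glue md ltnS ltnNge d0.
  by rewrite (dhomog_nemf_coeff (Vd i)) //; apply/eqP.
have solW d W := solP (d, hpart d.+1 W) (in_V_hpart d W).
have nrm_glue part d W i :
    (forall d, (0 < d)%N -> nrm d.+1 (fps_of_mpoly (part (sol (d, hpart d.+1 W)) i)) <=
       \sum_j nrm d.+1 (fps_of_mpoly (hpart d.+1 W j))) ->
  nrm d (glue part W i) <= \sum_j nrm d (W j).
  case: d => [|[|d]] le_part; try by rewrite nrm0 ?sumr_ge0 // => [j _|m md]; rewrite ?nrm_ge0 // /glue md.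
  rewrite (@eq_nrm _ _ _ _ (fps_of_mpoly (part (sol (d.+1, hpart d.+2 W)) i))) => [|m md].
    apply: le_trans (le_part _ _) _ => //; apply: ler_sum => j _.
    by rewrite (@eq_nrm _ _ _ _ (W j)) // => m md; rewrite /fps_of_mpoly hpart_coef md eqxx.
  by rewrite /glue md.
exists (glue fst), (glue snd); split=> [W|d W W' WW|W W2 i m|W d d0|W d i]; first by split.
- by split; apply: glue_agree.
- case: (ltnP (mdeg m) 2) => m2.
    rewrite W2 // jacobian_flinear (order_ge_lcomb _ (glue2 _ _)) // sub0r (glue2 snd W i m m2) addr0.
    apply/esym/eqP; rewrite oppr_eq0; apply/eqP; apply: lie_coef0 => k km.
    by rewrite hpart_coef km eqxx (glue2 fst W i k) // km.
  have mE : mdeg m = (mdeg m).-1.+1 by rewrite prednK // ltnW.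
  have [[u1 r1] WE _ _] := solW (mdeg m).-1 W.
  rewrite -mE in WE; have := congr1 (fun p : {mpoly C[n]} => p@_m) (WE i).
  rewrite hpart_coef eqxx mcoeffD => ->; congr (_ + _); last by rewrite /glue ltnNge m2.
  rewrite /theta mcoeffB raddf_sum jacobian_flinear; congr (_ - _).
    by apply: eq_bigr => j _; rewrite /= mcoeffZ /glue ltnNge m2.
  have d0 : (0 < (mdeg m).-1)%N by case: (mdeg m) m2 => [|[]].
  by have := glue_hpart fst W _ d0 u1; rewrite -mE => ->.
- by have [[u1 r1] _ rK _] := solW d W; rewrite (glue_hpart snd).
- by split; apply: nrm_glue => e e0; have [_ _ _ le_nrm] := solW e W; have [] := le_nrm i.
Qed.

(** Let [W = S o (I + U) - DU.V]. The conjugation of [a + V] to [a + S] by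
    [I + U] reads [W = theta a (- U) + V], so that [- U] and [V] are the two
    terms of the decomposition of [W], and [W] is a fixed point of an operator
    that is contracting because [S], [U] and [V] have order two. *)
Lemma normalization S : order_ge 2 S ->
  exists U V, [/\ order_ge 2 U, order_ge 2 V,
    jacobian_apply (fadd Id U) (fadd (flinear a) V) = fcomp (fadd (flinear a) S) (fadd Id U),
    forall d, (0 < d)%N -> theta (a^t*) (hpart d.+1 V) = (fun=> 0) &
    exists2 K : R, 1 <= K & forall d, (2 <= d)%N ->
      size2 d U V <= K * (\sum_i nrm d (fcomp S (fadd Id U) i)
                        + \sum_i nrm d (jacobian_apply U V i))].
Proof.
move=> S2; have [fu [fr [fur2 fur_agree WE frK fur_nrm]]] := formal_decomposition.
have fou2 W : order_ge 2 (fopp (fu W)).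
  by move=> i m m2; rewrite /fopp (proj1 (fur2 W)) ?oppr0.
pose T W := fsub (fcomp S (fadd Id (fopp (fu W)))) (jacobian_apply (fopp (fu W)) (fr W)).
have [W TW] : exists W, T W = W.
  apply: contraction_fixpoint => d F G FG; have [uFG rFG] := fur_agree _ _ _ FG.
  have ouFG : agree d (fopp (fu F)) (fopp (fu G)) by move=> i m md; rewrite /fopp uFG.
  have id_agree : agree d (fadd Id (fopp (fu F))) (fadd Id (fopp (fu G))) by apply: agree_fadd.
  move=> i m md; apply: (f_equal2 (fun x y => x - y)).
    have := agree_comp S2 (order_ge_fid_add (fou2 F)) (order_ge_fid_add (fou2 G)) id_agree.
    move=> e; exact: (e i m md).
  have [[_ rF2] [_ rG2]] := (fur2 F, fur2 G).
  have := agree_jacobian (fou2 F) (fou2 G) rF2 rG2 ouFG rFG.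
  by move=> e; exact: (e i m md).
have [_ V2] := fur2 W; have U2 := fou2 W; pose U := fopp (fu W); pose V := fr W.
have U1 := order_ge_fid_add U2.
have W2 : order_ge 2 W.
  move=> i m m2; rewrite -TW /T /fsub (order_ge_fcomp S2 U1 i m2).
  by rewrite (order_ge_jacobian U2 V2) ?subr0 // (leq_trans m2).
exists U, V; split=> //; first 1 last.
- exact: frK.
- exists (2 * n.+1%:R) => [|d d2].
    by rewrite mulr_ege1 ?ler1n.
  have WUV : \sum_i nrm d (W i) <= \sum_i nrm d (fcomp S (fadd Id U) i)
                        + \sum_i nrm d (jacobian_apply U V i).
    rewrite -big_split; apply: ler_sum => i _ /=; rewrite -TW /T /fsub.
    by apply: le_trans (nrmD _ _ _) _; rewrite nrmN.
  apply: le_trans (ler_wpM2l _ WUV); last by rewrite mulr_ge0 ?ler0n.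
  apply: (@le_trans _ _ (\sum_(i < n) (2 * \sum_j nrm d (W j)))).
    apply: ler_sum => i _; have [ule rle] := fur_nrm W d i.
    by rewrite mulr_natl mulr2n; apply: lerD => //; rewrite /U /fopp nrmN.
  have -> : \sum_(i < n) 2 * \sum_j nrm d (W j) = 2 * n%:R * \sum_j nrm d (W j).
    by rewrite big_const_ord iter_addr_0 -[LHS]mulr_natr mulrAC.
  apply: ler_wpM2r.
    by apply: sumr_ge0 => j _; apply: nrm_ge0.
  by apply: ler_wpM2l; rewrite ?ler0n // ler_nat.
rewrite jacobian_faddl jacobian_fid jacobian_faddr (fcomp_faddl _ _ U1).
rewrite (fcomp_flinear a U1) lcomb_fadd -flinear_lcomb.
apply: ftuple_eq => i m; rewrite /fadd.
have WEi := WE W W2 i m.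
have : fcomp S (fadd Id U) i m - jacobian_apply U V i m = W i m by rewrite -[in RHS]TW.
rewrite WEi -/V.
have -> : jacobian_apply U (flinear a) i m = - jacobian_apply (fu W) (flinear a) i m.
  by rewrite /U jacobian_fopp.
have -> : lcomb a U i m = - lcomb a (fu W) i m.
  by rewrite /lcomb -sumrN; apply: eq_bigr => j _; rewrite /U /fopp mulrN.
move=> E; rewrite -[fcomp S _ i m](subrK (jacobian_apply U V i m)) E; ring.
Qed.

End Normalization.

(** * Gevrey series under linear changes of coordinates *)

Section GevreyLinear.
Variables (R : realType) (n : nat).
Local Notation C := R[i].
Local Notation Id := (@fid R n).
Import Normc.
Implicit Types (F G U V W : ftuple R n) (Q : 'M[C]_n) (alpha : R).

Lemma fcomp_lcomb Q F G : order_ge 1 F -> order_ge 1 G ->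
  fcomp (lcomb Q F) G = lcomb Q (fcomp F G).
Proof.
move=> F1 G1; rewrite -(fcomp_flinear Q F1) (fcompA _ F1 G1).
by apply: fcomp_flinear; apply: order_ge_fcomp.
Qed.

Lemma l1_ge0 k (f : fps R n) : 0 <= l1 k f.
Proof. by apply: sumr_ge0 => m _; apply: normc_ge0. Qed.

Lemma gevrey_fadd alpha F G : gevrey alpha F -> gevrey alpha G -> gevrey alpha (fadd F G).
Proof.
move=> /gevreyP[B [r [B0 r1 Fk]]] /gevreyP[B' [r' [B'0 r'1 Gk]]]; apply/gevreyP.
have r0 := le_trans ler01 r1; have r'0 := le_trans ler01 r'1.
exists (B + B'), (r * r'); split=> [||k]; [exact: addr_gt0 | exact: mulr_ege1 |].
apply: (@le_trans _ _ (\sum_i l1 k (F i) + \sum_i l1 k (G i))).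
  rewrite -big_split; apply: ler_sum => i _ /=; rewrite /l1 -big_split.
  by apply: ler_sum => m _; apply: le_normcD.
rewrite !mulrDl; apply: lerD.
  apply: le_trans (Fk k) _; rewrite ler_wpM2r ?gw_ge0 // ler_wpM2l ?(ltW B0) //.
  by rewrite lerXn2r ?nnegrE ?mulr_ge0 // ler_peMr.
apply: le_trans (Gk k) _; rewrite ler_wpM2r ?gw_ge0 // ler_wpM2l ?(ltW B'0) //.
by rewrite lerXn2r ?nnegrE ?mulr_ge0 // ler_peMl.
Qed.

Lemma gevrey_lcomb alpha Q F : gevrey alpha F -> gevrey alpha (lcomb Q F).
Proof.
move=> /gevreyP[B [r [B0 r1 Fk]]]; apply/gevreyP; have r0 := le_trans ler01 r1.
pose q := \sum_i \sum_j normc (Q i j).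
have q0 : 0 <= q by do 2![apply: sumr_ge0 => ? _]; apply: normc_ge0.
exists ((1 + q) * B), r; split=> // [|k]; first by apply: mulr_gt0 => //; apply: ltr_pwDl.
rewrite -2!mulrA; apply: (@le_trans _ _ (q * \sum_j l1 k (F j))).
  rewrite /q mulr_suml; apply: ler_sum => i _; rewrite mulr_suml.
  apply: (@le_trans _ _ (\sum_j normc (Q i j) * l1 k (F j))).
    rewrite /l1; under [leRHS]eq_bigr do rewrite mulr_sumr.
    rewrite exchange_big; apply: ler_sum => m _; apply: le_trans (normc_sum _ _ _) _.
    by apply: ler_sum => j _; rewrite normcM.
  apply: ler_sum => j _; apply: ler_wpM2l; first exact: normc_ge0.
  by rewrite (bigD1 j) //= lerDl sumr_ge0 // => u _; apply: l1_ge0.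
apply: (@le_trans _ _ (q * (B * r ^+ k * gw alpha k))).
  by apply: ler_wpM2l => //; apply: Fk.
rewrite -!mulrA; apply: ler_wpM2r; last by rewrite lerDr.
by rewrite !mulr_ge0 ?gw_ge0 ?exprn_ge0 // ltW.
Qed.

Lemma gevrey_flinear alpha Q : gevrey alpha (flinear Q).
Proof.
pose b := \sum_i l1 1 (flinear Q i).
have b0 : 0 <= b by apply: sumr_ge0 => i _; apply: l1_ge0.
apply/gevreyP; exists (1 + b), 1; split=> // [|k]; first exact: ltr_pwDl.
rewrite expr1n mulr1; have [->|k1] := eqVneq k 1%N.
  by rewrite gw1 mulr1 lerDr.
rewrite big1 => [|i _]; first by rewrite mulr_ge0 ?gw_ge0 ?addr_ge0.
rewrite /l1 big_seq big1 // => m; rewrite mem_mons => /eqP mk.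
rewrite flinear_coef big1 ?normc0 // => j _.
case: eqP => [mj|_]; last by rewrite mulr0.
by case/eqP: k1; rewrite -mk mj mdeg1.
Qed.

(** A linear substitution multiplies the weighted norm of every monomial by a
    factor that is geometric in the degree, hence keeps the Gevrey order. *)
Lemma gevrey_comp_flinear alpha F Q : 0 <= alpha -> order_ge 2 F ->
  gevrey alpha F -> gevrey alpha (fcomp F (flinear Q)).
Proof.
move=> a0 F2 /(gevrey_pred a0 (lexx alpha))[B [r [B0 r1 Fk]]].
have r0 : 0 < r by apply: lt_le_trans r1.
pose c := 1 + \sum_i nrm 1 (flinear Q i).
have c0 : 0 < c by apply: ltr_pwDl => //; apply: sumr_ge0 => i _; apply: nrm_ge0.
(* With this [tau], the ratio [r * c * tau] of the geometric series is 1/2. *)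
pose tau := (2 * r * c)^-1; have tau0 : 0 < tau by rewrite invr_gt0 !mulr_gt0.
have Q1 := order_ge_flinear Q.
apply: (gevrey_nrm (B := B) (r := tau^-1)) => //; first by rewrite invr_gt0.
move=> D i; have [D2|D2] := ltnP D 2.
  rewrite nrm0 => [|m mD]; last by rewrite (order_ge_fcomp F2 Q1) // mD.
  apply: mulr_ge0 (gw_ge0 _ _); apply: mulr_ge0; first exact: ltW.
  by rewrite exprn_ge0 // invr_ge0 ltW.
pose p := trunc D (F i) \mPo trunc_map D (flinear Q).
rewrite (@eq_nrm _ _ _ _ (fps_of_mpoly p)) => [|m mD]; last first.
  by rewrite /fcomp (approx_comp_trunc _ Q1 (D := D)) ?mD.
have snorm_p : snorm alpha tau D 1 (fps_of_mpoly p) <= B.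
  apply: (@le_trans _ _ (\sum_(k < D.+1 | (2 <= k)%N) l1 k (F i) * (c * tau) ^+ k / gw alpha k.-1)).
    apply: snorm_comp => // [m|||j].
    - exact: F2.
    - by rewrite mulr_ge0 ?ltW.
    - by move=> j; apply: trunc_map_mord.
    apply: (@le_trans _ _ (snorm alpha tau D 1 (flinear Q j))).
      rewrite le_eqVlt (@eq_snorm _ _ _ _ _ _ _ (flinear Q j)) ?eqxx // => m mD.
      by rewrite /fps_of_mpoly tnth_mktuple trunc_coef mD.
    have i1 : (inord 1 : 'I_D.+1) = 1%N :> nat by rewrite inordK // ltnS ltnW.
    rewrite /snorm (bigD1 (inord 1)) /= ?i1 //.
    rewrite big1 ?addr0 => [|d /andP[d0 d1]].
      rewrite subnn gw0 divr1 expr1; apply: ler_wpM2r; first exact: ltW.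
      rewrite /c (bigD1 j) //= addrCA lerDl addr_ge0 // sumr_ge0 // => u _.
      exact: nrm_ge0.
    rewrite nrm0 ?mul0r // => m md; rewrite flinear_coef big1 // => u _.
    case: eqP => [mu|_]; last by rewrite mulr0.
    by case/eqP: d1; apply/val_inj; rewrite /= i1 -md mu mdeg1.
  apply: (@le_trans _ _ (\sum_(k < D.+1 | (2 <= k)%N) B * (1 / 2) ^+ k)).
    apply: ler_sum => k k2; rewrite ler_pdivrMr ?gw_gt0 //.
    have Fki : l1 k (F i) <= B * r ^+ k * gw alpha k.-1.
      apply: le_trans (Fk k _); last exact: ltnW.
      by rewrite (bigD1 i) //= lerDl sumr_ge0 // => u _; apply: l1_ge0.
    apply: le_trans (ler_wpM2r _ Fki) _; first by rewrite exprn_ge0 ?mulr_ge0 ?ltW.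
    have -> : (1 / 2 : R) ^+ k = r ^+ k * (c * tau) ^+ k.
      by rewrite -exprMn; congr (_ ^+ _); rewrite /tau; field; rewrite !gt_eqF.
    by rewrite le_eqVlt; apply/orP; left; apply/eqP; ring.
  rewrite -mulr_sumr ler_piMr ?(ltW B0) //.
  apply: le_trans (sum_geometric_le _ _ _) _; lra.
have : nrm D (fps_of_mpoly p) * tau ^+ D / gw alpha D.-1 <= B.
  have D1 : (1 <= D)%N := ltnW D2.
  apply: le_trans snorm_p; rewrite /snorm (bigD1 ord_max) //= subn1.
  rewrite lerDl sumr_ge0 // => d _.
  by rewrite divr_ge0 ?gw_ge0 // mulr_ge0 ?nrm_ge0 ?tauX_ge0.
rewrite ler_pdivrMr ?gw_gt0 // -ler_pdivlMr ?exprn_gt0 // => le_p.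
apply: le_trans le_p _; rewrite -[leLHS]mulrA -[leRHS]mulrA.
apply: ler_wpM2l; first exact: ltW.
rewrite (exprVn tau) [leLHS]mulrC; apply: ler_wpM2l; last by rewrite gw_mono ?leq_pred.
by rewrite invr_ge0 exprn_ge0 ?(ltW tau0).
Qed.

Lemma gevrey_fopp alpha F : gevrey alpha F -> gevrey alpha (fopp F).
Proof.
move=> /gevreyP[B [r [B0 r1 Fk]]]; apply/gevreyP; exists B, r; split=> // k.
apply: le_trans (Fk k); apply: ler_sum => i _; apply: ler_sum => m _.
by rewrite /fopp normcN.
Qed.

(** The equation satisfied by [W] is an instance of the hypothesis of the
    Gevrey estimate, without derivative term. *)
Lemma gevrey_inverse alpha U W : 0 <= alpha -> order_ge 2 U -> order_ge 2 W ->
  W = fcomp (fopp U) (fadd Id W) -> gevrey alpha U -> gevrey alpha W.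
Proof.
move=> a0 U2 W2 WE Ug; pose Z : ftuple R n := fun _ _ => 0.
have [] // := @gevrey_estimate R n alpha alpha 1 (fopp U) W Z a0 (lexx _) (lexx _).
- by move=> i m m2; rewrite /fopp U2 ?oppr0.
- exact: gevrey_fopp.
- move=> d d2; rewrite mul1r /size2.
  apply: (@le_trans _ _ (\sum_i nrm d (fcomp (fopp U) (fadd Id W) i))).
    by rewrite -WE; apply: ler_sum => i _; rewrite (@nrm0 _ _ _ (Z i)) ?addr0.
  by rewrite lerDl sumr_ge0 // => i _; apply: nrm_ge0.
- by right.
Qed.

End GevreyLinear.

(** * Rigidity of linear normal forms *)

Section Rigidity.
Variables (R : realType) (n : nat).
Local Notation C := R[i].
Local Notation Id := (@fid R n).
Local Open Scope sesquilinear_scope.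
Implicit Types (U V W : ftuple R n) (d : nat).

Lemma vinner_eq0 d (V : pvf R n) : in_V d V -> vinner d V V = 0 -> V = (fun=> 0).
Proof.
move=> Vd VV; have hge0 i : 0 <= hinner d.+1 (V i) (V i).
  rewrite hinnerE; apply: sumr_ge0 => m _; rewrite mulr_ge0 ?mul_conjC_ge0 //.
  by rewrite /bweightC lecR bweight_ge0.
apply: boolp.funext => i; apply/mpolyP => m; rewrite mcoeff0.
have [md|md] := eqVneq (mdeg m) d.+1; last exact: (dhomog_nemf_coeff (Vd i)).
have /(_ i) := psumr_eq0P (fun i _ => hge0 i) VV isT.
rewrite hinnerE => /eqP; rewrite psumr_eq0 => [|k _]; last first.
  by rewrite mulr_ge0 ?mul_conjC_ge0 // /bweightC lecR bweight_ge0.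
move=> /allP/(_ m); rewrite mem_mons md eqxx /= => /(_ isT).
rewrite mulf_eq0 => /orP[|]; first by rewrite mul_conjC_eq0 => /eqP.
by rewrite /bweightC fmorph_eq0 gt_eqF ?bweight_gt0.
Qed.

(** By induction on the degree: if the parts of [V] of lower degree vanish,
    [DW.V] has higher order, and the homogeneous part of [V] is [theta a] of
    that of [W]. As it is also in the kernel of the adjoint, it is orthogonal
    to itself. *)
Lemma linear_of_linearizable (a : 'M[C]_n) V W :
    order_ge 2 V -> order_ge 2 W ->
    (forall d, (0 < d)%N -> theta (a^t*) (hpart d.+1 V) = (fun=> 0)) ->
    jacobian_apply (fadd Id W) (fadd (flinear a) V) = lcomb a (fadd Id W) ->
  forall i m, V i m = 0.
Proof.
move=> V2 W2 VK WE.
have VW i m : V i m = lcomb a W i m - jacobian_apply W (flinear a) i m - jacobian_apply W V i m.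
  have := congr1 (fun F : ftuple R n => F i m) WE.
  rewrite jacobian_faddl jacobian_fid jacobian_faddr lcomb_fadd -flinear_lcomb /fadd => E.
  apply: (addrI (flinear a i m)); rewrite -[in RHS]addrA -opprD addrA -E; ring.
have V_order d : order_ge d.+2 V.
  elim: d => // d Vd i m; rewrite ltnS leq_eqVlt => /orP[/eqP md|]; last exact: Vd.
  suff : hpart d.+2 V i = 0.
    by move/(congr1 (mcoeff m)); rewrite hpart_coef md eqxx mcoeff0.
  suff -> : hpart d.+2 V = (fun=> 0) by [].
  apply: (@vinner_eq0 d.+1); first exact: in_V_hpart.
  have {1}-> : hpart d.+2 V = theta a (hpart d.+2 W).
    apply: boolp.funext => j; apply/mpolyP => k; rewrite hpart_coef /theta mcoeffB raddf_sum.
    case: eqP => kd; last first.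
      rewrite lie_coef0 ?subr0 => [|u uk]; last by rewrite hpart_coef uk; case: eqP.
      by rewrite big1 // => u _ /=; rewrite mcoeffZ hpart_coef; case: eqP; rewrite ?mulr0.
    rewrite VW (order_ge_jacobian W2 Vd) ?subr0 ?kd //; congr (_ - _); last first.
      by rewrite jacobian_flinear kd.
    by apply: eq_bigr => u _ /=; rewrite mcoeffZ hpart_coef kd eqxx.
  rewrite theta_adjoint VK // /vinner big1 // => j _.
  by rewrite hinnerE big1 // => k _; rewrite mcoeff0 rmorph0 mulr0 mul0r.
by move=> i m; apply: (V_order (mdeg m)); rewrite ltnS leqnSn.
Qed.

End Rigidity.

Theorem theorem1 (R : realType) (n : nat) (alpha : R) (X : ftuple R n)
    (N : pvf R n) (S : ftuple R n) (n_ge1 : (1 <= n)%N) (alpha_ge0 : 0 <= alpha)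
    (N_linear : in_V 0 N) (N_nilpotent : nilpotent_vf N)
    (S_order : order_ge 2 S) (X_def : X = fadd (ftuple_of_pvf N) S)
    (X_gevrey : gevrey alpha X) :
  (exists Phi Y : ftuple R n,
     [/\ formal_transformation Phi, gevrey (1 + alpha) Phi,
         is_pushforward Phi X Y, normal_form Y & gevrey (1 + alpha) Y]) /\
  (formally_linearizable X N ->
   exists Phi Y : ftuple R n,
     [/\ formal_transformation Phi, gevrey alpha Phi,
         is_pushforward Phi X Y, normal_form Y & gevrey alpha Y]).
Proof.
have [b NE] : exists b, N = linvf b.
  exists (\matrix_(i, j) (N i)@_(U_(j))); apply: boolp.funext => i; apply/mpolyP => m.
  rewrite /linvf raddf_sum /=; have [m1|m1] := eqVneq (mdeg m) 1%N.
    have /existsP[j /eqP mj] : [exists j, m == U_(j)%MM] by rewrite -mdeg_eq1 m1.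
    rewrite mj (bigD1 j) //= mcoeffZ mcoeffX eqxx mulr1 mxE big1 ?addr0 // => l lj.
    rewrite mcoeffZ mcoeffX; case: eqP => [E|_]; last by rewrite mulr0.
    have := congr1 (fun k : 'X_{1..n} => k l) E.
    by rewrite !mnm1E eqxx eq_sym (negbTE lj).
  rewrite (dhomog_nemf_coeff (N_linear i)) //= big1 // => l _.
  rewrite mcoeffZ mcoeffX; case: eqP => [E|_]; last by rewrite mulr0.
  by case/eqP: m1; rewrite -E mdeg1.
rewrite NE in N_nilpotent X_def *.
have {}X_def : X = fadd (flinear b) S by [].
have [P [a [h [Pu Pb a_std aa ha]]]] := nilpotent_standard_form N_nilpotent.
have bP : invmx P *m a = b *m invmx P.
  by rewrite -[a](mulmxK Pu) -Pb -mulmxA mulKmx.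
(* The nonlinear part in the coordinates in which the linear part is [a]. *)
pose S' := lcomb P (fcomp S (flinear (invmx P))).
have S'2 : order_ge 2 S'.
  apply: order_ge_lcomb; apply: order_ge_fcomp => //; exact: order_ge_flinear.
have [U [V [U2 V2 UV VK [K K1 size_le]]]] := normalization aa ha S'2.
have [W [W2 WE [Psi1 phi1 Psiphi phiPsi]]] := tangent_inverse U2.
(* [G] is the inverse of the transformation [Phi]. *)
pose phi := fadd (@fid R n) U; pose Psi := fadd (@fid R n) W.
pose Phi := fcomp Psi (flinear P); pose G := lcomb (invmx P) phi.
pose Y := fadd (flinear a) V.
have S1 : order_ge 1 S := order_ge_le (leqnSn 1) S_order.
have P1 := order_ge_flinear P; have iP1 := order_ge_flinear (invmx P).
have G1 : order_ge 1 G by apply: order_ge_lcomb.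
have PG : lcomb P G = phi by rewrite /G lcombM mulmxV // lcomb1.
have PhiG : inverse_map Phi G.
  split; [exact: order_ge_fcomp | exact: G1 | |].
    rewrite /Phi (fcompA _ P1 G1) (fcomp_flinear P G1) PG; exact: Psiphi.
  have Phi1 : order_ge 1 Phi by apply: order_ge_fcomp.
  have phiPhi : fcomp phi Phi = flinear P.
    transitivity (fcomp (fcomp phi Psi) (flinear P)).
      by symmetry; exact: (fcompA phi Psi1 P1).
    by have -> : fcomp phi Psi = fid R (n:=n) := phiPsi; exact: fcomp_idl.
  transitivity (fcomp (fcomp (flinear (invmx P)) phi) Phi).
    exact: (f_equal (fun F => fcomp F Phi) (esym (fcomp_flinear (invmx P) phi1))).
  by rewrite (fcompA (flinear (invmx P)) phi1 Phi1) phiPhi flinear_mul mulVmx.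
have GY : jacobian_apply G Y = fcomp X G.
  rewrite /G jacobian_lcomb UV X_def -/G.
  rewrite (fcomp_faddl _ _ phi1) (fcomp_flinear a phi1) lcomb_fadd lcombM bP.
  rewrite (fcomp_faddl _ _ G1) (fcomp_flinear b G1) /G lcombM.
  congr fadd; rewrite /S' (fcomp_lcomb _ (order_ge_fcomp S1 iP1) phi1) lcombM.
  rewrite (mulVmx Pu); transitivity (fcomp (fcomp S (flinear (invmx P))) phi).
    exact: lcomb1.
  transitivity (fcomp S (fcomp (flinear (invmx P)) phi)).
    exact: (fcompA S iP1 phi1).
  exact: (f_equal (fcomp S) (fcomp_flinear (invmx P) phi1)).
have Phi_formal : formal_transformation Phi.
  exists Psi, phi, U, P; split; [exact: Pu | exact: U2 | exact: erefl | | exact: erefl].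
  by split; [exact: Psi1 | exact: phi1 | exact: Psiphi | exact: phiPsi].
have push : is_pushforward Phi X Y by apply: is_pushforward_of_inverse GY.
have Y_normal : normal_form Y.
  exists (linvf a), V; split; [exact: a_std | exact: V2 | exact: erefl | move=> d d0].
  exists (theta (a^t*)%sesqui); split.
    exact: theta_is_adjoint.
  exact: VK.
have S'_gevrey : gevrey alpha S'.
  apply/gevrey_lcomb/gevrey_comp_flinear => //.
  have -> : S = fadd X (fopp (flinear b)).
    by rewrite X_def; apply: ftuple_eq => i m; rewrite /fadd /fopp addrAC subrr add0r.
  apply: gevrey_fadd => //; exact/gevrey_fopp/gevrey_flinear.
(* The same [U] and [V] serve in both parts: only the estimate differs. *)
have finish beta : alpha <= beta -> 1 <= beta \/ (forall i m, V i m = 0) ->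
    gevrey beta Phi /\ gevrey beta Y.
  move=> ab V0; have b0 := le_trans alpha_ge0 ab.
  have [Ug Vg] := gevrey_estimate alpha_ge0 ab K1 S'2 U2 V2 S'_gevrey size_le V0.
  split; last by apply: gevrey_fadd => //; apply: gevrey_flinear.
  rewrite /Phi /Psi (fcomp_faddl _ _ P1) (fcomp_idl P1).
  apply: gevrey_fadd; first exact: gevrey_flinear.
  apply: gevrey_comp_flinear => //.
  exact: gevrey_inverse WE Ug.
split=> [|[Phi0 [_ [U0 U02 Phi0E] push0]]].
  have [||Phig Yg] := finish (1 + alpha); first by rewrite lerDr.
    by left; rewrite lerDl.
  exists Phi, Y; split; [exact: Phi_formal | exact: Phig | exact: push | | exact: Yg].
  exact: Y_normal.
have V0 : forall i m, V i m = 0.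
  (* Composing the linearization of [X] with [G] and [P] linearizes [Y] by a map
     [I + Wlin] tangent to the identity. *)
  pose Wlin := fadd U (lcomb P (fcomp U0 G)).
  have Wlin2 : order_ge 2 Wlin.
    by apply: (order_ge_fadd U2); apply: order_ge_lcomb; exact: (order_ge_fcomp U02 G1).
  apply: (linear_of_linearizable V2 Wlin2 VK).
  have Phi01 : order_ge 1 Phi0 by rewrite Phi0E; apply: order_ge_fid_add.
  have chiE : fadd (@fid R n) Wlin = lcomb P (fcomp Phi0 G).
    rewrite Phi0E (fcomp_faddl _ _ G1) (fcomp_idl G1) lcomb_fadd PG.
    by apply: ftuple_eq => i m; rewrite /fadd /Wlin /phi /fadd addrA.
  rewrite chiE jacobian_lcomb (jacobian_fcomp _ G1 GY) (pushforward_jacobian push0).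
  rewrite -[ftuple_of_pvf _]/(flinear b) (fcomp_flinear b Phi01).
  by rewrite (fcomp_lcomb _ Phi01 G1) !lcombM Pb.
have [|Phig Yg] := finish alpha (lexx _); first by right.
exists Phi, Y; split; [exact: Phi_formal | exact: Phig | exact: push | | exact: Yg].
exact: Y_normal.
Qed.
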